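(* Let $\mathcal{M}$ be a finite unitary magma. The operad $\mathrm{NC}\mathcal{M}$ is binary, quadratic, and Koszul, and admits the presentation $\mathrm{NC}\mathcal{M}\simeq\mathrm{Free}(\mathcal{T}_\mathcal{M})/\langle\mathfrak{R}\rangle$, where $\mathrm{Free}(\mathcal{T}_\mathcal{M})$ is the free operad on the set $\mathcal{T}_\mathcal{M}$ of $\mathcal{M}$-triangles placed in arity $2$, and $\mathfrak{R}$ is the space of relations spanned by, for all $\mathfrak{p}_1,\mathfrak{p}_2,\mathfrak{p}_3,\mathfrak{q}_1,\mathfrak{q}_2,\mathfrak{q}_3,\mathfrak{r}_1,\mathfrak{r}_2,\mathfrak{r}_3\in\mathcal{M}$: (a) $\mathfrak{p}_1\mathfrak{p}_2\mathfrak{p}_3\circ_1\mathfrak{q}_1\mathfrak{q}_2\mathfrak{q}_3-\mathfrak{p}_1\mathfrak{r}_2\mathfrak{p}_3\circ_1\mathfrak{r}_1\mathfrak{q}_2\mathfrak{q}_3$ whenever $\mathfrak{p}_2\star\mathfrak{q}_1=\mathfrak{r}_2\star\mathfrak{r}_1\neq\mathds{1}_\mathcal{M}$; (b) $\mathfrak{p}_1\mathfrak{p}_2\mathfrak{p}_3\circ_1\mathfrak{q}_1\mathfrak{q}_2\mathfrak{q}_3-\mathfrak{p}_1\mathfrak{q}_2\mathfrak{r}_3\circ_2\mathfrak{r}_1\mathfrak{q}_3\mathfrak{p}_3$ whenever $\mathfrak{p}_2\star\mathfrak{q}_1=\mathfrak{r}_3\star\mathfrak{r}_1=\mathds{1}_\mathcal{M}$;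 (c) $\mathfrak{p}_1\mathfrak{p}_2\mathfrak{p}_3\circ_2\mathfrak{q}_1\mathfrak{q}_2\mathfrak{q}_3-\mathfrak{p}_1\mathfrak{p}_2\mathfrak{r}_3\circ_2\mathfrak{r}_1\mathfrak{q}_2\mathfrak{q}_3$ whenever $\mathfrak{p}_3\star\mathfrak{q}_1=\mathfrak{r}_3\star\mathfrak{r}_1\neq\mathds{1}_\mathcal{M}$.
   Context: A unitary magma is a set $\mathcal{M}$ with a binary operation $\star$ admitting a two-sided unit $\mathds{1}_\mathcal{M}$. For $n\geq 1$, an $\mathcal{M}$-clique of size $n$ is a complete graph $\mathfrak{p}$ on the vertex set $[n+1]$ with a labeling of each arc $(x,y)$, $1\le x<y\le n+1$, by $\mathfrak{p}(x,y)\in\mathcal{M}$; $(1,n+1)$ is the base, $(i,i+1)$ ($1\le i\le n$) is the $i$-th edge, and all other arcs are diagonals. An arc is solid if its label is not $\mathds{1}_\mathcal{M}$. Two diagonals $(x,y),(x',y')$ cross if $x<x'<y<y'$ or $x'<x<y'<y$. The operad $\mathrm{C}\mathcal{M}=\bigoplus_{n\ge1}\mathrm{C}\mathcal{M}(n)$ over a field of characteristic zero has $\mathrm{C}\mathcal{M}(1)$ spanned by the clique $\mathbf{u}$ of size 1 with base labeled $\mathds{1}_\mathcal{M}$ (the unit) and $\mathrm{C}\mathcal{M}(n)$, $n\ge2$, with basis all $\mathcal{M}$-cliques of size $n$. For $\mathfrak{p}$ of size $n$, $\mathfrak{q}$ of size $m$, $i\in[n]$, $\mathfrak{p}\circ_i\mathfrak{q}$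 is the $\mathcal{M}$-clique of size $n+m-1$ obtained by gluing the base of $\mathfrak{q}$ onto the $i$-th edge of $\mathfrak{p}$: vertex $x$ of $\mathfrak{p}$ becomes $x$ if $x\le i$ and $x+m-1$ if $x\ge i+1$, vertex $y$ of $\mathfrak{q}$ becomes $y+i-1$; arcs of $\mathfrak{p}$ other than its $i$-th edge and arcs of $\mathfrak{q}$ other than its base keep their labels, the arc $(i,i+m)$ gets label $\mathfrak{p}(i,i+1)\star\mathfrak{q}(1,m+1)$, and all other arcs get $\mathds{1}_\mathcal{M}$; extended bilinearly. $\mathrm{NC}\mathcal{M}$ is the suboperad of $\mathrm{C}\mathcal{M}$ spanned by $\mathbf{u}$ and all $\mathcal{M}$-cliques having no two crossing solid diagonals. An $\mathcal{M}$-triangle is an $\mathcal{M}$-clique of size 2; the triangle $\mathfrak{p}$ with $\mathfrak{p}(1,3)=\mathfrak{p}_1$, $\mathfrak{p}(1,2)=\mathfrak{p}_2$, $\mathfrak{p}(2,3)=\mathfrak{p}_3$ is written as the word $\mathfrak{p}_1\mathfrak{p}_2\mathfrak{p}_3\in\mathcal{M}^3$; $\mathcal{T}_\mathcal{M}$ is the set of all $\mathcal{M}$-triangles. In the relations, $\circ_1,\circ_2$ denote partial compositions in the free operad. *)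

(* Defs.v *)
From HB Require Import structures.
From mathcomp Require Import all_boot all_algebra.
From mathcomp Require Import ring_quotient boolp zify.

Set Implicit Arguments.
Unset Strict Implicit.
Unset Printing Implicit Defensive.

Import GRing.Theory.
Local Open Scope ring_scope.
Local Open Scope quotient_scope.

(* Arities are shifted by one: the component of index n of an operad is its
   component of arity n + 1, so that a partial composition goes from the
   components n and m to the component n + m and no arity 0 arises.  Inputs
   are numbered from 0: the usual composition x o_1 y is x o_(0) y here, and
   for x of index n the composition x o_(i) y is meaningful for i <= n only. *)

(* ** Nonsymmetric set operads *)

Record setOperad := SetOperad {
  so_sort :> nat -> finType;
  so_unit : so_sort 0;
  so_comp : forall n m, so_sort n -> nat -> so_sort m -> so_sort (n + m);
  so_unitl : forall n (y : so_sort n), so_comp so_unit 0 y = y;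
  so_unitr : forall n (x : so_sort n) i, (i <= n)%N ->
    so_comp x i so_unit = ecast k (so_sort k) (esym (addn0 n)) x;
  so_seq : forall n m p (x : so_sort n) (y : so_sort m) (z : so_sort p) i j,
    (i <= n)%N -> (j <= m)%N ->
    so_comp (so_comp x i y) (i + j) z
    = ecast k (so_sort k) (addnA n m p) (so_comp x i (so_comp y j z));
  so_par : forall n m p (x : so_sort n) (y : so_sort m) (z : so_sort p) i j,
    (i < j)%N -> (j <= n)%N ->
    so_comp (so_comp x i y) (j + m) z
    = ecast k (so_sort k) (addnAC n p m) (so_comp (so_comp x j z) i y)
}.

Section SubSetOperad.
Variables (S : setOperad) (P : forall n, pred (S n)).
Hypothesis P1 : P (so_unit S).
Hypothesis Pcomp : forall n m (x : S n) (y : S m) i, (i <= n)%N ->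
  P x -> P y -> P (so_comp x i y).

Definition sub_sort n : finType := {x : S n | P x}.

(* The value outside of the meaningful range i <= n is irrelevant. *)
Lemma sub_comp_subproof n m (x : sub_sort n) i (y : sub_sort m) :
  P (so_comp (val x) (minn i n) (val y)).
Proof. by apply: Pcomp; [exact: geq_minr | exact: valP | exact: valP]. Qed.

Definition sub_comp n m (x : sub_sort n) i (y : sub_sort m) : sub_sort (n + m) :=
  Sub (so_comp (val x) (minn i n) (val y)) (sub_comp_subproof x i y).

Lemma val_sub_comp n m (x : sub_sort n) i (y : sub_sort m) :
  (i <= n)%N -> val (sub_comp x i y) = so_comp (val x) i (val y).
Proof. by move=> /= /minn_idPl ->. Qed.

Lemma val_sub_cast n m (e : n = m) (x : sub_sort n) :
  val (ecast k (sub_sort k) e x) = ecast k (S k) e (val x).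
Proof. by case: m / e. Qed.

Definition sub_set_operad : setOperad.
Proof.
apply: (@SetOperad sub_sort (Sub (so_unit S) P1) sub_comp).
- by move=> n y; apply: val_inj; rewrite val_sub_comp // SubK so_unitl.
- move=> n x i le_in; apply: val_inj.
  by rewrite val_sub_comp // val_sub_cast SubK so_unitr.
- move=> n m p x y z i j le_in le_jm; apply: val_inj.
  by rewrite val_sub_cast !val_sub_comp ?so_seq // leq_add.
- move=> n m p x y z i j lt_ij le_jn; apply: val_inj.
  have le_in : (i <= n)%N := leq_trans (ltnW lt_ij) le_jn.
  rewrite val_sub_cast !val_sub_comp ?so_par ?leq_add2r //.
  exact: leq_trans (leq_addr _ _).
Defined.

End SubSetOperad.

(* ** Nonsymmetric operads in vector spaces *)

Record operad (K : fieldType) := Operad {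
  op_sort :> nat -> lmodType K;
  op_unit : op_sort 0;
  op_comp : forall n m, op_sort n -> nat -> op_sort m -> op_sort (n + m);
  op_compl : forall n m i (y : op_sort m), (i <= n)%N ->
    linear (fun x : op_sort n => op_comp x i y);
  op_compr : forall n m i (x : op_sort n), (i <= n)%N ->
    linear (fun y : op_sort m => op_comp x i y);
  op_unitl : forall n (y : op_sort n), op_comp op_unit 0 y = y;
  op_unitr : forall n (x : op_sort n) i, (i <= n)%N ->
    op_comp x i op_unit = ecast k (op_sort k) (esym (addn0 n)) x;
  op_seq : forall n m p (x : op_sort n) (y : op_sort m) (z : op_sort p) i j,
    (i <= n)%N -> (j <= m)%N ->
    op_comp (op_comp x i y) (i + j) z
    = ecast k (op_sort k) (addnA n m p) (op_comp x i (op_comp y j z));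
  op_par : forall n m p (x : op_sort n) (y : op_sort m) (z : op_sort p) i j,
    (i < j)%N -> (j <= n)%N ->
    op_comp (op_comp x i y) (j + m) z
    = ecast k (op_sort k) (addnAC n p m) (op_comp (op_comp x j z) i y)
}.

Notation "x 'o_(' i ')' y" := (op_comp x i y)
  (at level 40, i at level 99, left associativity,
   format "x  o_( i )  y") : ring_scope.

Section OperadTheory.
Variables (K : fieldType) (O : operad K).

Lemma op_compBl n m (x x' : O n) i (y : O m) : (i <= n)%N ->
  (x - x') o_(i) y = x o_(i) y - x' o_(i) y.
Proof.
move=> le_in; have := op_compl y le_in (- 1) x' x.
by rewrite /= !scaleN1r [- x' + _]addrC [RHS]addrC.
Qed.

Lemma op_compBr n m (x : O n) i (y y' : O m) : (i <= n)%N ->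
  x o_(i) (y - y') = x o_(i) y - x o_(i) y'.
Proof.
move=> le_in; have := op_compr x le_in (- 1) y' y.
by rewrite /= !scaleN1r [- y' + _]addrC [RHS]addrC.
Qed.

End OperadTheory.

Definition isomorphic (K : fieldType) (O P : operad K) : Prop :=
  exists f : forall n, {linear O n -> P n},
    [/\ forall n, bijective (f n),
        f 0 (op_unit O) = op_unit P
      & forall n m (x : O n) i (y : O m), (i <= n)%N ->
          f (n + m)%N (x o_(i) y) = f n x o_(i) f m y].

(* ** Linearization: the vector space on the finite set T is {ffun T -> K^o} *)

Section Delta.
Variables (K : fieldType) (T : finType).

Definition delta (a : T) : {ffun T -> K^o} := [ffun b => (b == a)%:R].

Lemma ffun_delta (x : {ffun T -> K^o}) : x = \sum_a x a *: delta a.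
Proof.
apply/ffunP=> b; rewrite sum_ffunE (bigD1 b) //= !ffunE eqxx [_ *: _]mulr1.
by rewrite big1 ?addr0 // => a ne_ab; rewrite !ffunE eq_sym (negPf ne_ab) [_ *: _]mulr0.
Qed.

Lemma sum_delta (V : lmodType K) (F : T -> V) a :
  \sum_b delta a b *: F b = F a.
Proof.
rewrite (bigD1 a) //= ffunE eqxx scale1r big1 ?addr0 // => b ne_ba.
by rewrite ffunE (negPf ne_ba) scale0r.
Qed.

Lemma linear_delta_ext (V : lmodType K) (f g : {ffun T -> K^o} -> V) :
  linear f -> linear g -> (forall a, f (delta a) = g (delta a)) -> f =1 g.
Proof.
move=> lf lg fg x.
pose mf := GRing.isLinear.Build _ _ _ _ f lf.
pose mg := GRing.isLinear.Build _ _ _ _ g lg.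
pose f' : {linear {ffun T -> K^o} -> V} := HB.pack f mf.
pose g' : {linear {ffun T -> K^o} -> V} := HB.pack g mg.
rewrite -[f x]/(f' x) -[g x]/(g' x) [x]ffun_delta !linear_sum.
by apply: eq_bigr => a _; rewrite !linearZ /= -/(f _) -/(g _) fg.
Qed.

End Delta.

Section Linearization.
Variables (K : fieldType) (S : setOperad).

Definition lin_sort n : lmodType K := {ffun S n -> K^o}.

Definition lin_comp n m (x : lin_sort n) i (y : lin_sort m) : lin_sort (n + m) :=
  \sum_(a : S n) \sum_(b : S m) (x a * y b) *: delta K (so_comp a i b).

Lemma lin_compl n m i (y : lin_sort m) :
  linear (fun x : lin_sort n => lin_comp x i y).
Proof.
move=> c x x'; rewrite /lin_comp scaler_sumr -big_split /=.
apply: eq_bigr => a _; rewrite scaler_sumr -big_split /=.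
by apply: eq_bigr => b _; rewrite !ffunE mulrDl scalerDl scalerA [in RHS]mulrA.
Qed.

Lemma lin_compr n m i (x : lin_sort n) :
  linear (fun y : lin_sort m => lin_comp x i y).
Proof.
move=> c y y'; rewrite /lin_comp scaler_sumr -big_split /=.
apply: eq_bigr => a _; rewrite scaler_sumr -big_split /=.
by apply: eq_bigr => b _; rewrite !ffunE mulrDr scalerDl scalerA mulrCA.
Qed.

Lemma lin_comp_delta n m (a : S n) i (b : S m) :
  lin_comp (delta K a) i (delta K b) = delta K (so_comp a i b).
Proof.
rewrite /lin_comp.
under eq_bigr => a' _ do
  (under eq_bigr => b' _ do rewrite -scalerA; rewrite -scaler_sumr sum_delta).
by rewrite sum_delta.
Qed.

Lemma linear_castT (V : nat -> lmodType K) n m (e : n = m) :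
  linear (fun x : V n => ecast k (V k) e x).
Proof. by case: m / e. Qed.

Lemma cast_delta n m (e : n = m) (a : S n) :
  ecast k (lin_sort k) e (delta K a) = delta K (ecast k (S k) e a).
Proof. by case: m / e. Qed.

Lemma linear_comp (U V W : lmodType K) (f : V -> W) (g : U -> V) :
  linear f -> linear g -> linear (fun x => f (g x)).
Proof. by move=> lf lg c x y; rewrite lg lf. Qed.

Lemma linear_idf (V : lmodType K) : linear (fun x : V => x).
Proof. by []. Qed.

Definition linear_operad : operad K.
Proof.
apply: (@Operad K lin_sort (delta K (so_unit S)) lin_comp).
- by move=> n m i y _; exact: lin_compl.
- by move=> n m i x _; exact: lin_compr.
- move=> n; apply: linear_delta_ext; [exact: lin_compr|exact: linear_idf|].
  by move=> a; rewrite lin_comp_delta so_unitl.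
- move=> n x i le_in; move: x.
  apply: linear_delta_ext; [exact: lin_compl|exact: linear_castT|].
  by move=> a; rewrite lin_comp_delta so_unitr // cast_delta.
- move=> n m p x y z i j le_in le_jm; move: x.
  have lc := @linear_castT lin_sort _ _ (addnA n m p).
  apply: linear_delta_ext => [||a].
  + exact: linear_comp (lin_compl (i + j) z) (lin_compl i y).
  + exact: linear_comp lc (lin_compl i (lin_comp y j z)).
  move: y; apply: linear_delta_ext => [||b].
  + exact: linear_comp (lin_compl (i + j) z) (lin_compr i (delta K a)).
  + exact: linear_comp lc (linear_comp (lin_compr i (delta K a)) (lin_compl j z)).
  move: z; apply: linear_delta_ext => [||c].
  + exact: lin_compr.
  + apply: linear_comp lc _.
    exact: linear_comp (lin_compr i (delta K a)) (lin_compr j (delta K b)).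
  by rewrite !lin_comp_delta so_seq // cast_delta.
- move=> n m p x y z i j lt_ij le_jn; move: x.
  have lc := @linear_castT lin_sort _ _ (addnAC n p m).
  apply: linear_delta_ext => [||a].
  + exact: linear_comp (lin_compl (j + m) z) (lin_compl i y).
  + exact: linear_comp lc (linear_comp (lin_compl i y) (lin_compl j z)).
  move: y; apply: linear_delta_ext => [||b].
  + exact: linear_comp (lin_compl (j + m) z) (lin_compr i (delta K a)).
  + exact: linear_comp lc (lin_compr i (lin_comp (delta K a) j z)).
  move: z; apply: linear_delta_ext => [||c].
  + exact: lin_compr.
  + apply: linear_comp lc _.
    exact: linear_comp (lin_compl i (delta K b)) (lin_compr j (delta K a)).
  by rewrite !lin_comp_delta so_par // cast_delta.
Defined.

End Linearization.

Section SubInclusion.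
Variables (K : fieldType) (S : setOperad) (P : forall n, pred (S n)).
Hypothesis P1 : P (so_unit S).
Hypothesis Pcomp : forall n m (x : S n) (y : S m) i, (i <= n)%N ->
  P x -> P y -> P (so_comp x i y).
Local Notation subS := (sub_set_operad P1 Pcomp).

Definition sub_incl n (x : linear_operad K subS n) : linear_operad K S n :=
  \sum_a x a *: delta K (val a).

Lemma sub_incl_linear n : linear (@sub_incl n).
Proof.
move=> c x y; rewrite /sub_incl scaler_sumr -big_split /=.
by apply: eq_bigr => a _; rewrite !ffunE scalerDl scalerA.
Qed.

Lemma sub_incl_delta n (a : subS n) : sub_incl (delta K a) = delta K (val a).
Proof. exact: sum_delta. Qed.

Lemma sub_incl_inj n : injective (@sub_incl n).
Proof.
have inclE x (a : subS n) : sub_incl x (val a) = x a.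
  rewrite /sub_incl sum_ffunE (bigD1 a) //= !ffunE eqxx [_ *: _]mulr1.
  rewrite big1 ?addr0 // => b ne_ba; rewrite !ffunE (inj_eq val_inj) eq_sym.
  by rewrite (negPf ne_ba) [_ *: _]mulr0.
by move=> x y xy; apply/ffunP=> a; rewrite -!inclE xy.
Qed.

Lemma sub_incl_unit : sub_incl (op_unit (linear_operad K subS))
  = op_unit (linear_operad K S).
Proof. exact: sub_incl_delta. Qed.

Lemma sub_incl_comp n m (x : linear_operad K subS n) i
    (y : linear_operad K subS m) : (i <= n)%N ->
  sub_incl (x o_(i) y) = sub_incl x o_(i) sub_incl y.
Proof.
move=> le_in; move: x; apply: linear_delta_ext => [||a].
- by move=> c u v; rewrite op_compl // sub_incl_linear.
- by move=> c u v; rewrite sub_incl_linear op_compl.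
move: y; apply: linear_delta_ext => [||b].
- by move=> c u v; rewrite op_compr // sub_incl_linear.
- by move=> c u v; rewrite sub_incl_linear op_compr.
by rewrite /= !sub_incl_delta !lin_comp_delta sub_incl_delta -(val_sub_comp Pcomp).
Qed.

End SubInclusion.

(* ** Subspaces, operad ideals and quotients *)

Definition is_subspace (K : fieldType) (V : lmodType K) (W : V -> Prop) : Prop :=
  W 0 /\ forall a x y, W x -> W y -> W (a *: x + y).

Definition span (K : fieldType) (V : lmodType K) (A : V -> Prop) (x : V) : Prop :=
  forall W : V -> Prop, is_subspace W -> (forall y, A y -> W y) -> W x.

Record opIdeal (K : fieldType) (O : operad K) := OpIdeal {
  ideal_mem :> forall n, O n -> Prop;
  ideal_subspace : forall n, is_subspace (@ideal_mem n);
  ideal_compl : forall n m (x : O n) i (y : O m), (i <= n)%N ->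
    ideal_mem x -> ideal_mem (x o_(i) y);
  ideal_compr : forall n m (x : O n) i (y : O m), (i <= n)%N ->
    ideal_mem y -> ideal_mem (x o_(i) y)
}.

Arguments ideal_mem {K O} _ n _.

Section Ideals.
Variables (K : fieldType) (O : operad K).

Definition ideal_gen_mem d (A : O d -> Prop) n (x : O n) : Prop :=
  forall I : opIdeal O, (forall y : O d, A y -> I d y) -> I n x.

Definition ideal_gen d (A : O d -> Prop) : opIdeal O.
Proof.
apply: (@OpIdeal K O (@ideal_gen_mem d A)).
- move=> n; split=> [I _|a x y Ix Iy I AI]; first by case: (ideal_subspace I n).
  by case: (ideal_subspace I n) => _; apply; [exact: Ix | exact: Iy].
- by move=> n m x i y le_in Ix I AI; apply: ideal_compl => //; exact: Ix.
- by move=> n m x i y le_in Iy I AI; apply: ideal_compr => //; exact: Iy.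
Defined.

Variable I : opIdeal O.

Definition ideal_pred n : {pred O n} := fun x => `[< I n x >].

Lemma ideal_predP n (x : O n) : reflect (I n x) (x \in @ideal_pred n).
Proof. exact: asboolP. Qed.

Lemma ideal_zmod_closed n : zmod_closed (@ideal_pred n).
Proof.
have [I0 ID] := ideal_subspace I n.
split=> [|x y /ideal_predP Ix /ideal_predP Iy]; apply/ideal_predP => //.
by rewrite addrC -scaleN1r; exact: ID.
Qed.

HB.instance Definition _ n :=
  GRing.isZmodClosed.Build (O n) (@ideal_pred n) (@ideal_zmod_closed n).

Definition quot_sort n := Quotient.quot (@ideal_pred n).
HB.instance Definition _ n := GRing.Zmodule.on (quot_sort n).
HB.instance Definition _ n := Quotient.on (quot_sort n).

Definition quot_pi n (x : O n) : quot_sort n := \pi x.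

Lemma quot_piP n (x y : O n) : (quot_pi x = quot_pi y) <-> I n (x - y).
Proof.
split=> [/eqP|/ideal_predP].
  by rewrite /quot_pi -Quotient.idealrBE => /ideal_predP.
by rewrite Quotient.idealrBE => /eqP.
Qed.

Lemma quot_piD n (x y : O n) : quot_pi (x + y) = quot_pi x + quot_pi y.
Proof. by rewrite /quot_pi !piE. Qed.

Lemma quot_ind n (P : quot_sort n -> Prop) :
  (forall x, P (quot_pi x)) -> forall q, P q.
Proof. by move=> Ppi q; rewrite -[q]reprK; exact: Ppi. Qed.

Definition quot_scale n (a : K) (q : quot_sort n) : quot_sort n :=
  quot_pi (a *: repr q).

Lemma quot_repr n (x : O n) : I n (repr (quot_pi x) - x).
Proof. by apply/quot_piP; rewrite /quot_pi reprK. Qed.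

Lemma quot_scaleE n a (x : O n) : quot_scale a (quot_pi x) = quot_pi (a *: x).
Proof.
have [I0 ID] := ideal_subspace I n.
apply/quot_piP; rewrite -scalerBr -[_ *: _]addr0; apply: ID => //.
exact: quot_repr.
Qed.

Fact quot_scaleA n a b (q : quot_sort n) :
  quot_scale a (quot_scale b q) = quot_scale (a * b) q.
Proof. by elim/quot_ind: q => x; rewrite !quot_scaleE scalerA. Qed.

Fact quot_scale1 n : left_id 1 (@quot_scale n).
Proof. by elim/quot_ind=> x; rewrite quot_scaleE scale1r. Qed.

Fact quot_scaleDr n : right_distributive (@quot_scale n) +%R.
Proof.
move=> a; elim/quot_ind=> x; elim/quot_ind=> y.
by rewrite -quot_piD !quot_scaleE scalerDr quot_piD.
Qed.

Fact quot_scaleDl n (q : quot_sort n) : {morph (@quot_scale n)^~ q : a b / a + b}.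
Proof. by elim/quot_ind: q => x a b; rewrite !quot_scaleE scalerDl quot_piD. Qed.

HB.instance Definition _ n := GRing.Zmodule_isLmodule.Build K (quot_sort n)
  (@quot_scaleA n) (@quot_scale1 n) (@quot_scaleDr n) (@quot_scaleDl n).

Definition quot_comp n m (p : quot_sort n) i (q : quot_sort m) : quot_sort (n + m) :=
  quot_pi (repr p o_(i) repr q).

Lemma quot_compE n m (x : O n) i (y : O m) : (i <= n)%N ->
  quot_comp (quot_pi x) i (quot_pi y) = quot_pi (x o_(i) y).
Proof.
move=> le_in; apply/quot_piP; set x' := repr _; set y' := repr _.
have [I0 ID] := ideal_subspace I (n + m)%N.
have -> : x' o_(i) y' - x o_(i) y = 1 *: ((x' - x) o_(i) y') + x o_(i) (y' - y).
  by rewrite scale1r op_compBl // op_compBr // addrA addrNK.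
apply: ID; first by apply: ideal_compl => //; exact: quot_repr.
by apply: ideal_compr => //; exact: quot_repr.
Qed.

Lemma cast_quot_pi n m (e : n = m) (x : O n) :
  ecast k (quot_sort k) e (quot_pi x) = quot_pi (ecast k (O k) e x).
Proof. by case: m / e. Qed.

Definition quotient_operad : operad K.
Proof.
apply: (@Operad K (fun n => quot_sort n) (quot_pi (op_unit O)) quot_comp).
- move=> n m i q le_in a; elim/quot_ind: q => y.
  elim/quot_ind=> x; elim/quot_ind=> x'.
  rewrite [a *: _]quot_scaleE -quot_piD !quot_compE // op_compl //.
  by rewrite quot_piD -quot_scaleE.
- move=> n m i q le_in a; elim/quot_ind: q => x.
  elim/quot_ind=> y; elim/quot_ind=> y'.
  rewrite [a *: _]quot_scaleE -quot_piD !quot_compE // op_compr //.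
  by rewrite quot_piD -quot_scaleE.
- by move=> n; elim/quot_ind=> y; rewrite quot_compE // op_unitl.
- move=> n; elim/quot_ind=> x i le_in.
  by rewrite quot_compE // op_unitr // cast_quot_pi.
- move=> n m p; elim/quot_ind=> x; elim/quot_ind=> y; elim/quot_ind=> z i j.
  move=> le_in le_jm; rewrite !quot_compE ?leq_add // cast_quot_pi.
  by rewrite op_seq.
- move=> n m p; elim/quot_ind=> x; elim/quot_ind=> y; elim/quot_ind=> z i j.
  move=> lt_ij le_jn; have le_in := leq_trans (ltnW lt_ij) le_jn.
  rewrite !quot_compE ?leq_add2r //; last exact: leq_trans (leq_addr _ _).
  by rewrite cast_quot_pi op_par.
Defined.

End Ideals.
(* ** Free operads on binary generators *)

Section Trees.
Variable G : finType.
Local Open Scope nat_scope.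

Inductive btree := Leaf | Node of G & btree & btree.

Fixpoint nodes t := if t is Node _ l r then (nodes l + nodes r).+1 else 0%N.

(* A tree with k nodes has k + 1 leaves, numbered from 0 to k from left to
   right; graft t i s substitutes s for the i-th leaf of t. *)
Fixpoint graft t i s :=
  if t is Node g l r then
    if (i <= nodes l)%N then Node g (graft l i s) r
    else Node g l (graft r (i - (nodes l).+1) s)
  else s.

Fixpoint tree_code t : seq (option G) :=
  if t is Node g l r then Some g :: tree_code l ++ tree_code r else [:: None].

Definition tree_push (o : option G) (st : seq btree) : seq btree :=
  match o, st with
  | None, _ => Leaf :: st
  | Some g, l :: r :: st' => Node g l r :: st'
  | Some _, _ => st
  end.

Definition trees_decode (s : seq (option G)) : seq btree := foldr tree_push [::] s.

Lemma tree_code_cat t s : trees_decode (tree_code t ++ s) = t :: trees_decode s.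
Proof. by elim: t s => //= g l IHl r IHr s; rewrite -catA IHl IHr. Qed.

Lemma tree_codeK : pcancel tree_code (fun s => ohead (trees_decode s)).
Proof. by move=> t; rewrite -[tree_code t]cats0 tree_code_cat. Qed.

Lemma size_tree_code t : size (tree_code t) = (nodes t).*2.+1.
Proof. by elim: t => //= g l IHl r IHr; rewrite size_cat IHl IHr; lia. Qed.

HB.instance Definition _ := Countable.copy btree (pcan_type tree_codeK).

Definition tree k := {t : btree | nodes t == k}.
HB.instance Definition _ k := SubCountable.on (tree k).

Lemma nodes_val k (t : tree k) : nodes (val t) = k.
Proof. exact/eqP/(valP t). Qed.

Lemma tree_tuple_subproof k (t : tree k) : size (tree_code (val t)) == k.*2.+1.
Proof. by rewrite size_tree_code nodes_val. Qed.

Definition tree_tuple k (t : tree k) : k.*2.+1.-tuple (option G) :=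
  Tuple (tree_tuple_subproof t).

Lemma tree_tupleK k :
  pcancel (@tree_tuple k) (fun s => obind insub (ohead (trees_decode s))).
Proof. by move=> t; rewrite /= tree_codeK /= valK. Qed.

HB.instance Definition _ k := isFinite.Build (tree k)
  (pcan_enumP (@tree_tupleK k)).

Lemma nodes_graft t i s : nodes (graft t i s) = (nodes t + nodes s)%N.
Proof.
elim: t i => //= g l IHl r IHr i.
by case: leqP => _ /=; rewrite ?IHl ?IHr; lia.
Qed.

Lemma graft_leaf t i : graft t i Leaf = t.
Proof. by elim: t i => //= g l IHl r IHr i; rewrite IHl IHr; case: leqP. Qed.

Lemma graft_seq t s u i j : (i <= nodes t)%N -> (j <= nodes s)%N ->
  graft (graft t i s) (i + j) u = graft t i (graft s j u).
Proof.
elim: t i => [|g l IHl r IHr] i /= le_i le_j.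
  by case: i le_i => // _; rewrite add0n.
case: (leqP i (nodes l)) => [le_il|lt_li] /=; rewrite ?nodes_graft.
  by rewrite leq_add // IHl.
rewrite ifF; last by lia.
by congr Node; rewrite -IHr //; last lia; congr graft; lia.
Qed.

Lemma graft_par t s u i j : (i < j)%N -> (j <= nodes t)%N ->
  graft (graft t i s) (j + nodes s) u = graft (graft t j u) i s.
Proof.
elim: t i j => [|g l IHl r IHr] i j /= lt_ij le_j; first by lia.
case: (leqP i (nodes l)) => [le_il|lt_li] /=; rewrite ?nodes_graft.
  rewrite leq_add2r; case: (leqP j (nodes l)) => [le_jl|lt_lj] /=.
    by rewrite nodes_graft ifT; [congr Node; exact: IHl | lia].
  by rewrite le_il; congr Node; congr graft; lia.
rewrite ifF; last by lia.
rewrite ifF /=; last by lia.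
rewrite ifF; last by lia.
by congr Node; rewrite -IHr; [congr graft | |]; lia.
Qed.

Definition tree_leaf : tree 0 := Sub Leaf (eqxx 0%N).

Lemma tree_graft_subproof n m (t : tree n) i (s : tree m) :
  nodes (graft (val t) i (val s)) == (n + m)%N.
Proof. by rewrite nodes_graft nodes_val nodes_val. Qed.

Definition tree_graft n m (t : tree n) i (s : tree m) : tree (n + m) :=
  Sub (graft (val t) i (val s)) (tree_graft_subproof t i s).

Lemma val_tree_cast n m (e : n = m) (t : tree n) :
  val (ecast k (tree k) e t) = val t.
Proof. by case: m / e. Qed.

Definition tree_set_operad : setOperad.
Proof.
apply: (@SetOperad (fun k => tree k) tree_leaf tree_graft).
- by move=> n t; apply: val_inj; rewrite !SubK.
- by move=> n t i le_in; apply: val_inj; rewrite val_tree_cast !SubK graft_leaf.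
- move=> n m p t s u i j le_in le_jm; apply: val_inj.
  by rewrite val_tree_cast !SubK graft_seq ?nodes_val.
- move=> n m p t s u i j lt_ij le_jn; apply: val_inj.
  rewrite val_tree_cast !SubK -[X in (j + X)%N](nodes_val s).
  by rewrite graft_par ?nodes_val.
Defined.

Definition corolla (g : G) : tree 1 := Sub (Node g Leaf Leaf) (eqxx 1%N).

End Trees.

Arguments Leaf {G}.

Section Presentations.
Variable K : fieldType.

(* The free operad on a finite set G of generators of arity 2: its component
   of index k, that is of arity k + 1, is the space on the planar binary trees
   with k nodes, all labelled by G.  Its component of index 2 is thus the
   space of all elements of degree 2, in which quadratic relations live. *)
Definition Free (G : finType) : operad K := linear_operad K (tree_set_operad G).

Definition gen (G : finType) (g : G) : Free G 1 := delta K (corolla g).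

Definition presented (G : finType) (R : Free G 2 -> Prop) : operad K :=
  quotient_operad (ideal_gen R).

Definition binary_quadratic (O : operad K) : Prop :=
  exists (G : finType) (R : Free G 2 -> Prop), isomorphic O (presented R).

End Presentations.

(* ** Koszulness of binary quadratic operads

   Let O = Free(G)/<R> be binary quadratic.  Its Koszul dual is the operad
   O^! = Free(G)/<R^perp>, where R^perp is the orthogonal of R for the form on
   degree 2 elements which makes trees orthogonal, a tree x o_1 y having
   square 1 and a tree x o_2 y having square -1.  The Koszul complex of O is
   the sum over k of the spaces
     O^!(k + 1)^* (x) O(i_0) (x) ... (x) O(i_k),
   with the differential given by the decomposition map dual to the partial
   compositions of O^! by one generator, followed by the action of this
   generator on two consecutive factors O(i_j), O(i_(j + 1)). *)

Section Koszul.
Variables (K : fieldType) (G : finType).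
Local Notation Free := (Free K G).

Definition left_tree (t : btree G) : bool :=
  if t is Node _ (Node _ _ _) _ then true else false.

Definition quadratic_form (x y : Free 2) : K :=
  \sum_(t : tree G 2) (if left_tree (val t) then 1 else - 1) * (x t * y t).

Definition orthogonal (R : Free 2 -> Prop) (y : Free 2) : Prop :=
  forall x, R x -> quadratic_form x y = 0.

(* The dual of the component of index k of O^!, as the space of the linear
   forms on Free(G) (in the dual basis of the basis of trees) vanishing on
   the ideal <R^perp>. *)
Definition dual_component (R : Free 2 -> Prop) k (x : Free k) : Prop :=
  forall y : Free k, ideal_gen (orthogonal R) k y ->
    \sum_(t : tree G k) x t * y t = 0.

(* Forests of k + 1 trees such that the total number of nodes of a tree with
   k nodes and of a forest grafted on its leaves is n. *)
Definition forest k n := {f : seq (btree G) |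
  (size f == k.+1) && (k + sumn (map (@nodes G) f) == n)%N}.
HB.instance Definition _ k n := SubCountable.on (forest k n).

Lemma size_forest_code (f : seq (btree G)) :
  size (flatten (map (@tree_code G) f))
  = ((sumn (map (@nodes G) f)).*2 + size f)%N.
Proof. by elim: f => //= t f IHf; rewrite size_cat IHf size_tree_code; lia. Qed.

Lemma forest_tuple_subproof k n (f : forest k n) :
  size (flatten (map (@tree_code G) (val f))) == ((n - k).*2 + k.+1)%N.
Proof.
have /andP[/eqP sz_f /eqP Dn] := valP f.
by rewrite size_forest_code sz_f -[X in (X - k)%N]Dn addKn.
Qed.

Definition forest_tuple k n (f : forest k n) :
  ((n - k).*2 + k.+1)%N.-tuple (option G) := Tuple (forest_tuple_subproof f).

Lemma forest_codeK (f : seq (btree G)) :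
  trees_decode (flatten (map (@tree_code G) f)) = f.
Proof. by elim: f => //= t f IHf; rewrite tree_code_cat IHf. Qed.

Lemma forest_tupleK k n :
  pcancel (@forest_tuple k n) (fun s => insub (trees_decode s)).
Proof. by move=> f; rewrite /= forest_codeK valK. Qed.

HB.instance Definition _ k n := isFinite.Build (forest k n)
  (pcan_enumP (@forest_tupleK k n)).

Definition merge_seq (i : nat) (g : G) (f : seq (btree G)) : seq (btree G) :=
  take i f ++ Node g (nth Leaf f i) (nth Leaf f i.+1) :: drop i.+2 f.

Lemma merge_subproof k n (i : 'I_k.+1) g (f : forest k.+1 n) :
  (size (merge_seq i g (val f)) == k.+1)
  && (k + sumn (map (@nodes G) (merge_seq i g (val f))) == n)%N.
Proof.
have /andP[/eqP sz_f /eqP] := valP f; move: (val f) sz_f => s sz_s Dn.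
have lt_i : (i < k.+1)%N := ltn_ord i.
have Ds : s = take i s ++ nth Leaf s i :: nth Leaf s i.+1 :: drop i.+2 s.
  by rewrite -{1}[s](cat_take_drop i) (drop_nth Leaf) ?(drop_nth Leaf (n := i.+1)) //; lia.
apply/andP; split.
  by rewrite /merge_seq size_cat /= size_take size_drop sz_s; case: ifP; lia.
rewrite -Dn [in X in _ == X]Ds /merge_seq !map_cat !sumn_cat /=; lia.
Qed.

Definition merge k n (i : 'I_k.+1) g (f : forest k.+1 n) : forest k n :=
  Sub (merge_seq i g (val f)) (merge_subproof i g f).

(* The space Free(G)(k + 1)^* (x) Free(G)(i_0) (x) ... (x) Free(G)(i_k), summed
   over all indices such that the total arity i_0 + ... + i_k is n + 1. *)
Definition chain k n : lmodType K := {ffun tree G k * forest k n -> K^o}.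

(* The coefficient of t in x, null when t does not have m nodes. *)
Definition coef m (x : Free m) (t : btree G) : K :=
  if insub t is Some t' then x t' else 0.

(* The element y (x) x_0 (x) ... (x) x_k of chain k n, which is null when its
   total arity is not n + 1. *)
Definition tensor k n (y : Free k) (m : 'I_k.+1 -> nat)
    (x : forall j, Free (m j)) : chain k n :=
  [ffun c => y c.1 * \prod_(j < k.+1) coef (x j) (nth Leaf (val c.2) j)].

(* The component O^!(k + 1)^* (x) O(i_0) (x) ... (x) O(i_k) of the Koszul
   complex is the quotient of koszul_chain by koszul_null. *)
Definition koszul_chain (R : Free 2 -> Prop) k n : chain k n -> Prop :=
  span (fun z => exists (y : Free k) m (x : forall j : 'I_k.+1, Free (m j)),
    dual_component R y /\ z = tensor n y x).

Definition koszul_null (R : Free 2 -> Prop) k n : chain k n -> Prop :=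
  span (fun z => exists (y : Free k) m (x : forall j : 'I_k.+1, Free (m j)),
    [/\ dual_component R y, exists j, ideal_gen R (m j) (x j)
      & z = tensor n y x]).

(* A basis element (t, f) is sent to the sum of the (-1)^i (t', f') over all
   the ways of writing t as the grafting of a generator g on the i-th leaf of
   some t', where f' is obtained by replacing the trees of f of ranks i and
   i + 1 by their composition by g.  The sign (-1)^i is the Koszul sign of the
   removal of g, the nodes of degree 1 of a tree being ordered from left to
   right: the node g of t is there the one of rank i. *)
Definition koszul_diff k n (z : chain k.+1 n) : chain k n :=
  \sum_(c : tree G k.+1 * forest k.+1 n)
    z c *: \sum_(t' : tree G k) \sum_(i < k.+1)
      \sum_(g : G | val c.1 == graft (val t') i (Node g Leaf Leaf))
        (-1) ^+ i *: delta K (t', merge i g c.2).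

Definition koszul_cycle (R : Free 2 -> Prop) k n : chain k n -> Prop :=
  match k with
  | 0 => fun=> True
  | k'.+1 => fun z => koszul_null R (koszul_diff z)
  end.

(* In arity 1 the complex is reduced to its component of degree k = 0, and it
   is required to be exact in all other arities. *)
Definition koszul_acyclic (R : Free 2 -> Prop) : Prop :=
  forall n k (z : chain k n), (0 < n)%N ->
    koszul_chain R z -> koszul_cycle R z ->
    exists z' : chain k.+1 n,
      koszul_chain R z' /\ koszul_null R (z - koszul_diff z').

End Koszul.

Definition koszul (K : fieldType) (O : operad K) : Prop :=
  exists (G : finType) (R : Free K G 2 -> Prop),
    isomorphic O (presented R) /\ koszul_acyclic R.

(* ** Cliques decorated by a unitary magma *)

#[short(type="finUMagmaType")]
HB.structure Definition FinUMagma := {M of UMagma M & Finite M}.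

Section Cliques.
Variable M : finUMagmaType.
Local Open Scope nat_scope.
Implicit Types x y i j n m : nat.

(* A clique of index n is of size n + 1: its vertices are 0, ..., n + 1. *)
Definition arc n := {a : 'I_n.+2 * 'I_n.+2 | a.1 < a.2}.
Definition clique n := {ffun arc n -> M}.

Definition source n (a : arc n) : nat := (val a).1.
Definition target n (a : arc n) : nat := (val a).2.

Definition is_base n (a : arc n) := (source a == 0) && (target a == n.+1).
Definition is_edge n (a : arc n) := target a == (source a).+1.
Definition is_diagonal n (a : arc n) := ~~ is_base a && ~~ is_edge a.
Definition solid n (p : clique n) (a : arc n) := p a != 1%g.
Definition cross n (a b : arc n) :=
  [&& source a < source b, source b < target a & target a < target b]
  || [&& source b < source a, source a < target b & target b < target a].

Definition noncrossing n (p : clique n) :=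
  [forall a : arc n, forall b : arc n,
     [&& is_diagonal a, is_diagonal b, solid p a & solid p b] ==> ~~ cross a b].

Definition mkclique n (f : nat -> nat -> M) : clique n :=
  [ffun a => f (source a) (target a)].

(* The label of the arc (x, y), and 1 when (x, y) is not an arc. *)
Definition label n (p : clique n) x y : M :=
  if [pick a : arc n | (source a == x) && (target a == y)] is Some a
  then p a else 1%g.

(* In the composition of p and q at the edge (i, i + 1) of p, the vertex y of
   q becomes i + y, and the vertex x of p becomes x if x <= i and x + m
   otherwise. *)
Definition clique_comp n m (p : clique n) i (q : clique m) : clique (n + m) :=
  let from_p x := (x <= i) || (i + m.+1 <= x) in
  let vertex_p x := if x <= i then x else x - m in
  mkclique (n + m) (fun x y =>
    if (x == i) && (y == i + m.+1) then (label p i i.+1 * label q 0 m.+1)%g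
    else if (i <= x) && (y <= i + m.+1) then label q (x - i) (y - i)
    else if from_p x && from_p y then label p (vertex_p x) (vertex_p y)
    else 1%g).

Definition clique_unit : clique 0 := mkclique 0 (fun _ _ => 1%g).

Lemma arcP n (a : arc n) : source a < target a <= n.+1.
Proof. by rewrite [_ < _](valP a) /= -ltnS ltn_ord. Qed.

Lemma arc_inj n (a b : arc n) : source a = source b -> target a = target b -> a = b.
Proof.
rewrite /source /target => sab tab; apply: val_inj.
by rewrite [val a]surjective_pairing [val b]surjective_pairing;
   congr pair; apply: val_inj.
Qed.

Lemma arc_ex n x y : x < y <= n.+1 -> exists2 a : arc n, source a = x & target a = y.
Proof.
move=> /andP[lt_xy le_y].
have ltx : x < n.+2 by lia.
have lty : y < n.+2 by lia.
have ltxy : (Ordinal ltx, Ordinal lty).1 < (Ordinal ltx, Ordinal lty).2 by [].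
by exists (Sub (Ordinal ltx, Ordinal lty) ltxy); rewrite /source /target SubK.
Qed.

Lemma label_arc n (p : clique n) (a : arc n) : label p (source a) (target a) = p a.
Proof.
rewrite /label; case: pickP => [b /andP[/eqP sb /eqP tb]|/(_ a)]; last by rewrite !eqxx.
by rewrite (arc_inj sb tb).
Qed.

Lemma label_mk n f x y : x < y <= n.+1 -> label (mkclique n f) x y = f x y.
Proof. by case/arc_ex => a <- <-; rewrite label_arc ffunE. Qed.

Lemma clique_ext n (p q : clique n) :
  (forall x y, x < y <= n.+1 -> label p x y = label q x y) -> p = q.
Proof. by move=> pq; apply/ffunP=> a; rewrite -!label_arc pq ?arcP. Qed.

Lemma label_cast n m (e : n = m) (p : clique n) x y :
  label (ecast k (clique k) e p) x y = label p x y.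
Proof. by case: m / e. Qed.

Lemma label_comp n m (p : clique n) i (q : clique m) x y :
  label (clique_comp p i q) x y =
  if x < y <= (n + m).+1 then
    if (x == i) && (y == i + m.+1) then (label p i i.+1 * label q 0 m.+1)%g
    else if (i <= x) && (y <= i + m.+1) then label q (x - i) (y - i)
    else if ((x <= i) || (i + m.+1 <= x)) && ((y <= i) || (i + m.+1 <= y)) then
      label p (if x <= i then x else x - m) (if y <= i then y else y - m)
    else 1%g
  else 1%g.
Proof.
case: ifP => [xy|/negP nxy]; first by rewrite label_mk.
rewrite /label; case: pickP => // a /andP[/eqP ax /eqP ay].
by case: nxy; rewrite -ax -ay arcP.
Qed.

Lemma label_unit x y : label clique_unit x y = 1%g.
Proof. by rewrite /label; case: pickP => // a _; rewrite ffunE. Qed.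

Lemma clique_unitl n (q : clique n) : clique_comp clique_unit 0 q = q.
Proof.
apply: clique_ext => x y xy; rewrite label_comp xy label_unit mul1g.
case: ifP => [/andP[/eqP-> /eqP->]//|_].
by rewrite !subn0 ifT //; lia.
Qed.

Lemma clique_unitr n (p : clique n) i : i <= n ->
  clique_comp p i clique_unit = ecast k (clique k) (esym (addn0 n)) p.
Proof.
move=> le_in; apply: clique_ext => x y xy.
rewrite label_cast label_comp xy !label_unit mulg1.
case: ifP => [/andP[/eqP-> /eqP->]|ne_e]; first by rewrite addn1.
case: ifP => [|_]; first by lia.
by rewrite !subn0 !if_same ifT //; lia.
Qed.

Ltac case_if :=
  repeat match goal with
  | |- context [if ?b then _ else _] =>
    lazymatch b with
    | context [if _ then _ else _] => fail
    | _ => first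
      [ have -> : b = true by lia
      | have -> : b = false by lia
      | let H := fresh "H" in case: (boolP b) => H ]; cbv beta iota
    end
  end.

Ltac label_eq :=
  match goal with
  | |- label _ _ _ = label _ _ _ => apply: f_equal2; lia
  | |- (_ * _)%g = (_ * _)%g => apply: f_equal2; apply: f_equal2; lia
  | |- _ => by []
  end.

Lemma clique_seq n m k (p : clique n) (q : clique m) (r : clique k) i j :
  (m = 0 -> label q 0 1 = 1%g) -> i <= n -> j <= m ->
  clique_comp (clique_comp p i q) (i + j) r
  = ecast k (clique k) (addnA n m k) (clique_comp p i (clique_comp q j r)).
Proof.
move=> q1 le_in le_jm; apply: clique_ext => x y xy.
rewrite label_cast !label_comp.
case_if; try label_eq.
have m0 : m = 0 by lia.
have j0 : j = 0 by lia.
by subst m j; rewrite q1 // mulg1 mul1g.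
Qed.

Lemma clique_par n m k (p : clique n) (q : clique m) (r : clique k) i j :
  i < j -> j <= n ->
  clique_comp (clique_comp p i q) (j + m) r
  = ecast k (clique k) (addnAC n k m) (clique_comp (clique_comp p j r) i q).
Proof.
move=> lt_ij le_jn; apply: clique_ext => x y xy.
rewrite label_cast !label_comp.
have [xi|ix] := leqP x i; have [yi|iy] := leqP y i;
have [xm|mx] := leqP (i + m.+1) x; have [ym|my] := leqP (i + m.+1) y;
have [xj|jx] := leqP x (j + m); have [yj|jy] := leqP y (j + m);
have [xk|kx] := leqP (j + m + k.+1) x; have [yk|ky] := leqP (j + m + k.+1) y;
try (exfalso; lia).
all: case_if; label_eq.
Qed.

Lemma noncrossingP n (p : clique n) :
  reflect (forall x y x' y', x < x' -> x' < y -> y < y' -> 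
             label p x y <> 1%g -> label p x' y' = 1%g) (noncrossing p).
Proof.
apply: (iffP forallP) => [nc x y x' y' xx' x'y yy' sxy|nc a].
  apply/eqP/negPn/negP=> sx'y'.
  have arc_of u v : label p u v <> 1%g ->
      exists2 a : arc n, (source a = u) /\ (target a = v) & solid p a.
    rewrite /label; case: pickP => // a /andP[/eqP au /eqP av] /eqP.
    by exists a.
  have [a [sa ta] pa] := arc_of _ _ sxy.
  have [b [sb tb] pb] := arc_of _ _ (elimN eqP sx'y').
  have := arcP a; have := arcP b; rewrite sa ta sb tb => ub ua.
  have /forallP/(_ b)/implyP := nc a; rewrite pa pb !andbT.
  rewrite /is_diagonal /is_base /is_edge /cross sa sb ta tb.
  by move=> H; suff /negP : false; [apply|]; lia.
apply/forallP=> b; apply/implyP=> /and4P[_ _ pa pb].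
apply/negP=> /orP[]/and3P[h1 h2 h3].
  by move/eqP: pb; apply; rewrite -label_arc; apply: nc h1 h2 h3 _; rewrite label_arc; apply/eqP.
by move/eqP: pa; apply; rewrite -label_arc; apply: nc h1 h2 h3 _; rewrite label_arc; apply/eqP.
Qed.

Lemma noncrossing_comp n m (p : clique n) i (q : clique m) : i <= n ->
  noncrossing p -> noncrossing q -> noncrossing (clique_comp p i q).
Proof.
move=> le_in /noncrossingP ncp /noncrossingP ncq.
apply/noncrossingP=> x y x' y' xx' x'y yy'; rewrite !label_comp.
case_if => //; try (by apply: ncp; lia); try (by apply: ncq; lia).
Qed.

(* The only clique of size 1 of the operad is the unit. *)
Definition size1_unit n (p : clique n) : bool := (n == 0) ==> (label p 0 1 == 1%g).

Lemma size1_unit_unit : size1_unit clique_unit.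
Proof. by apply/implyP=> _; rewrite label_unit. Qed.

Lemma size1_unit_comp n m (p : clique n) (q : clique m) i :
  size1_unit p -> size1_unit q -> size1_unit (clique_comp p i q).
Proof.
rewrite /size1_unit => /implyP p1 /implyP q1; apply/implyP=> /eqP nm0.
have n0 : n = 0 by lia.
have m0 : m = 0 by lia.
subst n m; have /eqP {}p1 := p1 isT; have /eqP {}q1 := q1 isT.
rewrite label_comp; apply/eqP; case_if => //.
have -> : i = 0 by lia.
by rewrite p1 q1 mul1g.
Qed.

Definition clique_sort n := {p : clique n | size1_unit p}.

Definition clique_op n m (p : clique_sort n) i (q : clique_sort m) :
    clique_sort (n + m) :=
  Sub (clique_comp (val p) i (val q)) (size1_unit_comp i (valP p) (valP q)).

Lemma val_clique_cast n m (e : n = m) (p : clique_sort n) :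
  val (ecast k (clique_sort k) e p) = ecast k (clique k) e (val p).
Proof. by case: m / e. Qed.

Definition C_set_operad : setOperad.
Proof.
apply: (@SetOperad (fun n => clique_sort n) (Sub clique_unit size1_unit_unit)
                   clique_op).
- by move=> n q; apply: val_inj; rewrite !SubK clique_unitl.
- move=> n p i le_in; apply: val_inj.
  by rewrite val_clique_cast !SubK clique_unitr.
- move=> n m k p q r i j le_in le_jm; apply: val_inj.
  rewrite val_clique_cast !SubK clique_seq // => m0; apply/eqP.
  by have /implyP := valP q; apply; rewrite m0.
- move=> n m k p q r i j lt_ij le_jn; apply: val_inj.
  by rewrite val_clique_cast !SubK clique_par.
Defined.

Definition C_noncrossing n (p : C_set_operad n) : bool := noncrossing (val p).

Lemma C_noncrossing_unit : C_noncrossing (so_unit C_set_operad).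
Proof. by apply/noncrossingP=> x y x' y' *; rewrite label_unit. Qed.

Lemma C_noncrossing_comp n m (p : C_set_operad n) (q : C_set_operad m) i :
  i <= n -> C_noncrossing p -> C_noncrossing q -> C_noncrossing (so_comp p i q).
Proof. exact: noncrossing_comp. Qed.

Definition NC_set_operad : setOperad :=
  sub_set_operad C_noncrossing_unit C_noncrossing_comp.

Definition triangle : finType := clique 1.

(* The triangle written as the word p1 p2 p3: its base is labelled by p1 and
   its two edges by p2 and p3. *)
Definition tri (p1 p2 p3 : M) : triangle :=
  mkclique 1 (fun x y =>
    if (x == 0) && (y == 2) then p1 else if x == 0 then p2 else p3).

End Cliques.

Definition C (K : fieldType) (M : finUMagmaType) : operad K :=
  linear_operad K (C_set_operad M).

(* The inclusion of NC K M in C K M is the injective morphism sub_incl, whose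
   image is the span of the noncrossing cliques. *)
Definition NC (K : fieldType) (M : finUMagmaType) : operad K :=
  linear_operad K (NC_set_operad M).

Section Relations.
Variables (K : fieldType) (M : finUMagmaType).
Local Notation "[ 't' p1 p2 p3 ]" := (gen K (tri p1 p2 p3))
  (p1 at level 8, p2 at level 8, p3 at level 8).

Inductive NC_relation : Free K (triangle M) 2 -> Prop :=
| NC_relation_a p1 p2 p3 q1 q2 q3 r1 r2 of
    (p2 * q1 = r2 * r1)%g & (r2 * r1 <> 1)%g :
    NC_relation ([t p1 p2 p3] o_(0) [t q1 q2 q3] - [t p1 r2 p3] o_(0) [t r1 q2 q3])
| NC_relation_b p1 p2 p3 q1 q2 q3 r1 r3 of
    (p2 * q1 = 1)%g & (r3 * r1 = 1)%g :
    NC_relation ([t p1 p2 p3] o_(0) [t q1 q2 q3] - [t p1 q2 r3] o_(1) [t r1 q3 p3])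
| NC_relation_c p1 p2 p3 q1 q2 q3 r1 r3 of
    (p3 * q1 = r3 * r1)%g & (r3 * r1 <> 1)%g :
    NC_relation ([t p1 p2 p3] o_(1) [t q1 q2 q3] - [t p1 p2 r3] o_(1) [t r1 q2 q3]).

Definition NC_relations : Free K (triangle M) 2 -> Prop := span NC_relation.

End Relations.

(* Main.v *)
(* Koszulness is proved by a filtration argument.  An internal edge of a tree
   of triangles carries a pair (a, b) of labels, one from each of its two
   triangles.  The relations replace (a, b) by (a * b, 1), and (1, 1) on a right
   edge by (1, 1) on a left edge.  The edges which are so reduced are of type Z,
   the other ones are of type F, and the weight of a tree, which counts its
   labels b <> 1 and the sizes of its right subtrees, decreases.  The trees with
   all edges of type F are in bijection with the noncrossing cliques: this gives
   the presentation, and the trees of type Z are the leading terms of a basis of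
   the Koszul dual cooperad.

   The leading part of the Koszul differential moves one node through the cut
   between the dual part and the operad part of a tree.  The node can be moved in
   both directions when the edge below it is of type Z and the edges above it are
   of type F; such a node always exists, and moving it is a contracting homotopy
   of the leading part.  Exactness follows by induction on the weight. *)

Require Import Defs.
From HB Require Import structures.
From mathcomp Require Import all_boot all_algebra.
From mathcomp Require Import boolp zify ring.

Set Implicit Arguments.
Unset Strict Implicit.
Unset Printing Implicit Defensive.

Import GRing.Theory.
Local Open Scope ring_scope.

(** * Trees with a cut *)

(** No dimension is counted: the dual component is known only as an annihilator, and the terms of
    the complex only as spans modulo spans. Each statement about bases is therefore replaced by
    one-sided facts about coefficients. On the dual side, a tree that is not of type Z is never
    maximal in the support of an element ([dual_lead]), and each Z-tree is the maximal tree of an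
    explicit element ([dual_elt]). On the operad side, the normal form of a tree is read off its
    clique, so that uniqueness of the F-tree of a clique takes the place of confluence.

    The explicit elements are suggested by the relations: (b) exchanges the two triangulations of a
    square whose diagonal has product 1, while (a) and (c) identify pairs of labels with the same
    product. Functions that annihilate the orthogonal relations are thus found as sums over all
    triangulations of polygons, glued along edges on which (a, b) - (a * b, 1) makes the sum over
    each product vanish. *)

Section CutTrees.
Variables (K : fieldType) (G : finType).
Local Notation btree := (btree G).

(** A basis element (t, f) of the complex as one tree: its [Low] nodes form t and its [Up] subtrees
    form f. Structural recursion then replaces the bookkeeping of leaf ranks. *)
Inductive cut_tree := Up of btree | Low of G & cut_tree & cut_tree.

Fixpoint ct_total A :=
  match A with Up t => t | Low g A B => Node g (ct_total A) (ct_total B) end.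

Fixpoint ct_bot A :=
  match A with Up _ => Leaf | Low g A B => Node g (ct_bot A) (ct_bot B) end.

Fixpoint ct_top A :=
  match A with Up t => [:: t] | Low _ A B => ct_top A ++ ct_top B end.

Fixpoint cut (t : btree) (f : seq btree) : cut_tree :=
  match t with
  | Leaf => Up (head Leaf f)
  | Node g l r =>
    Low g (cut l (take (nodes l).+1 f)) (cut r (drop (nodes l).+1 f))
  end.

Definition low A := nodes (ct_bot A).

Lemma size_ct_top A : size (ct_top A) = (low A).+1.
Proof. by elim: A => //= g A IHA B IHB; rewrite size_cat IHA IHB /low /=; lia. Qed.

Lemma ct_bot_cut t f : ct_bot (cut t f) = t.
Proof. by elim: t f => //= g l IHl r IHr f; rewrite IHl IHr. Qed.

Lemma ct_top_cut t (f : seq btree) : size f = (nodes t).+1 -> ct_top (cut t f) = f.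
Proof.
elim: t f => [|g l IHl r IHr] f /= sz_f; first by case: f sz_f => [|a []].
by rewrite IHl ?IHr ?cat_take_drop // ?size_drop ?size_takel; lia.
Qed.

Lemma cut_ct A : cut (ct_bot A) (ct_top A) = A.
Proof.
elim: A => //= g A IHA B IHB.
by rewrite -/(low A) -size_ct_top take_size_cat // drop_size_cat // IHA IHB.
Qed.

Lemma nodes_total A :
  nodes (ct_total A) = (low A + sumn (map (@nodes G) (ct_top A)))%N.
Proof.
rewrite /low; elim: A => [t|g A IHA B IHB] /=; first by lia.
by rewrite IHA IHB map_cat sumn_cat; lia.
Qed.

(* The differential and the homotopy act on functions on cut trees, seen as
   families of coefficients: at A, the differential reads the coefficients of
   the cut trees obtained from A by lowering a node. *)
Fixpoint ct_diff (F : cut_tree -> K) A : K :=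
  match A with
  | Up Leaf => 0
  | Up (Node g l r) => F (Low g (Up l) (Up r))
  | Low g A B => ct_diff (fun A' => F (Low g A' B)) A
                 + (-1) ^+ (low A).+1 * ct_diff (fun B' => F (Low g A B')) B
  end.

Lemma ct_diff_ext F F' A :
  (forall A', ct_total A' = ct_total A -> low A' = (low A).+1 -> F A' = F' A') ->
  ct_diff F A = ct_diff F' A.
Proof.
elim: A F F' => [[|g l r]|g A IHA B IHB] F F' eqF //=; first exact: eqF.
congr (_ + _ * _).
  by apply: IHA => A' tA lA; apply: eqF; rewrite /= ?tA // /low /= -!/(low _) lA.
by apply: IHB => B' tB lB; apply: eqF; rewrite /= ?tB // /low /= -!/(low _) lB; lia.
Qed.

Lemma ct_diff0 A : ct_diff (fun=> 0) A = 0.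
Proof. by elim: A => [[]|g A IHA B IHB] //=; rewrite IHA IHB mulr0 addr0. Qed.

Lemma ct_diffZ c F A : ct_diff (fun A' => c * F A') A = c * ct_diff F A.
Proof.
by elim: A F => [[|g l r]|g A IHA B IHB] F //=; rewrite ?mulr0 // IHA IHB; ring.
Qed.

Variables zl zr : rel G.

Definition on_root (z : pred G) (t : btree) :=
  if t is Node h _ _ then z h else false.

Fixpoint F_tree (t : btree) : bool :=
  if t is Node g l r then
    [&& ~~ on_root (zl g) l, ~~ on_root (zr g) r, F_tree l & F_tree r]
  else true.

Fixpoint Z_tree (t : btree) : bool :=
  if t is Node g l r then
    [&& (l == Leaf) || on_root (zl g) l, (r == Leaf) || on_root (zr g) r,
        Z_tree l & Z_tree r]
  else true.

Definition is_low A := if A is Low _ _ _ then true else false.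

(** Edges below the cut are of type Z, those above it of type F, and those through it are
    unconstrained. These cut trees index the leading part of the complex. *)
Fixpoint admissible A : bool :=
  match A with
  | Up t => F_tree t
  | Low g A B =>
    [&& is_low A ==> on_root (zl g) (ct_total A),
        is_low B ==> on_root (zr g) (ct_total B), admissible A & admissible B]
  end.

Lemma admissible_Z A : admissible A -> Z_tree (ct_bot A).
Proof.
elim: A => //= g A IHA B IHB /and4P[zA zB /IHA-> /IHB->]; rewrite !andbT.
by apply/andP; split; [case: A zA {IHA} | case: B zB {IHB}].
Qed.

Lemma admissible_F A : admissible A -> all F_tree (ct_top A).
Proof.
elim: A => [t|g A IHA B IHB] /=; first by rewrite andbT.
by case/and4P=> _ _ /IHA hA /IHB hB; rewrite all_cat hA.
Qed.

Lemma admissible_cut t (f : seq btree) : size f = (nodes t).+1 -> Z_tree t -> all F_tree f ->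
  admissible (cut t f).
Proof.
elim: t f => [|g l IHl r IHr] f /= sz_f; first by case: f sz_f => [|a []] //= _ _; rewrite andbT.
case/and4P=> zl' zr' Zl Zr; rewrite -{1}(cat_take_drop (nodes l).+1 f) all_cat.
case/andP=> Ff1 Ff2.
have sz1 : size (take (nodes l).+1 f) = (nodes l).+1 by rewrite size_takel // sz_f; lia.
have sz2 : size (drop (nodes l).+1 f) = (nodes r).+1 by rewrite size_drop sz_f; lia.
rewrite IHl // IHr // !andbT.
have lowZ z t u : (t == Leaf) || on_root z t ->
    is_low (cut t u) ==> on_root z (ct_total (cut t u)) by case: t.
by rewrite !lowZ.
Qed.

(* A node is free when the edge below it is of type Z and the edges above it
   are of type F: it may be moved through the cut in both directions.  Going
   up from the root along edges of type Z leads to a free node. *)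
Fixpoint raise A : option cut_tree :=
  match A with
  | Up _ => None
  | Low g A B =>
    if on_root (zl g) (ct_total A) then omap (fun A' => Low g A' B) (raise A)
    else if on_root (zr g) (ct_total B) then omap (Low g A) (raise B)
    else match A, B with
         | Up l, Up r => Some (Up (Node g l r))
         | _, _ => None
         end
  end.

(** The rank of the leaf of the lower tree at which the raised node was attached; its parity is the
    Koszul sign of the removal. *)
Fixpoint raise_rank A : nat :=
  match A with
  | Up _ => 0
  | Low g A B =>
    if on_root (zl g) (ct_total A) then raise_rank A
    else if on_root (zr g) (ct_total B) then ((low A).+1 + raise_rank B)%N
    else 0
  end.

Definition ct_homotopy (F : cut_tree -> K) A : K :=
  if raise A is Some A' then (-1) ^+ raise_rank A * F A' else 0.

Lemma raiseP A A' : raise A = Some A' ->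
  ct_total A' = ct_total A /\ low A = (low A').+1.
Proof.
rewrite /low; elim: A A' => //= g A IHA B IHB A'.
case: ifP => _.
  by case: (raise A) IHA => //= A1 /(_ _ erefl) [t1 l1] [<-] /=; rewrite t1 l1.
case: ifP => _.
  case: (raise B) IHB => //= B1 /(_ _ erefl) [t1 l1] [<-] /=; rewrite t1 l1.
  by split => //; lia.
by case: A B {IHA IHB} => [l|//] [r|//] [<-].
Qed.

Lemma admissible_raise A A' : raise A = Some A' -> admissible A' -> admissible A.
Proof.
elim: A A' => //= g A IHA B IHB A'.
case: ifP => [zA|nzA].
  case: (raise A) IHA => //= A1 /(_ _ erefl) IHA [<-] /= /and4P[_ -> /IHA-> ->].
  by rewrite implybT.
case: ifP => [zB|nzB].
  case: (raise B) IHB => //= B1 /(_ _ erefl) IHB [<-] /= /and4P[h _ hA /IHB hB].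
  by rewrite -nzA h hA hB implybT.
by case: A B nzA nzB {IHA IHB} => [l|//] [r|//] /= nl nr [<-] /= /and4P[_ _ -> ->].
Qed.

(** The walk of [raise] is guided by the total tree alone, so moving any other node through the cut
    either anticommutes with it or contributes zero; only the distinguished node is left. A tree
    without nodes has no such node. *)
Lemma homotopyP F A : admissible A -> (0 < nodes (ct_total A))%N ->
  (forall A', ~~ admissible A' -> F A' = 0) ->
  ct_diff (ct_homotopy F) A + ct_homotopy (ct_diff F) A = F A.
Proof.
elim: A F => [[|g l r]|g A IHA B IHB] F //=.
  (* The root of an upper F-tree is free: lowering it and raising it again gives F back. *)
  case/and4P=> nl nr Fl Fr _ _.
  by rewrite /ct_homotopy /= (negPf nl) (negPf nr) expr0 mul1r addr0.
case/and4P=> zA zB okA okB _ suppF.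
have suppA A' B' : ~~ admissible A' -> F (Low g A' B') = 0.
  by move=> nA; apply: suppF; rewrite /= (negPf nA) /= !andbF.
have suppB A' B' : ~~ admissible B' -> F (Low g A' B') = 0.
  by move=> nB; apply: suppF; rewrite /= (negPf nB) /= !andbF.
(* The walk enters A. The terms that lower a node of B cancel, because raising in A decreases
   [low A] by one and so flips the sign of B. *)
have [rA|nrA] := boolP (on_root (zl g) (ct_total A)).
  have nA : (0 < nodes (ct_total A))%N by case: (ct_total A) rA.
  rewrite -[RHS](IHA (fun A' => F (Low g A' B)) okA nA) //; last by move=> ? /suppA.
  rewrite [X in X + _ + _](_ : _ =
      ct_diff (ct_homotopy (fun A' => F (Low g A' B))) A); last first.
    apply: ct_diff_ext => A' tA _; rewrite /ct_homotopy /= tA rA.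
    by case: raise.
  have -> : ct_diff (fun B' => ct_homotopy F (Low g A B')) B =
      if raise A is Some A1 then
        (-1) ^+ raise_rank A * ct_diff (fun B' => F (Low g A1 B')) B else 0.
    rewrite (@ct_diff_ext _ (fun B' => if raise A is Some A1 then
      (-1) ^+ raise_rank A * F (Low g A1 B') else 0)).
      by case: raise => [A1|]; rewrite ?ct_diffZ ?ct_diff0.
    by move=> B' _ _; rewrite /ct_homotopy /= rA; case: raise.
  rewrite -addrA; congr (_ + _); rewrite /ct_homotopy /= rA.
  case DA: (raise A) => [A1|] /=; last by rewrite mulr0 addr0.
  by have [_ ->] := raiseP DA; rewrite !exprS; ring.
(* An admissible child whose edge is not of type Z is entirely above the cut. *)
case: A {IHA} zA okA nrA => [a /= _ okA nrA|g' A1 A2 /= zA _]; last by rewrite zA.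
have [rB|nrB] := boolP (on_root (zr g) (ct_total B)).
  have nB : (0 < nodes (ct_total B))%N by case: (ct_total B) rB.
  rewrite -[RHS](IHB (fun B' => F (Low g (Up a) B')) okB nB) //; last by move=> ? /suppB.
  (* Lowering the root of a would put an edge that is not of type Z below the cut, where F
     vanishes. *)
  have Fa h l r B' : a = Node h l r -> F (Low g (Low h (Up l) (Up r)) B') = 0.
    by move=> Da; apply: suppF; rewrite /= -[zl g h]/(on_root (zl g) (Node h l r)) -Da (negPf nrA).
  rewrite [X in X + _ + _](_ : _ = 0) ?add0r; last first.
    case Da: a => [|h l r] //=; rewrite /ct_homotopy /= rB.
    rewrite -[zl g h]/(on_root (zl g) (Node h l r)) -Da (negPf nrA).
    by case: raise => //= B1; rewrite Fa ?mulr0.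
  congr (_ + _).
    rewrite (@ct_diff_ext _ (fun B' => (-1) *
                     ct_homotopy (fun B' => F (Low g (Up a) B')) B')).
      by rewrite ct_diffZ /low /= expr1 mulrA mulrNN !mul1r.
    move=> B' tB _; rewrite /ct_homotopy /= (negPf nrA) tB rB.
    by case: raise => [B1|] /=; rewrite ?mulr0 // exprS; ring.
  rewrite /ct_homotopy /= (negPf nrA) rB.
  case DB: (raise B) => [B1|] //=.
  rewrite [X in _ * (X + _)](_ : _ = 0); last by case Da: a => [|h l r] //=; rewrite Fa.
  by rewrite /low /= exprD expr1 add0r mulrCA mulrA mulrA mulrNN !mul1r.
(* Both children are above the cut, so the root is the free node: raising it and lowering it again
   gives F, and once the root of a child is lowered nothing can be raised. *)
case: B {IHB} zB okB nrB => [b /= _ okB nrB|g' B1 B2 /= zB _]; last by rewrite zB.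
rewrite {3}/ct_homotopy /= (negPf nrA) (negPf nrB) expr0 mul1r.
rewrite [X in X + _ + _](_ : _ = 0); last first.
  case Da: a => [|h l r] //=; rewrite /ct_homotopy /=.
  by rewrite -[zl g h]/(on_root (zl g) (Node h l r)) -Da (negPf nrA) (negPf nrB).
rewrite [X in _ + _ * X + _](_ : _ = 0) ?mulr0 ?add0r //.
case Db: b => [|h l r] //=; rewrite /ct_homotopy /=.
by rewrite -[zr g h]/(on_root (zr g) (Node h l r)) -Db (negPf nrA) (negPf nrB).
Qed.

End CutTrees.

(** * Weights of trees and the Koszul differential *)

Lemma take_add_cat (T : Type) (u v : seq T) m : take (size u + m) (u ++ v) = u ++ take m v.
Proof. by rewrite takeD take_size_cat // drop_size_cat. Qed.

Lemma drop_add_cat (T : Type) (u v : seq T) m : drop (size u + m) (u ++ v) = drop m v.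
Proof. by rewrite drop_cat ltnNge leq_addr addKn. Qed.

Section Plug.
Variable G : finType.
Local Notation btree := (btree G).
Implicit Types (t s : btree) (f : seq btree).

Definition plug t f := ct_total (cut t f).

Lemma nodes_plug t f : size f = (nodes t).+1 ->
  nodes (plug t f) = (nodes t + sumn (map (@nodes G) f))%N.
Proof. by move=> sz_f; rewrite nodes_total /low ct_bot_cut ct_top_cut. Qed.

(** Moving a node through the cut keeps the total tree. Hence the differential preserves its weight,
    and only the reduction of the forest to normal form decreases it. *)
Lemma plug_merge g t (u v : seq btree) x y : size (u ++ v) = nodes t ->
  plug (graft t (size u) (Node g Leaf Leaf)) (u ++ x :: y :: v)
  = plug t (u ++ Node g x y :: v).
Proof.
rewrite /plug; elim: t u v => [|h l IHl r IHr] u v /=.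
  by move/size0nil; case: u => //= ->.
move=> sz_uv; case: leqP => [le_ul|lt_lu] /=; rewrite ?nodes_graft /=.
  have -> : (nodes l + 1).+1 = (size u + (nodes l - size u).+2)%N by lia.
  have -> : (nodes l).+1 = (size u + (nodes l - size u).+1)%N by lia.
  rewrite !take_add_cat !drop_add_cat /= IHl //.
  by move: sz_uv; rewrite !size_cat => sz_uv; rewrite size_takel; lia.
have Du : u = take (nodes l).+1 u ++ drop (nodes l).+1 u by rewrite cat_take_drop.
have szu : size (take (nodes l).+1 u) = (nodes l).+1 by rewrite size_takel.
have -> : (size u - (nodes l).+1)%N = size (drop (nodes l).+1 u) by rewrite size_drop.
move: (take _ u) (drop _ u) Du szu sz_uv => u1 u2 -> sz1 sz_uv.
rewrite -!catA -sz1 !take_size_cat // !drop_size_cat // IHr //.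
by move: sz_uv; rewrite !size_cat sz1; lia.
Qed.

Variable c : G -> nat -> nat -> nat.

Fixpoint weight t : nat :=
  if t is Node g l r then (c g (nodes l) (nodes r) + weight l + weight r)%N else 0%N.

(** All forests on the leaves are tested because the complex is filtered by the weight of the total
    tree, and the cost of a node depends on the sizes of its whole subtrees. *)
Definition heavier s t :=
  nodes s = nodes t /\
  forall f, size f = (nodes t).+1 -> (weight (plug t f) < weight (plug s f))%N.

Lemma heavier_node g l l' r r' : l = l' \/ heavier l l' -> r = r' \/ heavier r r' ->
  Node g l r = Node g l' r' \/ heavier (Node g l r) (Node g l' r').
Proof.
have szs l0 r0 f : size f = (nodes (Node g l0 r0)).+1 ->
    size (take (nodes l0).+1 f) = (nodes l0).+1 /\
    size (drop (nodes l0).+1 f) = (nodes r0).+1.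
  by move=> /= sz_f; rewrite size_drop size_takel; lia.
case=> [<-|[nl hl]]; case=> [<-|[nr hr]]; [by left| right..]; split;
  rewrite /= ?nl ?nr // => f /szs[sz1 sz2]; rewrite /plug /= -!/(plug _ _) ?nl;
  move: (take _ f) (drop _ f) sz1 sz2 => f1 f2 sz1 sz2.
- by have := hr _ sz2; rewrite !nodes_plug ?nr //; lia.
- by have := hl _ sz1; rewrite !nodes_plug ?nl //; lia.
by have := hl _ sz1; have := hr _ sz2; rewrite !nodes_plug ?nl ?nr //; lia.
Qed.

Lemma heavier_neq s t : heavier s t -> s <> t.
Proof.
by case=> _ h Dst; have := h (nseq (nodes t).+1 Leaf); rewrite size_nseq Dst ltnn => /(_ erefl).
Qed.

Lemma heavier_graft t i s s' : heavier s s' -> heavier (graft t i s) (graft t i s').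
Proof.
move=> hs; elim: t i => [|g l IHl r IHr] i //=.
case: leqP => _.
  have [[Dl]|//] := heavier_node g (or_intror (IHl i)) (or_introl (erefl r)).
  by case: (heavier_neq (IHl i)).
have [[Dr]|//] := heavier_node g (or_introl (erefl l)) (or_intror (IHr (i - (nodes l).+1)%N)).
by case: (heavier_neq (IHr (i - (nodes l).+1)%N)).
Qed.

End Plug.

(** * Coefficients of the Koszul differential *)

Section Diff.
Variables (K : fieldType) (G : finType).
Local Notation btree := (btree G).
Local Notation chain := (chain K G).

Lemma sum_delta_r (T : finType) (F : T -> K) a : \sum_b F b * (b == a)%:R = F a.
Proof.
rewrite (bigD1 a) //= eqxx mulr1 big1 ?addr0 // => b /negPf->.
by rewrite mulr0.
Qed.

Lemma sum_pair (T U : finType) (F : T * U -> K) : \sum_c F c = \sum_a \sum_b F (a, b).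
Proof. by rewrite pair_bigA; apply: eq_bigr => -[]. Qed.

Lemma graft_gen_subproof k (t : tree G k) i g :
  nodes (graft (val t) i (Node g Leaf Leaf)) == k.+1.
Proof. by rewrite nodes_graft nodes_val addn1. Qed.

Definition graft_gen k (t : tree G k) i g : tree G k.+1 :=
  Sub (graft (val t) i (Node g Leaf Leaf)) (graft_gen_subproof t i g).

Lemma diff_coef k n (z : chain k.+1 n) t f :
  koszul_diff z (t, f) =
  \sum_(i < k.+1) \sum_g (-1) ^+ i *
     \sum_(f' : forest G k.+1 n) z (graft_gen t i g, f') * (f == Defs.merge i g f')%:R.
Proof.
rewrite /koszul_diff sum_ffunE.
transitivity (\sum_c \sum_(i < k.+1) \sum_g z c * ((c.1 == graft_gen t i g)%:R *
                ((-1) ^+ i * (f == Defs.merge i g c.2)%:R))).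
  apply: eq_bigr => c _; rewrite ffunE sum_ffunE [_ *: _]mulr_sumr (bigD1 t) //=.
  rewrite [X in _ + X]big1 ?addr0; last first.
    move=> t' ne_t; rewrite sum_ffunE big1 ?mulr0 // => i _.
    rewrite sum_ffunE big1 // => g _; rewrite !ffunE xpair_eqE eq_sym (negPf ne_t).
    by rewrite [_ *: _]mulr0.
  rewrite sum_ffunE mulr_sumr; apply: eq_bigr => i _.
  rewrite sum_ffunE mulr_sumr big_mkcond; apply: eq_bigr => g _ /=.
  rewrite -(inj_eq val_inj) /=; case: ifP => _; last by rewrite mul0r mulr0.
  by rewrite !ffunE xpair_eqE eqxx mul1r.
rewrite exchange_big /=; apply: eq_bigr => i _.
rewrite exchange_big /=; apply: eq_bigr => g _.
rewrite sum_pair exchange_big mulr_sumr /=; apply: eq_bigr => f' _.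
under eq_bigr => t' _ do rewrite mulrCA mulrC.
by rewrite sum_delta_r; ring.
Qed.

(** The transpose of the differential: chains are tested for being null by such pairings with a
    function w of the forest. *)
Lemma diff_adj k n (z : chain k.+1 n) t (w : forest G k n -> K) :
  \sum_f koszul_diff z (t, f) * w f =
  \sum_(i < k.+1) \sum_g (-1) ^+ i *
     \sum_(f' : forest G k.+1 n) z (graft_gen t i g, f') * w (Defs.merge i g f').
Proof.
under eq_bigr => f _.
  rewrite diff_coef mulr_suml.
  under eq_bigr => i _ do rewrite mulr_suml.
  over.
rewrite exchange_big /=; apply: eq_bigr => i _.
rewrite exchange_big /=; apply: eq_bigr => g _.
under eq_bigr => f _ do rewrite -mulrA mulr_suml.
rewrite -mulr_sumr exchange_big /=; congr (_ * _); apply: eq_bigr => f' _.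
under eq_bigr => f _ do rewrite -mulrA [_%:R * _]mulrC mulrA.
by rewrite sum_delta_r.
Qed.

End Diff.

Section Diff2.
Variables (K : fieldType) (G : finType).
Local Notation btree := (btree G).
Local Notation chain := (chain K G).

Definition split_seq i (l r : btree) (f : seq btree) := take i f ++ l :: r :: drop i.+1 f.

Lemma split_mergeP i g g0 l r (f f' : seq btree) :
  (i < size f)%N -> (i.+1 < size f')%N -> nth Leaf f i = Node g0 l r ->
  (f == merge_seq i g f') = (g == g0) && (f' == split_seq i l r f).
Proof.
move=> lt_if lt_if' Df; have sz' : size (take i f') = i by rewrite size_takel //; lia.
apply/eqP/andP=> [Dm|[/eqP-> /eqP Df']].
  have := Df; rewrite Dm /merge_seq nth_cat sz'.
  rewrite ltnn subnn /= => -[-> <- <-]; rewrite eqxx; split=> //.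
  rewrite /split_seq take_size_cat //.
  rewrite -[take i f' ++ Node _ _ _ :: _]cat_rcons drop_size_cat ?size_rcons ?sz' //.
  by rewrite -!drop_nth ?cat_take_drop // ltnW.
have sz : size (take i f) = i by rewrite size_takel // ltnW.
rewrite Df' /split_seq /merge_seq.
rewrite take_size_cat // !nth_cat sz ltnn ltnNge leqnSn /= subnn subSnn /=.
rewrite -!cat_rcons drop_size_cat ?size_rcons ?sz // cat_rcons -Df.
by rewrite -drop_nth ?cat_take_drop.
Qed.

Lemma split_forestP k n (f : forest G k n) i g l r : (i < k.+1)%N ->
  nth Leaf (val f) i = Node g l r ->
  (size (split_seq i l r (val f)) == k.+2)
  && (k.+1 + sumn (map (@nodes G) (split_seq i l r (val f))) == n)%N.
Proof.
have /andP[/eqP sz_f /eqP] := valP f; move: (val f) sz_f => s sz_s Dn lt_i Dg.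
have Ds : s = take i s ++ Node g l r :: drop i.+1 s.
  by rewrite -Dg -drop_nth ?cat_take_drop ?sz_s.
apply/andP; split.
  by rewrite size_cat /= size_takel ?size_drop ?sz_s; lia.
by rewrite -Dn [in X in _ == X]Ds /split_seq !map_cat !sumn_cat /=; lia.
Qed.

Definition lower_at (F : btree -> seq btree -> K) t f i : K :=
  if nth Leaf f i is Node g l r then
    (-1) ^+ i * F (graft t i (Node g Leaf Leaf)) (split_seq i l r f)
  else 0.

(** Extension by 0 to all trees and all lists of trees, which removes the dependent indices. *)
Definition raw k n (z : chain k n) t f : K :=
  if insub t is Some t' then if insub f is Some f' then z (t', f') else 0 else 0.

Lemma rawE k n (z : chain k n) (t : tree G k) (f : forest G k n) :
  raw z (val t) (val f) = z (t, f).
Proof. by rewrite /raw !valK. Qed.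

Lemma diff_lower k n (z : chain k.+1 n) t f :
  koszul_diff z (t, f) = \sum_(i < k.+1) lower_at (raw z) (val t) (val f) i.
Proof.
rewrite diff_coef; apply: eq_bigr => i _.
have /andP[/eqP sz_f _] := valP f.
have lt_if : (i < size (val f))%N by rewrite sz_f.
have lt_if' (f' : forest G k.+1 n) : (i.+1 < size (val f'))%N.
  by have /andP[/eqP-> _] := valP f'; rewrite ltnS.
rewrite /lower_at; case Df: nth => [|g0 l r].
  rewrite big1 // => g _; rewrite big1 ?mulr0 // => f' _.
  rewrite -(inj_eq val_inj) /= (_ : _ == _ = false) ?mulr0 //.
  apply/eqP => Dm; move: Df.
  have -> : val f = merge_seq i g (val f') by [].
  rewrite /merge_seq nth_cat.
  by rewrite size_takel ?ltnn ?subnn // ltnW // ltnW.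
have key g f' : (f == Defs.merge i g f') = (g == g0) && (val f' == split_seq i l r (val f)).
  by rewrite -(inj_eq val_inj); exact: split_mergeP.
rewrite (bigD1 g0) //= [X in _ + X]big1 ?addr0; last first.
  move=> g /negPf ne_g; rewrite big1 ?mulr0 // => f' _.
  by rewrite key ne_g mulr0.
congr (_ * _); pose f0 : forest G k.+1 n :=
  Sub (split_seq i l r (val f)) (split_forestP (ltn_ord i) Df).
rewrite -[raw z _ _]/(raw z (val (graft_gen t i g0)) (val f0)) rawE.
rewrite -[RHS](sum_delta_r (fun f' => z (graft_gen t i g0, f')) f0).
by apply: eq_bigr => f' _; rewrite key eqxx.
Qed.

(** The leaves of the right subtree come after the [(low A).+1] leaves of the left one: this shift
    of ranks is the sign in [ct_diff]. *)
Lemma ct_diff_lower (F : btree -> seq btree -> K) A :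
  ct_diff (fun A' => F (ct_bot A') (ct_top A')) A
  = \sum_(0 <= i < (low A).+1) lower_at F (ct_bot A) (ct_top A) i.
Proof.
elim: A F => [t|g A IHA B IHB] F /=.
  by rewrite big_nat1; case: t => [|g l r] //; rewrite /lower_at /= expr0 mul1r.
rewrite (IHA (fun a fa => F (Node g a (ct_bot B)) (fa ++ ct_top B))).
rewrite (IHB (fun b fb => F (Node g (ct_bot A) b) (ct_top A ++ fb))).
have szA := size_ct_top A; have szB := size_ct_top B.
have -> : (low (Low g A B)).+1 = ((low B).+1 + (low A).+1)%N.
  by rewrite /low /=; lia.
rewrite [in RHS](@big_cat_nat _ _ _ (low A).+1) //=; last by lia.
congr (_ + _); last first.
  rewrite (big_addn 0 _ (low A).+1) addnK mulr_sumr.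
  apply: eq_bigr => i _; rewrite /lower_at -/(low A) nth_cat ltnNge szA leq_addl /= addnK.
  case: nth => [|h l r]; rewrite ?mulr0 /= -?/(low A) // ifF; last by lia.
  rewrite /split_seq take_cat drop_cat szA !ifF; try lia.
  by rewrite -addSn !addnK catA mulrA -exprD addnC.
apply: eq_big_nat => i /= lt_i; rewrite /lower_at -/(low A) nth_cat szA lt_i.
case: nth => [|h l r] //=; rewrite -/(low A) ifT; last by lia.
rewrite /split_seq take_cat drop_cat szA lt_i -catA /=.
case: ltnP => // le; rewrite drop_oversize ?szA //.
by rewrite (_ : _ - _ = 0)%N ?drop0 //; lia.
Qed.

Lemma chain_fun_diff k n (z : chain k.+1 n) t f :
  koszul_diff z (t, f) = ct_diff (fun A => raw z (ct_bot A) (ct_top A)) (cut (val t) (val f)).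
Proof.
have /andP[/eqP sz_f _] := valP f.
rewrite diff_lower ct_diff_lower ct_bot_cut ct_top_cut ?nodes_val //.
by rewrite /low ct_bot_cut nodes_val big_mkord.
Qed.

End Diff2.

(** * Chains up to null chains *)

Section Subspaces.
Variables (K : fieldType) (V : lmodType K) (W : V -> Prop).
Hypothesis subW : is_subspace W.

Lemma subspaceZ a x : W x -> W (a *: x).
Proof. by case: subW => W0 WD Wx; rewrite -[_ *: _]addr0; exact: WD. Qed.

Lemma subspaceD x y : W x -> W y -> W (x + y).
Proof. by case: subW => _ WD Wx Wy; rewrite -[x]scale1r; exact: WD. Qed.

Lemma subspaceB x y : W x -> W y -> W (x - y).
Proof. by move=> Wx Wy; apply: subspaceD => //; rewrite -scaleN1r; exact: subspaceZ. Qed.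

Lemma subspace_sum (I : Type) (r : seq I) (P : pred I) (F : I -> V) :
  (forall i, P i -> W (F i)) -> W (\sum_(i <- r | P i) F i).
Proof.
by move=> WF; elim/big_ind: _ => //; [case: subW | exact: subspaceD].
Qed.

End Subspaces.

Section Span.
Variables (K : fieldType) (V : lmodType K) (A : V -> Prop).

Lemma span_subspace : is_subspace (Defs.span A).
Proof.
split=> [W [W0 _] _ //|a x y Sx Sy W sW AW].
by case: (sW) => _; apply; [exact: Sx | exact: Sy].
Qed.

Lemma mem_span x : A x -> Defs.span A x.
Proof. by move=> Ax W _; apply. Qed.

End Span.

Lemma sum_linear (K : fieldType) (T : finType) a (x y : {ffun T -> K^o}) (w : T -> K) :
  \sum_t (a *: x + y) t * w t = a * (\sum_t x t * w t) + \sum_t y t * w t.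
Proof.
by rewrite mulr_sumr -big_split; apply: eq_bigr => t _; rewrite !ffunE mulrDl mulrA.
Qed.

Section Chains.
Variables (K : fieldType) (G : finType) (R : Free K G 2 -> Prop).
Local Notation btree := (btree G).
Local Notation Free := (Free K G).
Local Notation chain := (chain K G).
Local Notation dual := (dual_component R).

Lemma dual_subspace k : is_subspace (@dual_component K G R k).
Proof.
split=> [y _|a x x' Dx Dx' y Iy].
  by rewrite big1 // => t _; rewrite ffunE mul0r.
by rewrite sum_linear Dx // Dx' // mulr0 addr0.
Qed.

Definition row_at k n (z : chain k n) f : Free k := [ffun t => z (t, f)].

Definition has_dual_rows k n (z : chain k n) := forall f, dual (row_at z f).

Lemma has_dual_rows_subspace k n : is_subspace (@has_dual_rows k n).
Proof.
have [D0 DD] := dual_subspace k; split=> [f|a x y Dx Dy f].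
  by rewrite (_ : row_at 0 f = 0) //; apply/ffunP=> t; rewrite !ffunE.
rewrite (_ : row_at _ f = a *: row_at x f + row_at y f); first exact: DD.
by apply/ffunP=> t; rewrite !ffunE.
Qed.

Lemma forest_nodes k n (f : forest G k n) : size (val f) = k.+1.
Proof. by have /andP[/eqP] := valP f. Qed.

Definition forest_tree k n (f : forest G k n) j : tree G (nodes (nth Leaf (val f) j)) :=
  Sub (nth Leaf (val f) j) (eqxx (nodes (nth Leaf (val f) j))).

Lemma coef_delta m (t : tree G m) s : coef (delta K t) s = (s == val t)%:R.
Proof.
rewrite /coef; case: insubP => [t' _ <-|nt]; first by rewrite ffunE -(inj_eq val_inj).
by case: (s =P val t) nt => // ->; rewrite (valP t).
Qed.

Lemma coefB m (x y : Free m) s : coef (x - y) s = coef x s - coef y s.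
Proof. by rewrite /coef; case: insubP => [t _ _|_]; rewrite ?subr0 // !ffunE. Qed.

Lemma forest_eq_prod k n (h f : forest G k n) :
  (h == f)%:R = \prod_(j < k.+1) (nth Leaf (val h) j == nth Leaf (val f) j)%:R :> K.
Proof.
case: eqP => [->|ne_hf]; first by rewrite big1 // => j _; rewrite eqxx.
case: (pickP (fun j : 'I_k.+1 => nth Leaf (val h) j != nth Leaf (val f) j)) => [j ne_j|eq_hf].
  by rewrite (bigD1 j) //= (negPf ne_j) mul0r.
case: ne_hf; apply: val_inj; apply: (@eq_from_nth _ Leaf); first by rewrite !forest_nodes.
by move=> j; rewrite forest_nodes => lt_j; have /negbFE/eqP := eq_hf (Ordinal lt_j).
Qed.

Definition elem k n (y : Free k) (f : forest G k n) : chain k n :=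
  [ffun c => y c.1 * (c.2 == f)%:R].

Lemma elem_tensor k n (y : Free k) (f : forest G k n) :
  elem y f = tensor n y (fun j => delta K (forest_tree f j)).
Proof.
apply/ffunP=> -[t h]; rewrite !ffunE /= forest_eq_prod; congr (_ * _).
by apply: eq_bigr => j _; rewrite coef_delta.
Qed.

Lemma chain_elem k n (z : chain k n) : z = \sum_f elem (row_at z f) f.
Proof.
apply/ffunP=> -[t h]; rewrite sum_ffunE.
rewrite -[LHS](sum_delta_r (fun f => z (t, f)) h).
by apply: eq_bigr => f _; rewrite !ffunE /= [h == f]eq_sym.
Qed.

(** The space of chains is the dual component tensored with the space on all forests, so membership
    can be tested one forest at a time. *)
Lemma koszul_chainP k n (z : chain k n) : koszul_chain R z <-> has_dual_rows z.
Proof.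
split=> [Cz|Dz].
  apply: Cz; first exact: has_dual_rows_subspace.
  move=> _ [y [m [x [Dy ->]]]] f; rewrite (_ : row_at _ f =
      (\prod_(j < k.+1) coef (x j) (nth Leaf (val f) j)) *: y).
    exact: subspaceZ (dual_subspace k) _ _ Dy.
  by apply/ffunP=> t; rewrite !ffunE mulrC.
rewrite [z]chain_elem; apply: subspace_sum; first exact: span_subspace.
move=> f _; apply: mem_span; rewrite elem_tensor.
by do 3!eexists; split; last by []; exact: Dz.
Qed.

Lemma sum_op_comp n m (x : Free n) i (y : Free m) (w : btree -> K) :
  \sum_t (x o_(i) y) t * w (val t)
  = \sum_a \sum_b x a * y b * w (graft (val a) i (val b)).
Proof.
rewrite /op_comp /= /lin_comp.
under eq_bigr => t _ do rewrite sum_ffunE mulr_suml.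
rewrite exchange_big /=; apply: eq_bigr => a _.
under eq_bigr => t _ do rewrite sum_ffunE mulr_suml.
rewrite exchange_big /=; apply: eq_bigr => b _.
under eq_bigr => t _ do rewrite !ffunE [_ *: _]/(_ * _) -mulrA [_%:R * _]mulrC mulrA.
by rewrite sum_delta_r.
Qed.

Variable nf : btree -> btree.
Hypothesis nodes_nf : forall t, nodes (nf t) = nodes t.
Hypothesis nf_graftl : forall t i s, (i <= nodes t)%N ->
  nf (graft t i s) = nf (graft (nf t) i s).
Hypothesis nf_graftr : forall t i s, (i <= nodes t)%N ->
  nf (graft t i s) = nf (graft t i (nf s)).
Hypothesis nf_nf : forall t, nf (nf t) = nf t.

(** The coefficients of x sum to 0 over each fibre of [nf]. This describes the ideal generated by R:
    [ideal_kills] is one inclusion, and [nf_ideal] accounts for the other. *)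
Definition kills_classes k (x : Free k) :=
  forall w : btree -> K, \sum_t x t * w (nf (val t)) = 0.

Hypothesis R_nf : forall x, R x -> kills_classes x.

Lemma nf_tree_subproof k (t : tree G k) : nodes (nf (val t)) == k.
Proof. by rewrite nodes_nf (valP t). Qed.

Definition nf_tree k (t : tree G k) : tree G k := Sub (nf (val t)) (nf_tree_subproof t).

Hypothesis nf_ideal : forall k (t : tree G k),
  ideal_gen R k (delta K t - delta K (nf_tree t)).

Definition class_ideal : opIdeal Free.
Proof.
apply: (@OpIdeal K Free (@kills_classes)) => [n|n m x i y le_in kx w|n m x i y le_in ky w].
- split=> [w|a x y kx ky w]; first by rewrite big1 // => t _; rewrite ffunE mul0r.
  by rewrite sum_linear kx ky mulr0 addr0.
- rewrite (sum_op_comp x i y (fun s => w (nf s))) exchange_big big1 // => b _.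
  transitivity (y b * \sum_a x a * w (nf (graft (nf (val a)) i (val b)))).
    rewrite mulr_sumr; apply: eq_bigr => a _.
    by rewrite nf_graftl ?nodes_val // mulrCA mulrA.
  by rewrite (kx (fun s => w (nf (graft s i (val b))))) mulr0.
rewrite (sum_op_comp x i y (fun s => w (nf s))) big1 // => a _.
transitivity (x a * \sum_b y b * w (nf (graft (val a) i (nf (val b))))).
  rewrite mulr_sumr; apply: eq_bigr => b _.
  by rewrite nf_graftr ?nodes_val // mulrA.
by rewrite (ky (fun s => w (nf (graft (val a) i s)))) mulr0.
Defined.

Lemma ideal_kills k (x : Free k) : ideal_gen R k x -> kills_classes x.
Proof. by move=> Ix; apply: (Ix class_ideal) => y /R_nf. Qed.

(** The analogue of [kills_classes] for forests. On chains with dual rows it agrees with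
    [koszul_null], by [koszul_null_nf] and [nf_null_koszul]. *)
Definition nf_null k n (z : chain k n) :=
  forall t (w : seq btree -> K), \sum_f z (t, f) * w (map nf (val f)) = 0.

Lemma nf_null_subspace k n : is_subspace (@nf_null k n).
Proof.
split=> [t w|a x y Nx Ny t w]; first by rewrite big1 // => f _; rewrite ffunE mul0r.
transitivity (a * \sum_f x (t, f) * w (map nf (val f)) + \sum_f y (t, f) * w (map nf (val f))).
  by rewrite mulr_sumr -big_split; apply: eq_bigr => f _; rewrite !ffunE mulrDl mulrA.
by rewrite Nx Ny mulr0 addr0.
Qed.

Definition set_tree k n (f : forest G k n) j s : forest G k n :=
  insubd f (set_nth Leaf (val f) j s).

Lemma val_set_tree k n (f : forest G k n) j s : (j < k.+1)%N ->
  nodes s = nodes (nth Leaf (val f) j) ->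
  val (set_tree f j s) = set_nth Leaf (val f) j s.
Proof.
move=> lt_j Ds; rewrite val_insubd ifT //.
have /andP[/eqP sz_f /eqP] := valP f; move: (val f) sz_f Ds => u sz_u Ds.
rewrite -[in X in X -> _](cat_take_drop j u) (drop_nth Leaf) ?sz_u // set_nthE sz_u lt_j.
rewrite !map_cat !sumn_cat /= Ds size_cat /= size_takel ?size_drop ?sz_u; last by lia.
by move=> ->; rewrite eqxx andbT; lia.
Qed.

Lemma set_treeK k n (f : forest G k n) j s s' : (j < k.+1)%N ->
  nth Leaf (val f) j = s' -> nodes s = nodes s' -> set_tree (set_tree f j s) j s' = f.
Proof.
move=> lt_j Df Ns; have Dv : val (set_tree f j s) = set_nth Leaf (val f) j s.
  by rewrite val_set_tree ?Df.
have Dj : nth Leaf (val (set_tree f j s)) j = s by rewrite Dv nth_set_nth /= eqxx.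
apply: val_inj; rewrite val_set_tree ?Dj // Dv set_set_nth eqxx -Df.
apply: (@eq_from_nth _ Leaf).
  by rewrite size_set_nth forest_nodes; apply/maxn_idPr.
by move=> i _; rewrite nth_set_nth /=; case: eqP => [->|].
Qed.

(** Summing out the other trees of the forest leaves a function Psi of the tree of rank j0; it is
    constant on the classes of [nf], and x j0 kills such functions. *)
Lemma tensor_nf_null k n (y : Free k) (m : 'I_k.+1 -> nat) (x : forall j, Free (m j)) j0 :
  kills_classes (x j0) -> nf_null (tensor n y x).
Proof.
move=> kx t w.
pose Y (f : forest G k n) := \prod_(j < k.+1 | j != j0) coef (x j) (nth Leaf (val f) j).
pose Psi (s : btree) := \sum_(f : forest G k n | nth Leaf (val f) j0 == s)
   Y f * w (map nf (val f)).
(* Exchanging s and s' at rank j0 is a bijection between the two sets of forests that keeps all the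
   normal forms. *)
have PsiE s s' : nf s = nf s' -> nodes s = nodes s' -> Psi s = Psi s'.
  move=> Ds Ns; rewrite /Psi (reindex_onto (fun f => set_tree f j0 s)
      (fun f => set_tree f j0 s')) /=; last first.
    by move=> f /eqP Df; rewrite set_treeK.
  have setE (f : forest G k n) : nth Leaf (val f) j0 = s' ->
      val (set_tree f j0 s) = set_nth Leaf (val f) j0 s.
    by move=> Df; rewrite val_set_tree ?Df.
  apply: eq_big => [f|f].
    apply/andP/eqP => [[/eqP Dfs /eqP Dff]|Df]; last first.
      by rewrite setE // nth_set_nth /= set_treeK // !eqxx.
    rewrite -[f in LHS]Dff val_set_tree ?Dfs //.
    by rewrite nth_set_nth /= eqxx.
  case/andP=> /eqP Dfs /eqP Dff.
  have Df : nth Leaf (val f) j0 = s'.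
    by rewrite -[f in LHS]Dff val_set_tree ?Dfs // nth_set_nth /= eqxx.
  congr (_ * w _).
    apply: eq_bigr => j ne_j; rewrite setE // nth_set_nth /=.
    by rewrite (inj_eq val_inj) (negPf ne_j).
  rewrite setE //; apply: (@eq_from_nth _ (nf Leaf)).
    rewrite !size_map size_set_nth forest_nodes.
    by apply/maxn_idPr; exact: ltn_ord.
  move=> i; rewrite size_map size_set_nth forest_nodes => lt_i.
  have {}lt_i : (i < k.+1)%N by move: lt_i (ltn_ord j0); lia.
  rewrite (nth_map Leaf) ?size_set_nth ?forest_nodes; last by lia.
  rewrite (nth_map Leaf) ?forest_nodes // nth_set_nth /=.
  by case: eqP => // ->; rewrite Df.
transitivity (y t * \sum_(s : tree G (m j0)) x j0 s * Psi (nf (val s))); last first.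
  by rewrite (kx Psi) mulr0.
under [in RHS]eq_bigr => s _.
  rewrite (PsiE _ (val s)) ?nf_nf ?nodes_nf // /Psi mulr_sumr big_mkcond /=.
  over.
rewrite exchange_big mulr_sumr /=; apply: eq_bigr => f _.
rewrite ffunE /= (bigD1 j0) //= -/(Y f) -!mulrA; congr (_ * _).
rewrite -big_mkcond /= -mulr_suml; congr (_ * _).
rewrite /coef; case: insubP => [s' _ Ds'|nf'].
  by rewrite -Ds' (eq_bigl (pred1 s')) ?big_pred1_eq // => s /=; rewrite -(inj_eq val_inj) eq_sym.
by rewrite big_pred0 // => s; apply: contraNF nf' => /eqP->; exact: valP s.
Qed.

Lemma koszul_null_nf k n (z : chain k n) : koszul_null R z -> nf_null z.
Proof.
apply; first exact: nf_null_subspace.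
move=> _ [y [m [x [_ [j Ij] ->]]]].
by apply: (@tensor_nf_null _ _ _ _ _ j); exact: ideal_kills.
Qed.

Lemma koszul_null_subspace k n : is_subspace (@koszul_null K G R k n).
Proof. exact: span_subspace. Qed.

Lemma elem_step_null k n (y : Free k) (f : forest G k n) j0 : (j0 < k.+1)%N -> dual y ->
  koszul_null R (elem y f - elem y (set_tree f j0 (nf (nth Leaf (val f) j0)))).
Proof.
move=> lt_j Dy; pose i0 := Ordinal lt_j; apply: mem_span.
exists y, (fun j : 'I_k.+1 => nodes (nth Leaf (val f) j)), (fun j : 'I_k.+1 => if j == i0 then
  delta K (forest_tree f j) - delta K (nf_tree (forest_tree f j)) else delta K (forest_tree f j)).
split=> //; first by exists i0; rewrite eqxx; exact: nf_ideal.
apply/ffunP=> -[t h]; rewrite !ffunE /= -mulrBr; congr (_ * _).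
rewrite !forest_eq_prod (bigD1 i0) //= [X in _ - X](bigD1 i0) //= [RHS](bigD1 i0) //=.
rewrite eqxx coefB !coef_delta.
rewrite val_set_tree ?nodes_nf // nth_set_nth /= eqxx mulrBl.
congr (_ * _ - _ * _); apply: eq_bigr => j ne_j; rewrite (negPf ne_j) ?coef_delta //.
by rewrite nth_set_nth /= ifN.
Qed.

Lemma nf_forest_subproof k n (f : forest G k n) :
  (size (map nf (val f)) == k.+1) && (k + sumn (map (@nodes G) (map nf (val f))) == n)%N.
Proof. by rewrite size_map -map_comp (eq_map nodes_nf) (valP f). Qed.

Definition nf_forest k n (f : forest G k n) : forest G k n :=
  Sub (map nf (val f)) (nf_forest_subproof f).

Lemma elem_nf_null k n (y : Free k) (f : forest G k n) : dual y ->
  koszul_null R (elem y f - elem y (nf_forest f)).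
Proof.
move=> Dy; have sz_f := forest_nodes f.
(* A generator of the null space has a factor in the ideal at a chosen rank, so the trees are
   reduced one by one: f' is f with its first j trees in normal form. *)
suff /(_ k.+1 (leqnn _)) [f' Df' nf'] j : (j <= k.+1)%N -> exists2 f' : forest G k n,
    val f' = map nf (take j (val f)) ++ drop j (val f) & koszul_null R (elem y f - elem y f').
  rewrite (_ : nf_forest f = f') //; apply: val_inj.
  by rewrite Df' take_oversize ?drop_oversize ?cats0 ?sz_f.
elim: j => [_|j IHj lt_j].
  exists f; first by rewrite take0 drop0.
  by rewrite subrr; case: (koszul_null_subspace k n).
have [f' Df' nf'] := IHj (ltnW lt_j).
have szj : size (map nf (take j (val f))) = j by rewrite size_map size_takel // sz_f ltnW.
have Dj : nth Leaf (val f') j = nth Leaf (val f) j.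
  by rewrite Df' nth_cat szj ltnn subnn nth_drop addn0.
exists (set_tree f' j (nf (nth Leaf (val f') j))).
  rewrite val_set_tree ?nodes_nf // set_nthE forest_nodes lt_j Dj Df'.
  rewrite take_size_cat // (take_nth Leaf) ?sz_f // map_rcons cat_rcons.
  set u := map _ _ in szj *; congr (_ ++ _ :: _).
  by rewrite drop_cat szj ltnNge leqnSn subSnn drop_drop.
rewrite -[elem y f](subrK (elem y f')) -addrA.
by apply: (subspaceD (koszul_null_subspace k n) nf'); exact: elem_step_null.
Qed.

Lemma nf_null_koszul k n (z : chain k n) :
  has_dual_rows z -> nf_null z -> koszul_null R z.
Proof.
move=> Dz Nz.
(* The subtracted sum is zero: its coefficient at a forest h is the pairing of z with the indicator
   of h, which vanishes by hypothesis. *)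
have -> : z = \sum_f (elem (row_at z f) f - elem (row_at z f) (nf_forest f)).
  rewrite sumrB -chain_elem [X in _ - X](_ : _ = 0) ?subr0 //.
  apply/ffunP=> -[t h]; rewrite sum_ffunE ffunE -[RHS](Nz t (fun u => (u == val h)%:R)).
  by apply: eq_bigr => f _; rewrite !ffunE /= -(inj_eq val_inj) eq_sym.
apply: subspace_sum; first exact: koszul_null_subspace.
by move=> f _; apply: elem_nf_null; exact: Dz.
Qed.

End Chains.

(** * The dual component *)

Section Dual.
Variables (K : fieldType) (G : finType) (R : Free K G 2 -> Prop).
Local Notation btree := (btree G).
Local Notation Free := (Free K G).
Local Notation chain := (chain K G).

(** X is a function on trees of all sizes, so that a context can be put around its argument without
    changing the type of X. *)
Definition dualf k (X : btree -> K) := dual_component R [ffun t : tree G k => X (val t) : K^o].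

Lemma dualfE k X (y : Free k) : dualf k X -> ideal_gen (Defs.orthogonal R) k y ->
  \sum_t y t * X (val t) = 0.
Proof.
by move=> DX /DX E; rewrite -[RHS]E; apply: eq_bigr => t _; rewrite ffunE mulrC.
Qed.

Lemma dualfP k X : (forall y : Free k, ideal_gen (Defs.orthogonal R) k y ->
  \sum_t y t * X (val t) = 0) -> dualf k X.
Proof.
by move=> DX y /DX E; rewrite -[RHS]E; apply: eq_bigr => t _; rewrite ffunE mulrC.
Qed.

Lemma dualf_coef k (x : Free k) : dual_component R x -> dualf k (coef x).
Proof.
by congr (dual_component R); apply/ffunP=> t; rewrite ffunE /coef valK.
Qed.

(** The annihilator of an ideal is stable under the transpose of grafting: this is the decomposition
    map of the dual cooperad. *)
Lemma dualf_l n m X i (b : tree G m) : (i <= n)%N -> dualf (n + m)%N X ->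
  dualf n (fun t => X (graft t i (val b))).
Proof.
move=> le_in DX; apply: dualfP => y Iy.
rewrite -[RHS](dualfE DX (ideal_compl (delta K b : Free m) le_in Iy)) sum_op_comp.
apply: eq_bigr => a _; under eq_bigr => b' _ do rewrite ffunE -mulrA [_%:R * _]mulrC mulrA.
by rewrite sum_delta_r.
Qed.

Lemma dualf_r n m X i (a : tree G n) : (i <= n)%N -> dualf (n + m)%N X ->
  dualf m (fun t => X (graft (val a) i t)).
Proof.
move=> le_in DX; apply: dualfP => y Iy.
rewrite -[RHS](dualfE DX (ideal_compr (delta K a : Free n) le_in Iy)) sum_op_comp exchange_big.
apply: eq_bigr => b _; under eq_bigr => a' _ do
  rewrite ffunE -mulrA mulrC.
by rewrite (sum_delta_r (fun a' => y b * X (graft (val a') i (val b)))).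
Qed.

Lemma diff_dual_rows k n (z : chain k.+1 n) :
  has_dual_rows R z -> has_dual_rows R (koszul_diff z).
Proof.
move=> Dz f.
have -> : row_at (koszul_diff z) f = \sum_(i < k.+1) \sum_g \sum_(f' : forest G k.+1 n)
    ((-1) ^+ i * (f == Defs.merge i g f')%:R) *:
    [ffun t : tree G k => coef (row_at z f') (graft (val t) i (Node g Leaf Leaf)) : K^o].
  apply/ffunP=> t; rewrite ffunE diff_coef sum_ffunE; apply: eq_bigr => i _.
  rewrite sum_ffunE; apply: eq_bigr => g _; rewrite sum_ffunE mulr_sumr.
  apply: eq_bigr => f' _; rewrite !ffunE [_ *: _]/(_ * _).
  rewrite -[graft _ _ _]/(val (graft_gen t i g)) /coef valK ffunE.
  by rewrite -[RHS]mulrA [X in _ = _ * X]mulrC.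
have sD := dual_subspace R k.
apply: (subspace_sum sD) => i _; apply: (subspace_sum sD) => g _.
apply: (subspace_sum sD) => f' _.
apply: (subspaceZ sD).
apply: (@dualf_l _ 1%N _ _ (corolla _)); first by rewrite -ltnS ltn_ord.
by rewrite addn1; exact: dualf_coef (Dz _).
Qed.

Lemma diffD k n (x y : chain k.+1 n) : koszul_diff (x + y) = koszul_diff x + koszul_diff y.
Proof.
by rewrite /koszul_diff -big_split; apply: eq_bigr => c _; rewrite !ffunE scalerDl.
Qed.

Lemma diffB k n (x y : chain k.+1 n) : koszul_diff (x - y) = koszul_diff x - koszul_diff y.
Proof.
by rewrite /koszul_diff -sumrB; apply: eq_bigr => c _; rewrite !ffunE scalerBl.
Qed.

Definition left2 (h g : G) := Node h (Node g Leaf Leaf) Leaf.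
Definition right2 (h g : G) := Node h Leaf (Node g Leaf Leaf).

Lemma nodes2 (s : btree) : nodes s = 2 ->
  exists h g, s = left2 h g \/ s = right2 h g.
Proof.
case: s => //= h [|g l r] [|g' l' r'] //= [].
- by case: l' => [|? ? ?] /=; [case: r' => //= _; exists h, g'; right | lia].
- by case: l => [|? ? ?] /=; [case: r => //= _; exists h, g; left | lia].
by lia.
Qed.

Lemma sum_tree2 (X : btree -> K) :
  \sum_(s : tree G 2) X (val s) = \sum_h \sum_g (X (left2 h g) + X (right2 h g)).
Proof.
pose ins (t : btree) : K := \sum_(s : tree G 2) (val s == t)%:R * X t.
have insE t : nodes t == 2 -> ins t = X t.
  move=> nt; rewrite /ins (bigD1 (Sub t nt)) //= eqxx mul1r big1 ?addr0 // => s.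
  by rewrite -(inj_eq val_inj) /= => /negPf->; rewrite mul0r.
transitivity (\sum_h \sum_g (ins (left2 h g) + ins (right2 h g))); last first.
  by apply: eq_bigr => h _; apply: eq_bigr => g _; rewrite !insE.
rewrite /ins; under [RHS]eq_bigr => h _ do
  (under eq_bigr => g _ do rewrite -big_split /=; rewrite exchange_big /=).
rewrite exchange_big; apply: eq_bigr => s _.
move: (nodes2 (eqP (valP s))) => /=; move: (sval s) => {}s [h0 [g0]].
have eqL h g h' g' : (left2 h g == left2 h' g') = (h == h') && (g == g').
  by apply/eqP/andP=> [[-> ->]|[/eqP-> /eqP->]].
have eqR h g h' g' : (right2 h g == right2 h' g') = (h == h') && (g == g').
  by apply/eqP/andP=> [[-> ->]|[/eqP-> /eqP->]].
have eqLR h g h' g' : (left2 h g == right2 h' g') = false by apply/eqP.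
have eqRL h g h' g' : (right2 h g == left2 h' g') = false by apply/eqP.
have sum1 (F : G -> G -> K) : (forall h g, (h == h0) && (g == g0) = false -> F h g = 0) ->
    \sum_h \sum_g F h g = F h0 g0.
  move=> F0; rewrite pair_bigA (bigD1 (h0, g0)) //= big1 ?addr0 // => -[h g] /= /negPf.
  by rewrite xpair_eqE => /F0.
case=> ->; rewrite sum1 ?eqL ?eqR ?eqLR ?eqRL ?eqxx /= ?mul1r ?mul0r ?addr0 ?add0r //.
  by move=> h g nE; rewrite eqL eqLR [_ == h]eq_sym [_ == g]eq_sym nE !mul0r addr0.
by move=> h g nE; rewrite eqR eqRL [_ == h]eq_sym [_ == g]eq_sym nE !mul0r addr0.
Qed.

Definition tree_sign (s : btree) : K := if left_tree s then 1 else -1.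

(** The leaves are filled from right to left, so that the ranks of those still to be filled do not
    move. *)
Definition sub3 (s A B C : btree) := graft (graft (graft s 2 C) 1 B) 0 A.

Variable nf : btree -> btree.
Hypothesis R_nf : forall x, R x -> kills_classes nf x.

(** The sign of the quadratic form cancels [tree_sign], which leaves the pairing of x with a
    function constant on classes. *)
Lemma orth_class (w : btree -> K) :
  Defs.orthogonal R [ffun s : tree G 2 => tree_sign (val s) * w (nf (val s)) : K^o].
Proof.
move=> x /R_nf kx; rewrite -[RHS](kx w); apply: eq_bigr => s _.
rewrite ffunE /tree_sign; case: ifP => _; ring.
Qed.

(** With w an indicator, these are the quadratic relations between the coefficients of a dual
    element: one for each class of two-node trees in each context. *)
Lemma dualf_class n N (X : btree -> K) (a : tree G n) i (w : btree -> K) :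
  (i <= n)%N -> N = (n + 2)%N -> dualf N X ->
  \sum_(s : tree G 2) tree_sign (val s) * w (nf (val s)) * X (graft (val a) i (val s)) = 0.
Proof.
move=> le_in -> DX.
have := dualfE (dualf_r a le_in DX) (fun I H => H _ (orth_class w)).
by move=> E; rewrite -[RHS]E; apply: eq_bigr => s _; rewrite ffunE.
Qed.

End Dual.

(** * The square of the differential *)

Section DiffDiff.
Variables (K : fieldType) (G : finType) (R : Free K G 2 -> Prop).
Local Notation btree := (btree G).
Local Notation Free := (Free K G).
Local Notation chain := (chain K G).

Lemma merge_seq_cat g (u v : seq btree) x y :
  merge_seq (size u) g (u ++ x :: y :: v) = u ++ Node g x y :: v.
Proof.
rewrite /merge_seq take_size_cat // !nth_cat ltnn ltnNge leqnSn /= subnn subSnn /=.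
by rewrite -addn2 drop_add_cat /= drop0.
Qed.

Lemma cat2E (f : seq btree) i : (i.+1 < size f)%N ->
  exists u v x y, [/\ f = u ++ x :: y :: v, size u = i & size v = size f - i.+2]%N.
Proof.
move=> lt_i; exists (take i f), (drop i.+2 f), (nth Leaf f i), (nth Leaf f i.+1).
by rewrite -!drop_nth ?cat_take_drop ?size_takel ?size_drop //; lia.
Qed.

Lemma merge_merge g h (f : seq btree) i j : (i < j)%N -> (j.+2 < size f)%N ->
  merge_seq j h (merge_seq i g f) = merge_seq i g (merge_seq j.+1 h f).
Proof.
move=> lt_ij lt_j.
have [|u [v' [x [y [Df szu szv]]]]] := @cat2E f i; first by lia.
have [|v [w [p [q [Dv' sz_v _]]]]] := @cat2E v' (j - i.+1); first by lia.
rewrite Df -{1}szu merge_seq_cat Dv'.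
have -> : (j = size (u ++ Node g x y :: v))%N by rewrite size_cat /= szu sz_v; lia.
rewrite -!cat_cons !catA merge_seq_cat.
have -> : (size (u ++ Node g x y :: v)).+1 = size (u ++ [:: x, y & v]).
  by rewrite !size_cat /=; lia.
by rewrite merge_seq_cat -szu -!catA merge_seq_cat.
Qed.

(** As for a simplicial boundary, the terms with i <= j are paired with those with i > j, and the
    shift of one index by one makes the signs opposite. *)
Lemma alternating_cancel k (a : nat -> nat -> K) :
  (forall i j, (i <= j <= k)%N -> a i j = a j.+1 i) ->
  \sum_(j < k.+1) \sum_(i < k.+2) (-1) ^+ j * ((-1) ^+ i * a i j) = 0.
Proof.
move=> sym; pose b i j := (-1) ^+ j * ((-1) ^+ i * a i j).
transitivity (\sum_(j < k.+1) (\sum_(i < k.+1 | (i <= j)%N) b i j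
                               + \sum_(i < k.+1 | (j <= i)%N) b i.+1 j)).
  apply: eq_bigr => j _; rewrite (bigID (fun i : 'I_k.+2 => (i <= j)%N)) /=.
  congr (_ + _).
    by rewrite big_mkcond big_ord_recr /= leqNgt ltn_ord addr0 -big_mkcond.
  by rewrite big_mkcond big_ord_recl /= add0r -big_mkcond; apply: eq_bigl => i; rewrite -ltnNge.
rewrite big_split /= [X in _ + X](exchange_big_dep xpredT) //= -big_split big1 //= => j _.
rewrite -big_split big1 //= => i le_ij; rewrite /b sym; last by rewrite le_ij -ltnS ltn_ord.
by rewrite exprS; ring.
Qed.

Lemma sub3_left2 h g A B C : sub3 (left2 h g) A B C = Node h (Node g A B) C :> btree.
Proof. by []. Qed.

Lemma sub3_right2 h g A B C : sub3 (right2 h g) A B C = Node h A (Node g B C) :> btree.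
Proof. by []. Qed.

Variable nf : btree -> btree.
Hypothesis nodes_nf : forall t, nodes (nf t) = nodes t.
Hypothesis nf_graftl : forall t i s, (i <= nodes t)%N ->
  nf (graft t i s) = nf (graft (nf t) i s).
Hypothesis nf_graftr : forall t i s, (i <= nodes t)%N ->
  nf (graft t i s) = nf (graft t i (nf s)).
Hypothesis R_nf : forall x, R x -> kills_classes nf x.

Lemma nf_leaf : nf Leaf = Leaf.
Proof. by have := nodes_nf Leaf; case: (nf Leaf). Qed.

Lemma nf_node g l r : nf (Node g l r) = nf (Node g (nf l) (nf r)).
Proof.
have nodel l' r' : Node g l' r' = graft (Node g Leaf r') 0 l' by [].
have noder l' r' : Node g l' r' = graft (Node g l' Leaf) (nodes l').+1 r'.
  by rewrite /= ltnn.
by rewrite nodel nf_graftr // -nodel noder nf_graftr /= ?addn0 // -/(graft (Node g (nf l) Leaf) _ _) -noder.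
Qed.

Lemma nf_nf t : nf (nf t) = nf t.
Proof. by have := nf_graftl Leaf (leq0n (nodes t)); rewrite !graft_leaf. Qed.

Lemma nf_graft_congr t t' i s : (i <= nodes t)%N -> nf t = nf t' ->
  nf (graft t i s) = nf (graft t' i s).
Proof.
move=> le_i Dt; rewrite nf_graftl // Dt -nf_graftl //.
by rewrite -nodes_nf -Dt nodes_nf.
Qed.

Lemma nf_sub3 s A B C : nodes s = 2 -> nf (sub3 s A B C) = nf (sub3 (nf s) A B C).
Proof.
move=> ns; do 3!(apply: nf_graft_congr; first by rewrite ?nodes_graft ns).
by rewrite nf_nf.
Qed.

Lemma map_nf_merge i g f : map nf (merge_seq i g f) = map nf (merge_seq i g (map nf f)).
Proof.
have nthE j : nth Leaf (map nf f) j = nf (nth Leaf f j).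
  have [lt_j|le_j] := ltnP j (size f); first exact: nth_map.
  by rewrite !nth_default ?size_map // nf_leaf.
rewrite /merge_seq !map_cat /= !nthE -nf_node -map_take -map_drop.
by rewrite -!map_comp !(eq_map (nf_nf : nf \o nf =1 nf)).
Qed.

(** Removals of nodes at separate leaves commute. Removals at the same place give left and right
    two-node trees, whose signed sum over a class is zero on dual rows; the square thus vanishes
    only up to null chains. *)
Lemma diff_diff k n (z : chain k.+2 n) : has_dual_rows R z ->
  nf_null nf (koszul_diff (koszul_diff z)).
Proof.
move=> Dz t w; rewrite (diff_adj _ _ (fun f => w (map nf (val f)))).
pose a i j := \sum_h \sum_g \sum_(f : forest G k.+2 n)
   z (graft_gen (graft_gen t j h) i g, f)
   * w (map nf (merge_seq j h (merge_seq i g (val f)))).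
transitivity (\sum_(j < k.+1) \sum_(i < k.+2) (-1) ^+ j * ((-1) ^+ i * a i j)).
  apply: eq_bigr => j _.
  under eq_bigr => h _ do
    rewrite (diff_adj _ _ (fun f => w (map nf (merge_seq j h (val f))))) mulr_sumr.
  rewrite exchange_big; apply: eq_bigr => i _; rewrite /a !mulr_sumr.
  by apply: eq_bigr => h _; rewrite !mulr_sumr.
apply: alternating_cancel => i j /andP[]; rewrite leq_eqVlt => /orP[/eqP-> le_jk|lt_ij le_jk].
  apply/eqP; rewrite -subr_eq0 /a -sumrB; apply/eqP.
  under eq_bigr => h _ do
    (rewrite -sumrB; under eq_bigr => g _ do rewrite -sumrB; rewrite exchange_big /=).
  rewrite exchange_big big1 //= => f _.
  have sz_f := forest_nodes f.
  have [|u [v' [x [y [Df szu szv]]]]] := @cat2E (val f) j; first by rewrite sz_f; lia.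
  case: v' szv Df => [|p v] szv Df; first by move: szv; rewrite sz_f /=; lia.
  have DX := dualf_coef (Dz f).
  (* The three consecutive trees x, y, p of f are joined by the two removed nodes s. The test
     function sees the result through its normal form, so it depends only on the class of s. *)
  have := dualf_class R_nf t (fun s => w (map nf u ++ nf (sub3 s x y p) :: map nf v))
    le_jk (esym (addn2 k)) DX.
  rewrite (sum_tree2 (fun s => tree_sign K s * w (map nf u ++ nf (sub3 (nf s) x y p) :: map nf v)
      * coef (row_at z f) (graft (val t) j s))) => E.
  rewrite -[RHS]E; apply: eq_bigr => h _; apply: eq_bigr => g _.
  rewrite -!nf_sub3 // sub3_left2 sub3_right2 /tree_sign /= mul1r mulN1r mulNr.
  have zE (s : btree) (T : tree G k.+2) : val T = graft (val t) j s ->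
      coef (row_at z f) (graft (val t) j s) = z (T, f).
    by move=> <-; rewrite /coef valK ffunE.
  rewrite -(zE (left2 h g) (graft_gen (graft_gen t j h) j g)); last first.
    by rewrite /= -[X in graft _ X _](addn0 j) graft_seq ?nodes_val.
  rewrite -(zE (right2 h g) (graft_gen (graft_gen t j h) j.+1 g)); last first.
    by rewrite /= -[X in graft _ X _](addn1 j) graft_seq ?nodes_val.
  rewrite Df -{1 3}szu !merge_seq_cat -szu.
  have -> : (size u).+1 = size (u ++ [:: x]) by rewrite size_cat addn1.
  rewrite -[x :: y :: p :: v]cat1s catA !merge_seq_cat -!catA !merge_seq_cat.
  rewrite !map_cat /=; ring.
rewrite /a exchange_big; apply: eq_bigr => g _; apply: eq_bigr => h _.
apply: eq_bigr => f _; rewrite merge_merge ?forest_nodes //.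
congr (z (_, _) * _); apply: val_inj => /=.
by rewrite -graft_par ?nodes_val // addn1.
Qed.

End DiffDiff.

(** * Koszulness from a quadratic basis *)

Section ZTrees.
Variables (G : finType) (zl zr : rel G).
Local Notation btree := (btree G).
Local Notation Z_tree := (@Z_tree G zl zr).
Local Notation F_tree := (@F_tree G zl zr).
Local Notation admissible := (@admissible G zl zr).
Local Notation raise := (@raise G zl zr).

Lemma Z_tree_graft t i s : Z_tree (graft t i s) -> Z_tree t.
Proof.
elim: t i => //= g l IHl r IHr i.
have root_graft z t j : (graft t j s == Leaf) || on_root z (graft t j s) ->
  (t == Leaf) || on_root z t by case: t => //= h l' r'; case: leqP.
by case: leqP => _ /= /and4P[zL zR /=]; [move=> /IHl-> -> | move=> -> /IHr->];
  rewrite ?(root_graft _ _ _ zL) ?(root_graft _ _ _ zR) ?zL ?zR.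
Qed.

Lemma raise_admissible A A' : raise A = Some A' -> admissible A -> admissible A'.
Proof.
elim: A A' => //= g A IHA B IHB A'; case: ifP => [zA|nzA].
  case DA: (raise A) IHA => [A1|] //= /(_ _ erefl) IHA [<-] /= /and4P[_ zB /IHA okA okB].
  by have [-> _] := raiseP DA; rewrite zA zB okA okB implybT.
case: ifP => [zB|nzB].
  case DB: (raise B) IHB => [B1|] //= /(_ _ erefl) IHB [<-] /= /and4P[zA' _ okA /IHB okB].
  by have [-> _] := raiseP DB; rewrite zB nzA zA' okA okB implybT.
by case: A B nzA nzB {IHA IHB} => [l|//] [r|//] /= nl nr [<-] /= /andP[Fl Fr]; rewrite nl nr Fl Fr.
Qed.

Lemma nonZ_tree t : ~~ Z_tree t -> exists a i s A B C,
  [/\ t = graft a i (sub3 s A B C), (i <= nodes a)%N, nodes s = 2 & F_tree s].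
Proof.
elim: t => //= g l IHl r IHr; rewrite !negb_and => /or4P[|||].
- case: l {IHl} => //= h A B nz.
  by exists Leaf, 0, (left2 g h), A, B, r; split=> //=; rewrite nz.
- case: r {IHr} => //= h B C nz.
  by exists Leaf, 0, (right2 g h), l, B, C; split=> //=; rewrite nz.
- move=> /IHl[a [i [s [A [B [C [-> le_i ns Fs]]]]]]].
  by exists (Node g a r), i, s, A, B, C; split=> //=; [rewrite le_i | lia].
move=> /IHr[a [i [s [A [B [C [-> le_i ns Fs]]]]]]].
exists (Node g l a), ((nodes l).+1 + i)%N, s, A, B, C; split=> //=; last by lia.
by rewrite ifF ?addKn //; lia.
Qed.

Variables (c : G -> nat -> nat -> nat) (nf : btree -> btree).
Local Notation weight := (weight c).
Hypothesis nodes_nf : forall t, nodes (nf t) = nodes t.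
Hypothesis weight_nf : forall t, nf t != t -> (weight (nf t) < weight t)%N.

(** Normal forms keep the numbers of nodes, so the costs of the nodes of t are unchanged and the
    total weight drops with that of the forest. *)
Lemma weight_plug_nf t f : size f = (nodes t).+1 -> map nf f != f ->
  (weight (plug t (map nf f)) < weight (plug t f))%N.
Proof.
move=> sz_f; suff [->|] : map nf f = f \/
    (weight (plug t (map nf f)) < weight (plug t f))%N by rewrite ?eqxx.
elim: t f sz_f => [|g l IHl r IHr] f /= sz_f.
  case: f sz_f => [|x []] //= _; rewrite /plug /=.
  by have [->|/weight_nf] := eqVneq (nf x) x; [left | right].
have sz1 : size (take (nodes l).+1 f) = (nodes l).+1 by rewrite size_takel; lia.
have sz2 : size (drop (nodes l).+1 f) = (nodes r).+1 by rewrite size_drop; lia.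
rewrite /plug /= -!/(plug _ _) -map_take -map_drop.
rewrite !nodes_plug ?size_map // -!map_comp !(eq_map (nodes_nf : @nodes G \o nf =1 _)).
have [e1|lt1] := IHl _ sz1; have [e2|lt2] := IHr _ sz2; try (right; rewrite ?e1 ?e2; lia).
by left; rewrite -[f](cat_take_drop (nodes l).+1) map_cat e1 e2.
Qed.

Lemma heavier_sub3 s s' A B C : nodes s = 2 -> nodes s' = 2 ->
  (forall A B C, (weight (sub3 s' A B C) < weight (sub3 s A B C))%N) ->
  heavier c (sub3 s A B C) (sub3 s' A B C).
Proof.
move=> ns ns' hw; split=> [|f]; first by rewrite /sub3 !nodes_graft ns ns'.
have plug3 t : nodes t = 2 -> size f = (nodes A + nodes B + nodes C).+3 ->
    plug (sub3 t A B C) f = sub3 t (plug A (take (nodes A).+1 f))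
      (plug B (take (nodes B).+1 (drop (nodes A).+1 f)))
      (plug C (drop (nodes B).+1 (drop (nodes A).+1 f))).
  move=> /nodes2[h [g [->|->]]] sz_f; rewrite ?sub3_left2 ?sub3_right2 /plug /=; last by [].
  have -> : (nodes A + nodes B).+2 = ((nodes A).+1 + (nodes B).+1)%N by lia.
  by rewrite take_takel ?leq_addr // takeD drop_size_cat ?drop_drop 1?addnC // size_takel //; lia.
rewrite /sub3 !nodes_graft ns' => sz_f; rewrite -!/(sub3 _ _ _ _).
rewrite !plug3 //; rewrite sz_f; lia.
Qed.

End ZTrees.

(** * Exactness by induction on the weight *)

Section Acyclic.
Variables (K : fieldType) (G : finType) (R : Free K G 2 -> Prop).
Local Notation btree := (btree G).
Local Notation Free := (Free K G).
Local Notation chain := (chain K G).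

Variable nf : btree -> btree.
Hypothesis nodes_nf : forall t, nodes (nf t) = nodes t.
Hypothesis nf_graftl : forall t i s, (i <= nodes t)%N ->
  nf (graft t i s) = nf (graft (nf t) i s).
Hypothesis nf_graftr : forall t i s, (i <= nodes t)%N ->
  nf (graft t i s) = nf (graft t i (nf s)).
Hypothesis R_nf : forall x, R x -> kills_classes nf x.
Hypothesis nf_ideal : forall k (t : tree G k),
  ideal_gen R k (delta K t - delta K (nf_tree nodes_nf t)).

Variables (zl zr : rel G).
Local Notation Z_tree := (@Z_tree G zl zr).
Local Notation F_tree := (@F_tree G zl zr).
Local Notation admissible := (@admissible G zl zr).
Hypothesis F_tree_nf : forall t, F_tree (nf t).
Hypothesis nf_F_tree : forall t, F_tree t -> nf t = t.

Variable c : G -> nat -> nat -> nat.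
Local Notation weight := (weight c).
Hypothesis weight_nf : forall t, nf t != t -> (weight (nf t) < weight t)%N.
Hypothesis weight_sub3 : forall s A B C, nodes s = 2 -> nf s != s ->
  (weight (sub3 (nf s) A B C) < weight (sub3 s A B C))%N.

(* E t is an element of the dual component with leading term t. *)
Variable E : btree -> btree -> K.
Hypothesis E_dual : forall t, (0 < nodes t)%N -> Z_tree t -> dualf R (nodes t) (E t).
Hypothesis E_id : forall t, (0 < nodes t)%N -> Z_tree t -> E t t = 1.
Hypothesis E_lead : forall t s, (0 < nodes t)%N -> Z_tree t -> E t s != 0 ->
  t = s \/ heavier c t s.

(** A tree that is not of type Z has an edge of type F. The relation attached to the class of this
    edge expresses X at the tree through its values at heavier trees. *)
Lemma dual_lead k X (t : tree G k) : dualf R k X -> ~~ Z_tree (val t) ->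
  (forall s, heavier c s (val t) -> X s = 0) -> X (val t) = 0.
Proof.
move=> DX /nonZ_tree[a [i [s [A [B [C [Dt le_i ns Fs]]]]]]] Xh.
pose n := (nodes A + nodes B + nodes C)%N.
have Dk : k = (nodes a + (2 + nodes C + nodes B + nodes A))%N.
  by rewrite -(nodes_val t) Dt /sub3 !nodes_graft ns.
pose a' : tree G (nodes a) := Sub a (eqxx (nodes a)).
pose tr T : tree G (nodes T) := Sub T (eqxx (nodes T)).
rewrite Dk in DX; have := dualf_r a' le_i DX => {}DX.
have {}DX := @dualf_l _ _ _ _ _ _ 0 (tr A) (leq0n _) DX.
have {}DX := @dualf_l _ _ _ _ _ _ 1 (tr B) (leq_trans (leq_addl 1 1) (leq_addr _ _)) DX.
have {}DX := @dualf_l _ _ _ _ _ _ 2 (tr C) (leqnn _) DX.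
(* The test function is the indicator of the normal form s; the other members of its class are
   heavier by [weight_sub3]. *)
have := @dualf_class _ _ _ nf R_nf 0 2 _ (tree_leaf G) 0 (fun s' => (s' == s)%:R) (leq0n _) (erefl _) DX.
rewrite (bigD1 (Sub s (introT eqP ns))) //= nf_F_tree // eqxx mulr1.
rewrite big1 => [|s' ne_s]; last first.
  case: eqP => [Ds|]; last by rewrite mulr0 mul0r.
  rewrite [X in _ * X](_ : _ = 0) ?mulr0 //; apply: Xh.
  rewrite Dt; apply: heavier_graft; apply: heavier_sub3 => // [|A' B' C']; first exact: nodes_val.
  rewrite -Ds; apply: weight_sub3; first exact: nodes_val.
  by rewrite Ds; apply: contraNneq ne_s => Ds'; apply/eqP/val_inj; rewrite /= Ds'.
rewrite addr0 /tree_sign; rewrite Dt /sub3 /=.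
by case: ifP => _; rewrite ?mul1r // mulN1r => /eqP; rewrite oppr_eq0 => /eqP.
Qed.

(** Coordinates of a chain modulo null chains: coefficients summed over a class of forests and
    stored at its normal form. *)
Definition nf_sum k n (z : chain k n) : chain k n :=
  [ffun x => \sum_(f | map nf (val f) == val x.2) z (x.1, f)].

Lemma sum_nf k n (z : chain k n) t (w : seq btree -> K) :
  \sum_f z (t, f) * w (map nf (val f)) = \sum_u nf_sum z (t, u) * w (val u).
Proof.
rewrite (partition_big (fun f => nf_forest nodes_nf f) xpredT) //=; apply: eq_bigr => u _.
rewrite ffunE /= mulr_suml; apply: eq_big => [f|f /eqP <- //].
by rewrite -(inj_eq val_inj).
Qed.

Lemma nf_sum_eq0 k n (z : chain k n) : nf_sum z = 0 -> nf_null nf z.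
Proof. by move=> z0 t w; rewrite sum_nf z0 big1 // => u _; rewrite ffunE mul0r. Qed.

Lemma nf_sum_F k n (z : chain k n) t u : ~~ all F_tree (val u) -> nf_sum z (t, u) = 0.
Proof.
move=> nF; rewrite ffunE big_pred0 // => f; apply: contraNF nF => /eqP<-.
by apply/allP=> _ /mapP[s _ ->]; exact: F_tree_nf.
Qed.

Lemma map_nf_F (f : seq btree) : all F_tree f -> map nf f = f.
Proof. by move=> /allP Ff; rewrite -[RHS]map_id; apply/eq_in_map => s /Ff; exact: nf_F_tree. Qed.

Local Notation wt x := (weight (plug (val x.1) (val x.2))).

Lemma plug_graft_gen k n (t : tree G k) i g (f : forest G k.+1 n) : (i < k.+1)%N ->
  plug (val (graft_gen t i g)) (val f) = plug (val t) (merge_seq i g (val f)).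
Proof.
move=> lt_i; have [|u [v [x [y [Df szu szv]]]]] := @cat2E _ (val f) i.
  by rewrite forest_nodes.
rewrite Df -{2}szu merge_seq_cat -plug_merge ?szu //.
by rewrite nodes_val size_cat szu szv forest_nodes; lia.
Qed.

(** A merged forest that is not normal loses weight when it is reduced, so in weight W or more only
    the merges that are already normal contribute. *)
Lemma nf_sum_diff k n (z : chain k.+1 n) W t u :
  (forall x, nf_sum z x != 0 -> (wt x <= W)%N) -> (W <= wt (t, u))%N -> all F_tree (val u) ->
  nf_sum (koszul_diff z) (t, u) = koszul_diff (nf_sum z) (t, u).
Proof.
move=> zW Wu Fu.
transitivity (\sum_f koszul_diff z (t, f) * (map nf (val f) == val u)%:R).
  rewrite ffunE big_mkcond; apply: eq_bigr => f _ /=.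
  by case: ifP; rewrite ?mulr1 ?mulr0.
rewrite (diff_adj _ _ (fun f => (map nf (val f) == val u)%:R)) diff_coef.
apply: eq_bigr => i _; apply: eq_bigr => g _; congr (_ * _).
under eq_bigr => f _ do rewrite [val _]/(merge_seq i g (val f)) (map_nf_merge nodes_nf nf_graftl nf_graftr).
rewrite (sum_nf _ _ (fun f => (map nf (merge_seq i g f) == val u)%:R)).
apply: eq_bigr => f _.
have [->|nz] := eqVneq (nf_sum z (graft_gen t i g, f)) 0; first by rewrite !mul0r.
congr (_ * (nat_of_bool _)%:R); rewrite -(inj_eq val_inj) [val (Defs.merge _ _ _)]/(merge_seq i g (val f)).
rewrite [RHS]eq_sym; have /= := zW _ nz; rewrite plug_graft_gen // => leW.
set m := merge_seq i g (val f) in leW *.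
have [Dm|ne_m] := eqVneq m (val u); first by rewrite Dm map_nf_F ?eqxx.
apply/eqP=> Dm; have : (weight (plug (val t) (map nf m)) < weight (plug (val t) m))%N.
  apply: weight_plug_nf => //; last by rewrite Dm eq_sym.
  have /andP[/eqP sz_m _] := merge_subproof i g f.
  by rewrite sz_m nodes_val.
by rewrite Dm; move: Wu leW => /=; lia.
Qed.

Lemma nf_sum_dual k n (z : chain k n) (u : forest G k n) : has_dual_rows R z ->
  dualf R k (fun t => raw (nf_sum z) t (val u)).
Proof.
move=> Dz; rewrite /dualf (_ : finfun _ = \sum_(f | map nf (val f) == val u) row_at z f).
  by apply: (subspace_sum (dual_subspace R k)) => f _.
apply/ffunP=> t; rewrite ffunE rawE ffunE sum_ffunE.
by apply: eq_bigr => f _; rewrite ffunE.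
Qed.

Lemma cut_chain k n A : low A = k -> nodes (ct_total A) = n ->
  exists (t : tree G k) (f : forest G k n), A = cut (val t) (val f).
Proof.
move=> lA nA; have nf' : (size (ct_top A) == k.+1)
    && (k + sumn (map (@nodes G) (ct_top A)) == n)%N.
  by rewrite size_ct_top lA eqxx -nA nodes_total lA eqxx.
have nt : nodes (ct_bot A) == k by rewrite -lA.
by exists (Sub (ct_bot A) nt), (Sub (ct_top A) nf'); rewrite /= cut_ct.
Qed.

Lemma nodes_cut k n (t : tree G k) (f : forest G k n) :
  nodes (ct_total (cut (val t) (val f))) = n.
Proof.
rewrite -/(plug _ _) nodes_plug ?nodes_val ?forest_nodes //.
by have /andP[_ /eqP] := valP f.
Qed.

Lemma low_cut k n (t : tree G k) (f : forest G k n) : low (cut (val t) (val f)) = k.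
Proof. by rewrite /low ct_bot_cut nodes_val. Qed.

Lemma raw_cut k n (z : chain k n) (t : tree G k) (f : forest G k n) :
  raw z (ct_bot (cut (val t) (val f))) (ct_top (cut (val t) (val f))) = z (t, f).
Proof. by rewrite ct_bot_cut ct_top_cut ?forest_nodes ?nodes_val // rawE. Qed.

Section Step.
Variables (k n : nat) (z : chain k n) (W : nat).
Hypothesis dual_z : has_dual_rows R z.
Hypothesis wt_z : forall x, nf_sum z x != 0 -> (wt x <= W)%N.

Definition top_part (A : cut_tree G) : K :=
  if admissible A && (weight (ct_total A) == W) then
    raw (nf_sum z) (ct_bot A) (ct_top A) else 0.

Local Notation y := (ct_homotopy zl zr top_part).

(** The homotopy only provides coefficients on Z-trees. Replacing each Z-tree t by [E t] yields a
    chain with dual rows and changes coefficients in weights below W only. *)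
Definition top_lift : chain k.+1 n :=
  [ffun x => \sum_(t : tree G k.+1) y (cut (val t) (val x.2)) * E (val t) (val x.1)].

Lemma homotopy_supp A : y A != 0 -> admissible A /\ weight (ct_total A) = W.
Proof.
rewrite /ct_homotopy; case DA: raise => [A'|]; last by rewrite eqxx.
have [tA _] := raiseP DA; rewrite /top_part tA.
case: ifP => [/andP[okA' /eqP wA] _|]; last by rewrite mulr0 eqxx.
by split=> //; exact: admissible_raise DA okA'.
Qed.

Lemma top_lift_dual : has_dual_rows R top_lift.
Proof.
move=> f; have -> : row_at top_lift f = \sum_(t : tree G k.+1) y (cut (val t) (val f)) *:
    [ffun s : tree G k.+1 => E (val t) (val s) : K^o].
  by apply/ffunP=> s; rewrite !ffunE sum_ffunE; apply: eq_bigr => t _; rewrite !ffunE.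
have sD := dual_subspace R k.+1; apply: (subspace_sum sD) => t _.
have [->|/homotopy_supp[/admissible_Z]] := eqVneq (y (cut (val t) (val f))) 0.
  by rewrite scale0r; case: sD.
rewrite ct_bot_cut => Zt _; apply: (subspaceZ sD).
by have := E_dual _ Zt; rewrite nodes_val; apply.
Qed.

Lemma top_lift_lead x : (W <= wt x)%N -> top_lift x = y (cut (val x.1) (val x.2)).
Proof.
case: x => s f /= Wx; rewrite ffunE /= (bigD1 s) //= big1 ?addr0 => [|t ne_ts].
  have [->|/homotopy_supp[/admissible_Z]] := eqVneq (y (cut (val s) (val f))) 0.
    by rewrite mul0r.
  by rewrite ct_bot_cut => Zs _; rewrite E_id ?mulr1 // nodes_val.
have [->|/homotopy_supp[/admissible_Z]] := eqVneq (y (cut (val t) (val f))) 0.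
  by rewrite mul0r.
rewrite ct_bot_cut => Zt wt_t.
have [->|nzE] := eqVneq (E (val t) (val s)) 0; first by rewrite mulr0.
have [|Dts|[_ hv]] := E_lead _ Zt nzE; first by rewrite nodes_val.
  by case/eqP: ne_ts; apply: val_inj.
have := hv (val f); rewrite forest_nodes nodes_val => /(_ erefl).
by rewrite [weight (plug (val t) _)]wt_t ltnNge Wx.
Qed.

(** Restriction to admissible cut trees loses nothing in weight W: a forest that is not made of
    F-trees has coefficient 0 in [nf_sum], and a lower tree that is not of type Z is excluded by
    [dual_lead]. *)
Lemma top_partE (t : tree G k) (f : forest G k n) : wt (t, f) = W ->
  top_part (cut (val t) (val f)) = nf_sum z (t, f).
Proof.
move=> wx; rewrite /top_part raw_cut [weight _]wx eqxx andbT; case: ifP => // nok.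
have [Ff|/nf_sum_F-> //] := boolP (all F_tree (val f)).
have nZ : ~~ Z_tree (val t).
  by apply: contraFN nok => Zt; apply: admissible_cut => //; rewrite forest_nodes nodes_val.
rewrite -rawE; apply/esym; apply: (dual_lead (nf_sum_dual f dual_z) nZ) => s [ns hv].
have Ns : nodes s == k by rewrite ns nodes_val.
rewrite -[s]/(val (Sub s Ns : tree G k)) rawE.
have [//|/wt_z /=] := eqVneq (nf_sum z (Sub s Ns, f)) 0.
have := hv (val f); rewrite forest_nodes nodes_val => /(_ erefl).
by move: wx => /= ->; rewrite ltnNge => /negPf->.
Qed.

Lemma diff_top_lift (t : tree G k) (f : forest G k n) : (W <= wt (t, f))%N ->
  koszul_diff top_lift (t, f) = ct_diff y (cut (val t) (val f)).
Proof.
move=> Wx; rewrite chain_fun_diff; apply: ct_diff_ext => A tA lA.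
have [||s [h DA]] := @cut_chain k.+1 n A; rewrite ?lA ?low_cut ?tA ?nodes_cut //.
rewrite DA raw_cut top_lift_lead //=.
by rewrite /plug -DA tA.
Qed.

End Step.

Lemma nf_null_sum k n (z : chain k n) : nf_null nf z -> nf_sum z = 0.
Proof.
move=> Nz; apply/ffunP=> -[t u]; rewrite !ffunE -[RHS](Nz t (fun f => (f == val u)%:R)).
by rewrite big_mkcond; apply: eq_bigr => f _ /=; case: ifP; rewrite ?mulr1 ?mulr0.
Qed.

Lemma nf_sumB k n (x y : chain k n) : nf_sum (x - y) = nf_sum x - nf_sum y.
Proof.
by apply/ffunP=> -[t u]; rewrite !ffunE -sumrB; apply: eq_bigr => f _; rewrite !ffunE.
Qed.

(** In weight W the differential of [nf_sum z] is the reduced differential of z, which is zero for a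
    cycle. So only one of the two composites of [homotopyP] survives. *)
Lemma homotopy_diff_top k n (z : chain k n) W (t : tree G k) (f : forest G k n) :
  has_dual_rows R z -> (forall x, nf_sum z x != 0 -> (wt x <= W)%N) -> koszul_cycle R z ->
  admissible (cut (val t) (val f)) -> wt (t, f) = W ->
  ct_homotopy zl zr (ct_diff (top_part z W)) (cut (val t) (val f)) = 0.
Proof.
rewrite /ct_homotopy => dual_z wt_z cyc_z okA wA; case DA: raise => [A'|] //.
have [tA lA] := raiseP DA; have okA' := raise_admissible DA okA.
rewrite low_cut in lA.
(* For k = 0 nothing is below the cut, so [raise] cannot have succeeded. *)
case: k => [|k] // in z t f dual_z wt_z cyc_z okA wA DA tA lA *; case: lA => lA.
have [||t' [f' DA']] := @cut_chain k n A'; rewrite ?tA ?nodes_cut //.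
have wA' : wt (t', f') = W by rewrite /= /plug -DA' tA.
rewrite [X in _ * X](_ : _ = koszul_diff (nf_sum z) (t', f')).
  rewrite -(nf_sum_diff wt_z) ?wA' //; first last.
    by have := admissible_F okA'; rewrite DA' ct_top_cut // forest_nodes nodes_val.
  have := koszul_null_nf nodes_nf nf_graftl nf_graftr (nf_nf nf_graftl) R_nf cyc_z.
  by move=> /nf_null_sum->; rewrite ffunE mulr0.
rewrite chain_fun_diff DA'; apply: ct_diff_ext => A tA'' lA''.
have [||s [h Dh]] := @cut_chain k.+1 n A; rewrite ?lA'' ?low_cut ?tA'' ?nodes_cut //.
rewrite Dh raw_cut top_partE //.
by rewrite /= /plug -Dh tA''.
Qed.

Lemma nf_sum_lift k n (z : chain k n) W x : (0 < n)%N ->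
  has_dual_rows R z -> (forall x, nf_sum z x != 0 -> (wt x <= W)%N) -> koszul_cycle R z ->
  (W <= wt x)%N -> nf_sum (z - koszul_diff (top_lift z W)) x = 0.
Proof.
move=> n_gt0 dual_z wt_z cyc_z; case: x => t u Wx; rewrite nf_sumB ffunE [X in _ + X]ffunE.
have [Fu|nFu] := boolP (all F_tree (val u)); last by rewrite !nf_sum_F // subrr.
have diff0 f : (W < wt (t, f))%N -> koszul_diff (top_lift z W) (t, f) = 0.
  move=> lt_f; rewrite diff_top_lift ?(ltnW lt_f) //.
  rewrite (@ct_diff_ext _ _ _ (fun=> 0)) ?ct_diff0 // => A tA _.
  have [//|/homotopy_supp[_ wA]] := eqVneq (ct_homotopy zl zr (top_part z W) A) 0.
  by move: lt_f; rewrite /= /plug -tA wA ltnn.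
(* A forest that reduces to u without being u gives a weight above W, where the boundary is zero. *)
have -> : nf_sum (koszul_diff (top_lift z W)) (t, u) = koszul_diff (top_lift z W) (t, u).
  rewrite ffunE (bigD1 u) /=; last by rewrite map_nf_F.
  rewrite big1 ?addr0 // => f /andP[/eqP Df ne_fu]; apply: diff0.
  apply: leq_ltn_trans Wx _; rewrite /= -Df; apply: weight_plug_nf => //.
    by rewrite forest_nodes nodes_val.
  apply/eqP=> Duf; case/eqP: ne_fu; apply: val_inj.
  exact: etrans (esym Duf) Df.
move: Wx; rewrite leq_eqVlt => /orP[/eqP wx|lt_x]; last first.
  rewrite diff0 // subr0; have [//|/wt_z] := eqVneq (nf_sum z (t, u)) 0.
  by rewrite leqNgt lt_x.
have [Zt|nZ] := boolP (Z_tree (val t)).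
  have okA : admissible (cut (val t) (val u)).
    by apply: admissible_cut => //; rewrite forest_nodes nodes_val.
  have := @homotopyP _ _ zl zr (top_part z W) _ okA.
  rewrite nodes_cut n_gt0 => /(_ isT).
  rewrite homotopy_diff_top // addr0 top_partE // diff_top_lift -?wx // => <-; first exact: subrr.
  by move=> A nA; rewrite /top_part (negPf nA).
(* If t is not of type Z both terms vanish, because no Z-tree is obtained by grafting a node on
   t. *)
rewrite -[nf_sum z (t, u)](top_partE dual_z wt_z (esym wx)) /top_part ifN; last first.
  by apply: contra nZ => /andP[/admissible_Z]; rewrite ct_bot_cut.
rewrite sub0r diff_coef big1 ?oppr0 // => i _; rewrite big1 // => g _.
rewrite big1 ?mulr0 // => f _; case: eqP => [Du|]; last by rewrite mulr0.
have wf : wt (graft_gen t i g, f) = W by rewrite plug_graft_gen // wx Du.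
rewrite top_lift_lead ?wf //=.
have [->|/homotopy_supp[/admissible_Z]] := eqVneq
    (ct_homotopy zl zr (top_part z W) (cut (val (graft_gen t i g)) (val f))) 0.
  by rewrite mul0r.
by rewrite ct_bot_cut => /Z_tree_graft; rewrite (negPf nZ).
Qed.

Lemma cycle_diff k n (z : chain k n) (x : chain k.+1 n) : koszul_cycle R z ->
  has_dual_rows R x -> koszul_cycle R (z - koszul_diff x).
Proof.
case: k z x => [|k] // z x cyc_z dual_x.
rewrite /= diffB; apply: (subspaceB (koszul_null_subspace R k n) cyc_z).
apply: (nf_null_koszul nf_ideal); last exact: (diff_diff nodes_nf nf_graftl R_nf).
by do 2!apply: diff_dual_rows.
Qed.

Lemma acyclic_weight W k n (z : chain k n) : (0 < n)%N ->
  has_dual_rows R z -> (forall x, nf_sum z x != 0 -> (wt x < W)%N) -> koszul_cycle R z ->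
  exists2 z' : chain k.+1 n, has_dual_rows R z' & koszul_null R (z - koszul_diff z').
Proof.
move=> n_gt0; elim: W z => [|W IHW] z dual_z wt_z cyc_z.
  exists 0; first by case: (has_dual_rows_subspace R k.+1 n).
  have -> : koszul_diff (0 : chain k.+1 n) = 0 by rewrite -(subrr (0 : chain k.+1 n)) diffB subrr.
  rewrite subr0; apply: (nf_null_koszul nf_ideal) => //; apply: nf_sum_eq0.
  by apply/ffunP=> x; rewrite [RHS]ffunE; have [//|/wt_z] := eqVneq (nf_sum z x) 0.
have sD := has_dual_rows_subspace R.
pose z1 := top_lift z W.
have dual_z1 : has_dual_rows R z1 by exact: top_lift_dual.
have dual_dz1 : has_dual_rows R (koszul_diff z1) by exact: diff_dual_rows.
have [|x nz|| z2 dual_z2 null_z2] := IHW (z - koszul_diff z1).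
- exact: (subspaceB (sD k n)).
- rewrite ltnNge; apply: contra nz => Wx; rewrite nf_sum_lift //.
- exact: cycle_diff.
exists (z1 + z2); first exact: (subspaceD (sD _ _)).
by rewrite diffD opprD addrA.
Qed.

Theorem koszul_acyclic_PBW : koszul_acyclic R.
Proof.
move=> n k z n_gt0 /koszul_chainP dual_z cyc_z.
pose W := (\max_(x : tree G k * forest G k n) wt x).+1.
have [x _||z' /koszul_chainP Cz' null_z'] := @acyclic_weight W _ _ z n_gt0 dual_z.
- by rewrite ltnS; exact: (leq_bigmax x).
- by [].
by exists z'.
Qed.

End Acyclic.

(** * A local criterion for belonging to the dual component *)

Section LocalDual.
Variables (K : fieldType) (G : finType) (R : Free K G 2 -> Prop).
Local Notation btree := (btree G).
Local Notation Free := (Free K G).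

(** Orthogonality to each orthogonal relation placed in a context, with a below it and A, B, C above
    it. It can be checked without a description of the ideal, and suffices by [local_dualP]. *)
Definition local_dual (e : btree -> K) := forall y : Free 2, Defs.orthogonal R y ->
  forall a i A B C, (i <= nodes a)%N ->
  \sum_s y s * e (graft a i (sub3 (val s) A B C)) = 0.

Lemma nodes_sub3 (s A B C : btree) : nodes s = 2 ->
  nodes (sub3 s A B C) = (2 + (nodes A + nodes B + nodes C))%N :> nat.
Proof. by move=> ns; rewrite /sub3 !nodes_graft ns; lia. Qed.

Lemma graft_sub3 (s A B C : btree) i (b : btree) : nodes s = 2 ->
  (i <= 2 + (nodes A + nodes B + nodes C))%N ->
  graft (sub3 s A B C) i b =
  if (i <= nodes A)%N then sub3 s (graft A i b) B C
  else if (i <= (nodes A + nodes B).+1)%N then sub3 s A (graft B (i - (nodes A).+1) b) C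
  else sub3 s A B (graft C (i - (nodes A + nodes B).+2) b).
Proof.
move=> /nodes2[h [g [->|->]]] le_i; rewrite ?sub3_left2 ?sub3_right2 /=.
  case: (leqP i (nodes A)) => [le_iA|lt_Ai].
    by rewrite ifT //; lia.
  by case: leqP.
case: (leqP i (nodes A)) => [le_iA|lt_Ai]; first by [].
case: (leqP i (nodes A + nodes B).+1) => [le_i'|lt_i].
  by rewrite ifT //; lia.
rewrite ifF; last by lia.
by congr Node; congr Node; congr graft; lia.
Qed.

Lemma local_dual_graftr e a i : (i <= nodes a)%N -> local_dual e ->
  local_dual (fun t => e (graft a i t)).
Proof.
move=> le_i De y Ry a' i' A B C le_i'.
rewrite -[RHS](De y Ry (graft a i a') (i + i')%N A B C); last first.
  by rewrite nodes_graft leq_add.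
by apply: eq_bigr => s _; rewrite graft_seq.
Qed.

(** The value 0 out of range is needed because [local_dual] tests trees of all sizes, whereas the
    laws of grafting require i <= nodes t. It does no harm, since all the trees of one tested sum
    have the same number of nodes. *)
Lemma local_dual_graftl e i b : local_dual e ->
  local_dual (fun t => if (i <= nodes t)%N then e (graft t i b) else 0).
Proof.
move=> De y Ry a j A B C le_j.
pose n3 := (2 + (nodes A + nodes B + nodes C))%N.
have nS (s : tree G 2) : nodes (sub3 (val s) A B C) = n3 by rewrite nodes_sub3 ?nodes_val.
under eq_bigr => s _ do rewrite nodes_graft nS.
case: leqP => [le_i|_]; last by rewrite big1 // => s _; rewrite mulr0.
have [lt_ij|le_ji] := ltnP i j.
  rewrite -[RHS](De y Ry (graft a i b) (j + nodes b)%N A B C); last first.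
    by rewrite nodes_graft leq_add2r.
  by apply: eq_bigr => s _; rewrite graft_par.
have [le_ij3|lt_j3i] := leqP i (j + n3).
  have Di : i = (j + (i - j))%N by lia.
  have graftE (s : tree G 2) : graft (graft a j (sub3 (val s) A B C)) i b
      = graft a j (graft (sub3 (val s) A B C) (i - j) b).
    by rewrite {1}Di graft_seq // nS; lia.
  under eq_bigr => s _ do (rewrite graftE graft_sub3; [|exact: nodes_val|lia]).
  case: (i - j <= nodes A)%N; first exact: De.
  by case: (i - j <= _)%N; exact: De.
have Di : i = (i - n3 + n3)%N by lia.
rewrite -[RHS](De y Ry (graft a (i - n3) b) j A B C); last first.
  by rewrite nodes_graft; lia.
apply: eq_bigr => s _; rewrite {1}Di -{2}(nS s) graft_par //; lia.
Qed.

(** A double annihilator: it is an ideal that contains the orthogonal of R, hence also the ideal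
    generated by it. *)
Definition killed n (y : Free n) :=
  forall e, local_dual e -> \sum_t y t * e (val t) = 0.

Lemma killed_subspace n : is_subspace (@killed n).
Proof.
split=> [e De|a x y mx my e De]; first by rewrite big1 // => t _; rewrite ffunE mul0r.
by rewrite sum_linear mx // my // mulr0 addr0.
Qed.

Lemma killed_compl n m (x : Free n) i (y : Free m) : (i <= n)%N ->
  killed x -> killed (x o_(i) y).
Proof.
move=> le_in mx e De; rewrite sum_op_comp exchange_big big1 // => b _.
under eq_bigr => a _ do rewrite mulrAC mulrC.
rewrite -mulr_sumr [X in _ * X](_ : _ = 0) ?mulr0 //.
rewrite -[RHS](mx _ (local_dual_graftl i (val b) De)).
by apply: eq_bigr => a _; rewrite nodes_val le_in.
Qed.

Lemma killed_compr n m (x : Free n) i (y : Free m) : (i <= n)%N ->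
  killed y -> killed (x o_(i) y).
Proof.
move=> le_in my e De; rewrite sum_op_comp big1 // => a _.
under eq_bigr => b _ do rewrite -mulrA.
rewrite -mulr_sumr (my (fun t => e (graft (val a) i t))) ?mulr0 //.
by apply: local_dual_graftr => //; rewrite nodes_val.
Qed.

Definition killed_ideal : opIdeal Free :=
  OpIdeal killed_subspace killed_compl killed_compr.

Lemma local_dualP e k : local_dual e -> dualf R k e.
Proof.
move=> De; apply: dualfP => y /(_ killed_ideal) Iy.
apply: (Iy _ e De) => z Rz e' De'.
rewrite -[RHS](De' z Rz Leaf 0%N Leaf Leaf Leaf) //.
by apply: eq_bigr => s _; rewrite /= /sub3 !graft_leaf.
Qed.

End LocalDual.

(** * Labels of the clique of a tree *)

Ltac label_eq :=
  match goal with
  | |- (_ * _)%g = (_ * _)%g => apply: f_equal2 => //; apply: f_equal2; lia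
  | |- ?f _ _ = ?f _ _ => apply: f_equal2; lia
  | |- _ => by []
  end.

Ltac case_if :=
  repeat match goal with
  | |- context [if ?b then _ else _] =>
    lazymatch b with
    | context [if _ then _ else _] => fail
    | _ => first
      [ have -> : b = true by lia
      | have -> : b = false by lia
      | let H := fresh "H" in case: (boolP b) => H ]; cbv beta iota
    end
  end.

Section Labels.
Variable M : finUMagmaType.
Local Notation G := (triangle M).
Local Notation btree := (btree G).
Local Open Scope nat_scope.

Definition base_label (g : G) : M := label g 0 2.
Definition left_label (g : G) : M := label g 0 1.
Definition right_label (g : G) : M := label g 1 2.

Lemma base_tri p q r : base_label (tri p q r) = p. Proof. by rewrite /base_label label_mk. Qed.
Lemma left_tri p q r : left_label (tri p q r) = q. Proof. by rewrite /left_label label_mk. Qed.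
Lemma right_tri p q r : right_label (tri p q r) = r. Proof. by rewrite /right_label label_mk. Qed.

Lemma tri_eta g : tri (base_label g) (left_label g) (right_label g) = g.
Proof.
apply: clique_ext => x y xy; rewrite label_mk //.
case: x y xy => [|[|x]] [|[|[|y]]] //=; by case/andP.
Qed.

Definition root_base (t : btree) : M := if t is Node g _ _ then base_label g else 1%g.

(* The label of the arc (x, y) in the clique obtained by composing the triangles of t. *)
Fixpoint tree_label (t : btree) x y : M :=
  if t is Node g l r then
    let v := (nodes l).+1 in
    if (x == 0) && (y == (v + nodes r).+1) then base_label g
    else if (x == 0) && (y == v) then (left_label g * tree_label l 0 v)%g
    else if (x == v) && (y == (v + nodes r).+1) then
      (right_label g * tree_label r 0 (nodes r).+1)%g
    else if y <= v then tree_label l x y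
    else if v <= x then tree_label r (x - v) (y - v)
    else 1%g
  else 1%g.

Definition label_eq s t :=
  nodes s = nodes t /\
  forall x y, x < y <= (nodes t).+1 -> tree_label s x y = tree_label t x y.

Lemma label_eq_sym s t : label_eq s t -> label_eq t s.
Proof. by case=> n st; split=> // x y xy; rewrite st // -n. Qed.
Lemma label_eq_trans u s t : label_eq s u -> label_eq u t -> label_eq s t.
Proof. by case=> n su [n' ut]; split=> [|x y xy]; rewrite ?n // su ?ut // n'. Qed.

Lemma tree_label_base t : tree_label t 0 (nodes t).+1 = root_base t.
Proof. by case: t => //= g l r; rewrite eqxx. Qed.

Lemma tree_label_leaf t x y : nodes t = 0 -> tree_label t x y = 1%g.
Proof. by case: t. Qed.

Definition comp_label (m : nat) (p q : nat -> nat -> M) (i x y : nat) : M :=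
  if (x == i) && (y == i + m.+1) then (p i i.+1 * q 0 m.+1)%g
  else if (i <= x) && (y <= i + m.+1) then q (x - i) (y - i)
  else if ((x <= i) || (i + m.+1 <= x)) && ((y <= i) || (i + m.+1 <= y)) then
    p (if x <= i then x else x - m) (if y <= i then y else y - m)
  else 1%g.

Lemma tree_label_graft t i s x y : i <= nodes t -> x < y <= (nodes t + nodes s).+1 ->
  tree_label (graft t i s) x y
  = comp_label (nodes s) (tree_label t) (tree_label s) i x y.
Proof.
elim: t i x y => [|g l IHl r IHr] i x y /= le_i xy.
  have i0 : i = 0 by lia.
  subst i; rewrite /comp_label mul1g !subn0.
  case: ifP => [/andP[/eqP-> /eqP->] //|_].
  by rewrite ifT //; lia.
case: (leqP i (nodes l)) => [le_il|lt_li] /=; rewrite nodes_graft.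
  have {}IHl x' y' : x' < y' <= (nodes l + nodes s).+1 -> _ := @IHl i x' y' le_il.
  rewrite /comp_label in IHl *; rewrite IHl; last by lia.
  case_if; try label_eq.
  all: try by (rewrite IHl; [case_if; label_eq | lia]).
  (* The product of M is not associative. Three labels meet on one arc only when the middle one
     belongs to a leaf, and it is then 1. *)
  have l0 : nodes l = 0 by lia.
  by rewrite !(tree_label_leaf _ _ l0) mul1g mulg1.
have le_ir : i - (nodes l).+1 <= nodes r by lia.
have {}IHr x' y' : x' < y' <= (nodes r + nodes s).+1 -> _ := @IHr _ x' y' le_ir.
rewrite /comp_label in IHr *; rewrite IHr; last by lia.
case_if; try label_eq.
all: try by (rewrite IHr; [case_if; label_eq | lia]).
have r0 : nodes r = 0 by lia.
by rewrite !(tree_label_leaf _ _ r0) mul1g mulg1.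
Qed.

End Labels.

(** * Normal forms *)

Section NormalForms.
Variable M : finUMagmaType.
Local Notation G := (triangle M).
Local Notation btree := (btree G).
Local Open Scope nat_scope.

Definition label_noncrossing n (P : nat -> nat -> M) :=
  forall x y x' y', x < x' -> x' < y -> y < y' -> y' <= n.+1 ->
    P x y <> 1%g -> P x' y' = 1%g.

Lemma tree_noncrossing t : label_noncrossing (nodes t) (tree_label t).
Proof.
elim: t => [|g l IHl r IHr] x y x' y' /= xx' x'y yy' le_y'; first by [].
case_if => //; try (by move=> nz; apply: IHl nz; lia).
all: try by move=> nz; apply: IHr nz; lia.
Qed.

(* The edge from g up to h carries the labels (left_label g, base_label h) or
   (right_label g, base_label h): it is of type Z unless its second label is 1
   and, for a right edge, its first label is not 1. *)
Definition zero_left (g h : G) := base_label h != 1%g.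
Definition zero_right (g h : G) := (base_label h != 1%g) || (right_label g == 1%g).
Local Notation F_tree := (@F_tree G zero_left zero_right).

Lemma F_tree_node g l r : F_tree (Node g l r) =
  [&& root_base l == 1%g, root_base r == 1%g, (r == Leaf) || (right_label g != 1%g),
      F_tree l & F_tree r].
Proof.
have neg_left t : ~~ on_root (zero_left g) t = (root_base t == 1%g).
  by case: t => [|h u v] /=; rewrite ?eqxx // negbK.
have neg_right t : ~~ on_root (zero_right g) t
    = (root_base t == 1%g) && ((t == Leaf) || (right_label g != 1%g)).
  by case: t => [|h u v] /=; rewrite ?eqxx // negb_or negbK.
by rewrite /= neg_left neg_right -!andbA.
Qed.

(* An F-tree is determined by its clique because its root triangle is: the apex
   is the first vertex x > 0 such that x = n or the arc (x, n + 1) is solid. *)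
Lemma F_tree_apex g l r x : F_tree (Node g l r) -> 0 < x <= (nodes l).+1 ->
  (x == (nodes l).+1) = (x == nodes (Node g l r))
    || (tree_label (Node g l r) x (nodes (Node g l r)).+1 != 1%g).
Proof.
rewrite F_tree_node => /and5P[bl /eqP br sr _ _] /andP[x_gt0]; rewrite leq_eqVlt /=.
case: eqP => [-> _|_ /= lt_x]; last by case_if; try lia; rewrite eqxx orbF; lia.
case_if; try lia; rewrite tree_label_base br mulg1.
by case: eqP sr => [->|_] /=; [rewrite addn0 eqxx | rewrite orbC => ->].
Qed.

Lemma F_tree_unique s t : F_tree s -> F_tree t -> label_eq s t -> s = t.
Proof.
elim: s t => [|g l IHl r IHr] [|g' l' r'] Fs Ft [Dn Dl] //.
pose s := Node g l r; pose t := Node g' l' r'.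
have apexE x : x <= nodes t ->
    (x == nodes s) || (tree_label s x (nodes s).+1 != 1%g)
    = (x == nodes t) || (tree_label t x (nodes t).+1 != 1%g).
  by move=> le_x; rewrite Dn Dl // leqnn andbT.
(* Each apex is the first vertex that passes the test of [F_tree_apex], and by [apexE] the test is
   the same for both trees. *)
have Dv : nodes l = nodes l'.
  have apexS x := @F_tree_apex g l r x Fs; have apexT x := @F_tree_apex g' l' r' x Ft.
  have le_l : nodes l < nodes t by rewrite -Dn /= ltnS leq_addr.
  have le_l' : nodes l' < nodes t by rewrite /= ltnS leq_addr.
  have := apexS (nodes l).+1; have := apexT (nodes l').+1.
  rewrite !eqxx !ltnS !leqnn -/s -/t => /(_ isT) eT /(_ isT) eS.
  have [lt|lt|//] := ltngtP (nodes l) (nodes l').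
    have := apexT (nodes l).+1 (ltnW lt); rewrite -/t -apexE // -eS.
    by move/eqP; lia.
  have := apexS (nodes l').+1 (ltnW lt); rewrite -/s apexE // -eT.
  by move/eqP; lia.
have Dr : nodes r = nodes r' by move: Dn => /=; lia.
move: Fs Ft; rewrite !F_tree_node => /and5P[/eqP bl /eqP br _ Fl Fr] /and5P[/eqP bl' /eqP br' _ Fl' Fr'].
rewrite /= -Dv -Dr in Dl {apexE}.
have lab_l := tree_label_base l; have lab_l' := tree_label_base l'.
have lab_r := tree_label_base r; have lab_r' := tree_label_base r'.
rewrite ?bl ?br ?bl' ?br' -?Dv -?Dr in lab_l lab_l' lab_r lab_r'.
have Dg : g = g'.
  rewrite -(tri_eta g) -(tri_eta g'); congr tri.
  - by have := Dl 0 ((nodes l).+1 + nodes r).+1; case_if; apply; lia.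
  - have := Dl 0 (nodes l).+1; case_if; rewrite lab_l lab_l' !mulg1; apply; lia.
  have := Dl (nodes l).+1 ((nodes l).+1 + nodes r).+1; case_if.
  by rewrite lab_r lab_r' !mulg1; apply; lia.
rewrite -Dg; congr Node; [apply: IHl | apply: IHr] => //; split=> // x y xy.
  (* The clique shows the base of a child only inside a product; in an F-tree this base is 1. *)
  have [|ne] := boolP ((x == 0) && (y == (nodes l).+1)).
    by move=> /andP[/eqP-> /eqP->]; rewrite lab_l lab_l'.
  by have := Dl x y; case_if; apply; lia.
have [|ne] := boolP ((x == 0) && (y == (nodes r).+1)).
  by move=> /andP[/eqP-> /eqP->]; rewrite lab_r lab_r'.
have := Dl (x + (nodes l).+1) (y + (nodes l).+1); rewrite !addnK; case_if.
by apply; lia.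
Qed.

(** The base of the subpolygon gets the label 1, since the label of the diagonal is carried by the
    root triangle. *)
Definition restrict_left (P : nat -> nat -> M) v x y :=
  if (x == 0) && (y == v) then 1%g else P x y.

Definition restrict_right (P : nat -> nat -> M) v n x y :=
  if (x == 0) && (y == n - v) then 1%g else P (x + v) (y + v).

(** The root triangle has as apex the first v such that the arc from v to the last vertex is solid
    or an edge. This choice makes the right edge of type F, and no solid arc passes over v except
    the base. *)
Lemma F_tree_exists n (P : nat -> nat -> M) : (n = 0 -> P 0 1 = 1%g) ->
  label_noncrossing n P ->
  exists t, [/\ F_tree t, nodes t = n & forall x y, x < y <= n.+1 -> tree_label t x y = P x y].
Proof.
elim/ltn_ind: n P => -[|n] IHn P P1 ncP.
  exists Leaf; split=> // x y xy.
  have [-> ->] : x = 0 /\ y = 1 by lia.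
  by rewrite P1.
have ex_v : exists v, (0 < v) && ((v == n.+1) || (P v n.+2 != 1%g)) by exists n.+1; rewrite eqxx.
have [v [v_gt0 v_le v_sol v_min]] : exists v, [/\ 0 < v, v <= n.+1, (v == n.+1) || (P v n.+2 != 1%g)
    & forall x, 0 < x < v -> P x n.+2 = 1%g].
  case: (ex_minnP ex_v) => w /andP[w_gt0 sol_w] w_min; exists w; split=> //.
    by apply: w_min; rewrite eqxx.
  move=> x /andP[x_gt0 lt_xw]; apply/eqP/negPn/negP=> nPx.
  by have := w_min x; rewrite x_gt0 nPx orbT => /(_ isT); lia.
have [|||l [Fl nl Dl]] := IHn v.-1 _ (restrict_left P v); first by lia.
- by move=> v1; rewrite /restrict_left ifT //; lia.
- move=> x y x' y' xx' x'y yy' le_y'; rewrite /restrict_left; case_if => //.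
  by apply: ncP; lia.
have [|||r [Fr nr Dr]] := IHn (n.+1 - v) _ (restrict_right P v n.+2); first by lia.
- by move=> v1; rewrite /restrict_right ifT //; lia.
- move=> x y x' y' xx' x'y yy' le_y'; rewrite /restrict_right; case_if => //.
  by apply: ncP; lia.
have bl : root_base l = 1%g.
  by rewrite -tree_label_base nl Dl /restrict_left ?ifT //; lia.
have br : root_base r = 1%g.
  by rewrite -tree_label_base nr Dr /restrict_right ?ifT //; lia.
pose g := tri (P 0 n.+2) (P 0 v) (P v n.+2).
have Ft : F_tree (Node g l r).
  rewrite F_tree_node bl br !eqxx Fl Fr right_tri /= !andbT.
  case/orP: v_sol => [/eqP vn|->]; last by rewrite orbT.
  by apply/orP; left; case: r nr {Fr Dr br} => //= ? ? ?; lia.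
exists (Node g l r); split=> [//||x y xy]; first by rewrite /= nl nr; lia.
rewrite /= base_tri left_tri right_tri !tree_label_base bl br !mulg1 nl nr prednK //.
have -> : (v + (n.+1 - v)).+1 = n.+2 by lia.
case_if; rewrite ?Dl ?Dr /restrict_left /restrict_right; try lia; case_if.
all: try by apply: f_equal2; lia.
(* An arc passing over v has label 1: by minimality of v if it ends at the last vertex, otherwise
   because it would cross the solid arc of v. *)
apply/esym; have [Dy|ne_y] := eqVneq y n.+2; first by rewrite Dy v_min //; lia.
apply/eqP/negPn/negP => /eqP nPxy.
have Pv : P v n.+2 = 1%g by apply: ncP nPxy; lia.
by move: v_sol; rewrite Pv eqxx orbF => /eqP; lia.
Qed.

End NormalForms.

(** * Rewriting *)

Section Rewriting.
Variables (K : fieldType) (M : finUMagmaType).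
Local Notation G := (triangle M).
Local Notation btree := (btree G).
Local Notation F_tree := (@F_tree G (@zero_left M) (@zero_right M)).
Local Notation Free := (Free K G).
Local Notation NC_rel := (@NC_relations K M).

Lemma nf_exists (t : btree) : exists s, F_tree s /\ label_eq s t.
Proof.
have [|s [Fs ns Ds]] := F_tree_exists _ (@tree_noncrossing M t).
  by move=> t0; rewrite tree_label_leaf.
by exists s; split=> //; split=> // x y; rewrite -ns => /Ds.
Qed.

(** The normal form is chosen from the clique, and rewriting is only shown to reach it.
    Compatibility with grafting then follows from that of labels. *)
Definition nf (t : btree) : btree := sval (cid (nf_exists t)).

Lemma nfP t : F_tree (nf t) /\ label_eq (nf t) t.
Proof. exact: svalP (cid (nf_exists t)). Qed.

Lemma F_tree_nf t : F_tree (nf t). Proof. by case: (nfP t). Qed.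

Lemma label_eq_nf t : label_eq (nf t) t. Proof. by case: (nfP t). Qed.

Lemma nodes_nf t : nodes (nf t) = nodes t. Proof. by case: (label_eq_nf t). Qed.

Lemma nf_eqP s t : nf s = nf t <-> label_eq s t.
Proof.
split=> st.
  have Ds := label_eq_sym (label_eq_nf s); rewrite st in Ds.
  exact: (@label_eq_trans _ (nf t) _ _ Ds (label_eq_nf t)).
have Dst : label_eq (nf s) (nf t).
  exact: (@label_eq_trans _ s _ _ (label_eq_nf s)
    (@label_eq_trans _ t _ _ st (label_eq_sym (label_eq_nf t)))).
exact: F_tree_unique (F_tree_nf s) (F_tree_nf t) Dst.
Qed.

Lemma nf_F_tree t : F_tree t -> nf t = t.
Proof. by move=> Ft; apply: F_tree_unique (label_eq_nf t) => //; exact: F_tree_nf. Qed.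

Lemma label_eq_graft (s s' t t' : btree) i : (i <= nodes t)%N -> label_eq t t' -> label_eq s s' ->
  label_eq (graft t i s) (graft t' i s').
Proof.
move=> le_i [nt Dt] [ns Ds]; split=> [|x y]; first by rewrite !nodes_graft nt ns.
rewrite nodes_graft => xy.
have -> : tree_label (graft t i s) x y
    = comp_label (nodes s') (tree_label t) (tree_label s) i x y.
  by rewrite tree_label_graft ?ns ?nt // -nt.
have le_i' : (i <= nodes t')%N by rewrite -nt.
rewrite tree_label_graft // /comp_label.
by case_if; rewrite ?Ds ?Dt //; lia.
Qed.

Lemma nf_graftl t i s : (i <= nodes t)%N -> nf (graft t i s) = nf (graft (nf t) i s).
Proof.
move=> le_i; apply/nf_eqP; apply: label_eq_graft => //; exact: label_eq_sym (label_eq_nf t).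
Qed.

Lemma nf_graftr t i s : (i <= nodes t)%N -> nf (graft t i s) = nf (graft t i (nf s)).
Proof.
move=> le_i; apply/nf_eqP; apply: label_eq_graft => //; exact: label_eq_sym (label_eq_nf s).
Qed.

(** The first term drops when the second label of an edge becomes 1, the second one when a right
    edge is rotated into a left edge. *)
Definition tree_cost (g : G) (n m : nat) : nat := (base_label g != 1%g) + m.
Local Notation weight := (weight tree_cost).

(* Null when t does not have k nodes. *)
Definition tree_vec k (t : btree) : Free k := [ffun s : tree G k => (val s == t)%:R].

Lemma tree_vecE k (t : tree G k) : tree_vec k (val t) = delta K t.
Proof. by apply/ffunP=> s; rewrite !ffunE (inj_eq val_inj). Qed.

Lemma tree_vec_graft n m t i s : nodes t = n -> nodes s = m ->
  tree_vec (n + m) (graft t i s) = tree_vec n t o_(i) tree_vec m s.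
Proof.
move=> /eqP nt /eqP ns; rewrite -[t]/(val (Sub t nt : tree G n)) -[s]/(val (Sub s ns : tree G m)).
rewrite !tree_vecE [RHS]lin_comp_delta.
exact: (tree_vecE (tree_graft (Sub t nt : tree G n) i (Sub s ns : tree G m))).
Qed.

Definition equiv k (s t : btree) := ideal_gen NC_rel k (tree_vec k s - tree_vec k t).

Lemma equiv_graftr n m t i s s' : (i <= n)%N -> nodes t = n -> nodes s = m -> nodes s' = m ->
  equiv m s s' -> equiv (n + m) (graft t i s) (graft t i s').
Proof.
move=> le_i nt ns ns' ss'; rewrite /equiv !tree_vec_graft // -op_compBr //.
exact: ideal_compr.
Qed.

Lemma equiv_graftl n m t t' i s : (i <= n)%N -> nodes t = n -> nodes t' = n -> nodes s = m ->
  equiv n t t' -> equiv (n + m) (graft t i s) (graft t' i s).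
Proof.
move=> le_i nt nt' ns tt'; rewrite /equiv !tree_vec_graft // -op_compBl //.
exact: ideal_compl.
Qed.

Lemma equiv_refl k t : equiv k t t.
Proof. by rewrite /equiv subrr; case: (ideal_subspace (ideal_gen NC_rel) k). Qed.

Lemma equiv_trans k s t u : equiv k s t -> equiv k t u -> equiv k s u.
Proof.
move=> st tu; rewrite /equiv -[tree_vec k s](subrK (tree_vec k t)) -addrA.
exact: (subspaceD (ideal_subspace (ideal_gen NC_rel) k) st tu).
Qed.

Lemma equiv_sub3 k s s' A B C : nodes s = 2 -> nodes s' = 2 -> nodes (sub3 s A B C) = k ->
  equiv 2 s s' -> equiv k (sub3 s A B C) (sub3 s' A B C).
Proof.
move=> ns ns' <- ss'; rewrite /sub3 !nodes_graft ns.
by do 3!(apply: equiv_graftl; rewrite ?nodes_graft ?ns ?ns' //).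
Qed.

Local Notation triL p1 p2 p3 q1 q2 q3 := (left2 (tri p1 p2 p3) (tri q1 q2 q3)).
Local Notation triR p1 p2 p3 q1 q2 q3 := (right2 (tri p1 p2 p3) (tri q1 q2 q3)).

Lemma gen_comp0 (h g : G) : gen K h o_(0) gen K g = tree_vec 2 (left2 h g).
Proof.
rewrite [LHS]lin_comp_delta -tree_vecE.
by congr (tree_vec 2 _).
Qed.

Lemma gen_comp1 (h g : G) : gen K h o_(1) gen K g = tree_vec 2 (right2 h g).
Proof. by rewrite [LHS]lin_comp_delta -tree_vecE. Qed.

Definition related s t := NC_rel (tree_vec 2 s - tree_vec 2 t).

Lemma related_sym s t : related s t -> related t s.
Proof.
move=> st; rewrite /related -opprB -scaleN1r.
exact: subspaceZ (span_subspace _) _ _ st.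
Qed.

Lemma related_trans s t u : related s t -> related t u -> related s u.
Proof.
move=> st tu; rewrite /related -[tree_vec 2 s](subrK (tree_vec 2 t)) -addrA.
exact: subspaceD (span_subspace _) _ _ st tu.
Qed.

Lemma related_LR p1 p2 p3 q1 q2 q3 r1 r3 : (p2 * q1 = 1)%g -> (r3 * r1 = 1)%g ->
  related (triL p1 p2 p3 q1 q2 q3) (triR p1 q2 r3 r1 q3 p3).
Proof.
by move=> pq rr; apply: mem_span; rewrite -gen_comp0 -gen_comp1; exact: NC_relation_b.
Qed.

(** Relation (a) excludes products equal to 1; in that case both trees are related by (b) to one
    right tree. In the same way [related_R] completes (c). *)
Lemma related_L p1 p2 p3 q1 q2 q3 r1 r2 : (p2 * q1 = r2 * r1)%g ->
  related (triL p1 p2 p3 q1 q2 q3) (triL p1 r2 p3 r1 q2 q3).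
Proof.
move=> pq; have [r1E|/eqP ne] := eqVneq (r2 * r1)%g 1%g.
  apply: related_trans (related_LR p1 p3 q2 q3 (etrans pq r1E) (mulg1 1%g)) _.
  exact: related_sym (related_LR _ _ _ _ r1E (mulg1 1%g)).
by apply: mem_span; rewrite -!gen_comp0; exact: NC_relation_a.
Qed.

Lemma related_R p1 p2 p3 q1 q2 q3 r1 r3 : (p3 * q1 = r3 * r1)%g ->
  related (triR p1 p2 p3 q1 q2 q3) (triR p1 p2 r3 r1 q2 q3).
Proof.
move=> pq; have [r1E|/eqP ne] := eqVneq (r3 * r1)%g 1%g.
  apply: related_trans (related_sym (related_LR p1 q3 p2 q2 (mulg1 1%g) (etrans pq r1E))) _.
  exact: related_LR (mulg1 1%g) r1E.
by apply: mem_span; rewrite -!gen_comp1; exact: NC_relation_c.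
Qed.

Lemma equiv_related s t : related s t -> equiv 2 s t.
Proof. by move=> st I; apply. Qed.

Lemma small_arcs (P : nat -> nat -> Prop) :
  P 0 1 -> P 0 2 -> P 0 3 -> P 1 2 -> P 1 3 -> P 2 3 ->
  forall x y, (x < y <= 3)%N -> P x y.
Proof. by move=> P1 P2 P3 P4 P5 P6 [|[|[|x]]] [|[|[|[|y]]]] //=; case/andP. Qed.

Lemma label_eq_L (p1 p2 p3 q1 q2 q3 r1 r2 : M) : (p2 * q1 = r2 * r1)%g ->
  label_eq (triL p1 p2 p3 q1 q2 q3) (triL p1 r2 p3 r1 q2 q3).
Proof.
move=> E; split; first by [].
by apply: small_arcs; rewrite /= ?base_tri ?left_tri ?right_tri ?E.
Qed.

Lemma label_eq_R (p1 p2 p3 q1 q2 q3 r1 r3 : M) : (p3 * q1 = r3 * r1)%g ->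
  label_eq (triR p1 p2 p3 q1 q2 q3) (triR p1 p2 r3 r1 q2 q3).
Proof.
move=> E; split; first by [].
by apply: small_arcs; rewrite /= ?base_tri ?left_tri ?right_tri ?E.
Qed.

Lemma label_eq_LR (p1 p2 p3 q1 q2 q3 r1 r3 : M) : (p2 * q1 = 1)%g -> (r3 * r1 = 1)%g ->
  label_eq (triL p1 p2 p3 q1 q2 q3) (triR p1 q2 r3 r1 q3 p3).
Proof.
move=> E E'; split; first by [].
by apply: small_arcs; rewrite /= ?base_tri ?left_tri ?right_tri ?E ?E'.
Qed.

Lemma rewrite2 s : nodes s = 2 -> ~~ F_tree s -> exists s', [/\ nodes s' = 2, F_tree s',
  label_eq s' s, related s s' &
  forall A B C, (weight (sub3 s' A B C) < weight (sub3 s A B C))%N].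
Proof.
move=> /nodes2[h [g Ds]]; rewrite -(tri_eta h) -(tri_eta g) in Ds.
move: (base_label h) (left_label h) (right_label h) (base_label g) (left_label g)
  (right_label g) Ds => p1 p2 p3 q1 q2 q3 {h g} [->|->].
  rewrite F_tree_node /= base_tri !eqxx !andbT => q1_neq1.
  exists (triL p1 (p2 * q1)%g p3 1%g q2 q3); split; first by [].
  - by rewrite F_tree_node /= base_tri !eqxx.
  - by apply: label_eq_L; rewrite mulg1.
  - by apply: related_L; rewrite mulg1.
  move=> A B C; rewrite !sub3_left2 /= /tree_cost !base_tri eqxx q1_neq1 /=; lia.
rewrite F_tree_node /= base_tri right_tri !eqxx !andbT => nF.
(* A right edge of product 1 is rotated into a left edge; any other product is moved into the first
   label. *)
have [pq1|pq1] := eqVneq (p3 * q1)%g 1%g.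
  exists (triL p1 1%g q3 1%g p2 q2); split; first by [].
  - by rewrite F_tree_node /= base_tri !eqxx.
  - by apply: label_eq_LR pq1; rewrite mulg1.
  - by apply: related_sym; apply: related_LR pq1; rewrite mulg1.
  move=> A B C; rewrite sub3_left2 /= /tree_cost !base_tri eqxx /=; lia.
have q1_neq1 : q1 != 1%g.
  apply: contraNneq nF => Eq; move: pq1; rewrite Eq mulg1 eqxx => ->.
  by rewrite ?orbT.
exists (triR p1 p2 (p3 * q1)%g 1%g q2 q3); split; first by [].
- by rewrite F_tree_node /= base_tri right_tri !eqxx pq1.
- by apply: label_eq_R; rewrite mulg1.
- by apply: related_R; rewrite mulg1.
move=> A B C; rewrite !sub3_right2 /= /tree_cost !base_tri eqxx q1_neq1 /=; lia.
Qed.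

Lemma rewrite_step t : ~~ F_tree t -> exists t',
  [/\ label_eq t' t, equiv (nodes t) t t' & (weight t' < weight t)%N].
Proof.
have step2 s A B C : nodes s = 2 -> ~~ F_tree s -> exists t', [/\ label_eq t' (sub3 s A B C),
    equiv (nodes (sub3 s A B C)) (sub3 s A B C) t' & (weight t' < weight (sub3 s A B C))%N].
  move=> ns nF; have [s' [ns' _ Ds rel lt_w]] := rewrite2 ns nF.
  exists (sub3 s' A B C); split=> //.
    by do 3!(apply: label_eq_graft; rewrite ?nodes_graft ?ns' //).
  exact: equiv_sub3 (equiv_related rel).
elim: t => [//|g l IHl r IHr] /=; rewrite !negb_and !negbK => /or4P[].
- case: l {IHl} => //= h A B zh; apply: (step2 (left2 g h) A B r) => //.
  by rewrite /= zh.
- case: r {IHr} => //= h B C zh; apply: (step2 (right2 g h) l B C) => //.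
  by rewrite /= zh.
- move=> /IHl[l' [Dl El lt_l]]; exists (Node g l' r).
  have nl : nodes l' = nodes l by case: Dl.
  have nodeE u : Node g u r = graft (Node g Leaf r) 0 u by [].
  split.
  + by rewrite (nodeE l) (nodeE l'); exact: label_eq_graft.
  + rewrite (nodeE l) (nodeE l').
    have -> : (nodes l + nodes r).+1 = (nodes (Node g Leaf r) + nodes l)%N by move=> /=; lia.
    exact: equiv_graftr.
  by rewrite /= nl; lia.
move=> /IHr[r' [Dr Er lt_r]]; exists (Node g l r').
have nr : nodes r' = nodes r by case: Dr.
have nodeE u : Node g l u = graft (Node g l Leaf) (nodes l).+1 u by rewrite /= ltnn.
split.
- by rewrite (nodeE r) (nodeE r'); apply: label_eq_graft => //=; lia.
- rewrite (nodeE r) (nodeE r').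
  have -> : (nodes l + nodes r).+1 = (nodes (Node g l Leaf) + nodes r)%N by move=> /=; lia.
  by apply: equiv_graftr => //=; lia.
by rewrite /= nr; lia.
Qed.

(** Rewriting preserves the clique and decreases the weight, so it ends at an F-tree with the clique
    of t, which is [nf t]. *)
Lemma nf_reduces t : equiv (nodes t) t (nf t) /\ (nf t != t -> (weight (nf t) < weight t)%N).
Proof.
elim/ltn_ind: {t}(weight t) {-2}t (erefl (weight t)) => w IHw t Dw.
have [Ft|/rewrite_step[t' [Dt' Et' lt_t']]] := boolP (F_tree t).
  by rewrite nf_F_tree // eqxx; split=> //; exact: equiv_refl.
rewrite -Dw in IHw; have [Et le_t] := IHw _ lt_t' _ (erefl _).
have Dnf : nf t' = nf t by apply/nf_eqP.
have nt' : nodes t' = nodes t by case: Dt'.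
rewrite Dnf nt' in Et le_t; split; first exact: equiv_trans Et.
by move=> _; have [->|/le_t] := eqVneq (nf t) t'; [|lia].
Qed.

Lemma weight_nf t : nf t != t -> (weight (nf t) < weight t)%N.
Proof. by case: (nf_reduces t). Qed.

Lemma nf_ideal k (t : tree G k) :
  ideal_gen NC_rel k (delta K t - delta K (nf_tree nodes_nf t)).
Proof. by have [] := nf_reduces (val t); rewrite nodes_val /equiv -!tree_vecE. Qed.

Lemma nf2 s : nodes s = 2 -> nf s != s ->
  related s (nf s) /\ forall A B C, (weight (sub3 (nf s) A B C) < weight (sub3 s A B C))%N.
Proof.
move=> ns ne; have nF : ~~ F_tree s by apply: contra ne => /nf_F_tree->.
have [s' [_ Fs' Ds rel lt_w]] := rewrite2 ns nF.
suff -> : nf s = s' by [].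
by rewrite -[RHS](nf_F_tree Fs'); apply/nf_eqP; exact: label_eq_sym.
Qed.

Lemma weight_sub3 s A B C : nodes s = 2 -> nf s != s ->
  (weight (sub3 (nf s) A B C) < weight (sub3 s A B C))%N.
Proof. by move=> ns /(nf2 ns)[]. Qed.

Lemma sum_tree_vec k t (w : btree -> K) : nodes t = k ->
  \sum_s tree_vec k t s * w (val s) = w t.
Proof.
move=> /eqP nt; rewrite (bigD1 (Sub t nt)) //= ffunE eqxx mul1r big1 ?addr0 // => s.
by rewrite -(inj_eq val_inj) ffunE => /negPf-> ; rewrite mul0r.
Qed.

Lemma R_nf x : NC_rel x -> kills_classes nf x.
Proof.
have vec_kills s t : nodes s = 2 -> nodes t = 2 -> label_eq s t ->
    kills_classes nf (tree_vec 2 s - tree_vec 2 t).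
  move=> ns nt /nf_eqP st w.
  have E : w (nf s) - w (nf t) = 0 by rewrite st subrr.
  rewrite -[RHS]E.
  rewrite -(sum_tree_vec (fun u => w (nf u)) ns) -(sum_tree_vec (fun u => w (nf u)) nt).
  by rewrite -sumrB; apply: eq_bigr => u _; rewrite !ffunE mulrBl.
apply.
  split=> [w|a y z ky kz w]; first by rewrite big1 // => t _; rewrite ffunE mul0r.
  by rewrite sum_linear ky kz mulr0 addr0.
move=> _ [p1 p2 p3 q1 q2 q3 r1 r2 E _|p1 p2 p3 q1 q2 q3 r1 r3 E E'|p1 p2 p3 q1 q2 q3 r1 r3 E _];
  rewrite ?gen_comp0 ?gen_comp1.
- by apply: vec_kills; [| | exact: label_eq_L].
- by apply: vec_kills; [| | exact: label_eq_LR].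
by apply: vec_kills; [| | exact: label_eq_R].
Qed.

End Rewriting.

(** * The presentation *)

Section Presentation.
Variables (K : fieldType) (M : finUMagmaType).
Local Notation G := (triangle M).
Local Notation btree := (btree G).
Local Notation Free := (Free K G).
Local Notation NC_rel := (@NC_relations K M).
Local Notation NCS := (NC_set_operad M).

Definition nc_label n (p : NCS n) := label (val (val p)).

Lemma nc_ext n (p q : NCS n) :
  (forall x y, (x < y <= n.+1)%N -> nc_label p x y = nc_label q x y) -> p = q.
Proof. by move=> pq; do 2!apply: val_inj; exact: clique_ext. Qed.

Lemma nc_label_comp n m (p : NCS n) i (q : NCS m) x y : (i <= n)%N -> (x < y <= (n + m).+1)%N ->
  nc_label (so_comp p i q) x y = comp_label m (nc_label p) (nc_label q) i x y.
Proof.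
move=> le_in xy; rewrite /nc_label (_ : val (so_comp p i q) = so_comp (val p) i (val q)).
  by rewrite [LHS](label_comp (val (val p)) i (val (val q))) xy.
exact: (@val_sub_comp _ _ (@C_noncrossing_comp M) _ _ p i q le_in).
Qed.

Definition tree_clique n (t : tree G n) : clique M n := mkclique n (tree_label (val t)).

Lemma label_tree_clique n (t : tree G n) x y : (x < y <= n.+1)%N ->
  label (tree_clique t) x y = tree_label (val t) x y.
Proof. exact: label_mk. Qed.

Lemma label_out n (p : clique M n) x y : ~~ (x < y <= n.+1)%N -> label p x y = 1%g.
Proof.
rewrite /label; case: pickP => // a /andP[/eqP<- /eqP<-].
by rewrite arcP.
Qed.

Lemma tree_clique_size1 n (t : tree G n) : size1_unit (tree_clique t).
Proof.
apply/implyP=> /eqP n0; rewrite label_tree_clique ?n0 //.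
by rewrite tree_label_leaf // nodes_val.
Qed.

Lemma tree_clique_noncrossing n (t : tree G n) : noncrossing (tree_clique t).
Proof.
apply/noncrossingP => x y x' y' xx' x'y yy'.
have [xy|/label_out-> //] := boolP (x < y <= n.+1)%N.
have [x'y'|/label_out-> //] := boolP (x' < y' <= n.+1)%N.
rewrite !label_tree_clique //; have := @tree_noncrossing _ (val t).
by rewrite nodes_val => nc; apply: nc; lia.
Qed.

Definition eval n (t : tree G n) : NCS n :=
  Sub (Sub (tree_clique t) (tree_clique_size1 t) : C_set_operad M n) (tree_clique_noncrossing t).

Lemma nc_label_eval n (t : tree G n) x y : (x < y <= n.+1)%N ->
  nc_label (eval t) x y = tree_label (val t) x y.
Proof. exact: label_tree_clique. Qed.

Lemma eval_nf n (s t : tree G n) : (eval s = eval t) <-> (nf (val s) = nf (val t)).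
Proof.
split=> [st|/nf_eqP[_ st]].
  apply/nf_eqP; split=> [|x y]; rewrite !nodes_val // => xy.
  by rewrite -!nc_label_eval // st.
by apply: nc_ext => x y xy; rewrite !nc_label_eval ?st // nodes_val.
Qed.

Lemma eval_comp n m (s : tree G n) i (t : tree G m) : (i <= n)%N ->
  eval (so_comp (s : tree_set_operad G n) i (t : tree_set_operad G m)) =
  so_comp (eval s) i (eval t).
Proof.
move=> le_in; apply: nc_ext => x y xy.
rewrite nc_label_eval // nc_label_comp // [LHS]tree_label_graft ?nodes_val //.
by rewrite /comp_label; case_if => //; rewrite !nc_label_eval //; lia.
Qed.

Lemma eval_surj n (p : NCS n) : exists t : tree G n, eval t = p.
Proof.
have [||t [_ nt Dt]] := @F_tree_exists _ n (nc_label p).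
- by move=> /eqP n0; have /implyP/(_ n0)/eqP := valP (val p).
- move=> x y x' y' xx' x'y yy' _ nxy.
  by have /noncrossingP := valP p; apply; [exact: xx'|exact: x'y|exact: yy'|].
exists (Sub t (introT eqP nt)); apply: nc_ext => x y xy.
by rewrite nc_label_eval // Dt.
Qed.

Definition preimage n (p : NCS n) : tree G n := sval (cid (eval_surj p)).

Lemma preimageK n (p : NCS n) : eval (preimage p) = p.
Proof. exact: svalP (cid (eval_surj p)). Qed.

Definition lin_map (T U : finType) (f : T -> U) (x : {ffun T -> K^o}) : {ffun U -> K^o} :=
  \sum_t x t *: delta K (f t).

Lemma lin_map_linear (T U : finType) (f : T -> U) : linear (lin_map f).
Proof.
move=> c x y; rewrite /lin_map scaler_sumr -big_split /=.
by apply: eq_bigr => a _; rewrite !ffunE scalerDl scalerA.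
Qed.

Lemma lin_map_delta (T U : finType) (f : T -> U) t : lin_map f (delta K t) = delta K (f t).
Proof. exact: sum_delta. Qed.

Lemma eval_lin_comp n m (x : Free n) i (y : Free m) : (i <= n)%N ->
  lin_map (@eval (n + m)) (x o_(i) y)
  = (lin_map (@eval n) x : NC K M n) o_(i) (lin_map (@eval m) y : NC K M m).
Proof.
move=> le_in; move: x; apply: linear_delta_ext => [c u v|c u v|a].
- by rewrite op_compl // lin_map_linear.
- by rewrite lin_map_linear op_compl.
move: y; apply: linear_delta_ext => [c u v|c u v|b].
- by rewrite op_compr // lin_map_linear.
- by rewrite lin_map_linear op_compr.
rewrite !lin_map_delta [X in lin_map _ X]lin_comp_delta lin_map_delta [RHS]lin_comp_delta.
by rewrite eval_comp.
Qed.

Local Notation I := (ideal_gen NC_rel).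

Lemma ideal_eval n (x : Free n) : I n x -> lin_map (@eval n) x = 0.
Proof.
move=> /(ideal_kills (@nf_graftl M) (@nf_graftr M) (@R_nf K M)) kx.
apply/ffunP=> p; rewrite sum_ffunE ffunE.
rewrite -[RHS](kx (fun u => (u == nf (val (preimage p)))%:R)).
apply: eq_bigr => t _; rewrite !ffunE [_ *: _]/(_ * _); congr (_ * (nat_of_bool _)%:R).
rewrite -{1}(preimageK p).
apply/eqP/eqP => [E|E]; first by apply/esym/eval_nf.
by apply/eval_nf.
Qed.

(** A tree and the tree chosen for its clique have the same normal form, hence are equal modulo the
    ideal. *)
Lemma ideal_eval_section n (x : Free n) :
  I n (x - lin_map (@preimage n) (lin_map (@eval n) x)).
Proof.
have sI := ideal_subspace I n.
have -> : x - lin_map (@preimage n) (lin_map (@eval n) x)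
    = \sum_t x t *: (delta K t - delta K (preimage (eval t))).
  under eq_bigr => t _ do rewrite scalerBr.
  rewrite sumrB -ffun_delta; congr (_ - _).
  move: x; apply: linear_delta_ext => [c u v|c u v|t].
  - by rewrite !lin_map_linear.
  - rewrite scaler_sumr -big_split /=.
    by apply: eq_bigr => a _; rewrite !ffunE scalerDl scalerA.
  by rewrite !lin_map_delta sum_delta.
apply: (subspace_sum sI) => t _; apply: (subspaceZ sI).
have Dnf : nf_tree (@nodes_nf M) (preimage (eval t)) = nf_tree (@nodes_nf M) t.
  by apply: val_inj; apply/eval_nf; rewrite preimageK.
have := subspaceB sI (@nf_ideal K _ _ t) (@nf_ideal K _ _ (preimage (eval t))).
by rewrite Dnf opprB addrA subrK.
Qed.

Definition to_presented n (x : NC K M n) : presented NC_rel n :=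
  quot_pi I (lin_map (@preimage n) x).

Lemma to_presented_linear n : linear (@to_presented n).
Proof.
move=> a x y; rewrite /to_presented lin_map_linear quot_piD.
by rewrite -quot_scaleE.
Qed.

(** The choice of a tree for each clique respects composition only modulo the ideal; this is
    [ideal_eval_section] applied to a composition of chosen trees. *)
Theorem NC_presented : isomorphic (NC K M) (presented NC_rel).
Proof.
pose f n : {linear NC K M n -> presented NC_rel n} :=
  HB.pack (@to_presented n) (GRing.isLinear.Build _ _ _ _ _ (@to_presented_linear n)).
have sectionK n (x : NC K M n) : lin_map (@eval n) (lin_map (@preimage n) x) = x.
  move: x; apply: linear_delta_ext => [c u v|c u v|p]; rewrite ?lin_map_linear //.
  by rewrite !lin_map_delta preimageK.
have eval_eq n (x y : Free n) : I n (x - y) -> lin_map (@eval n) x = lin_map (@eval n) y.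
  move=> /ideal_eval E; rewrite -[x](subrK y) -[x - y]scale1r lin_map_linear E.
  by rewrite scaler0 add0r.
exists f; split=> [n||n m x i y le_in].
- exists (fun q => lin_map (@eval n) (repr q)) => [x|].
    by rewrite -[RHS]sectionK; apply: eval_eq; exact: quot_repr.
  elim/quot_ind => y; apply/quot_piP.
  have sI := ideal_subspace I n.
  have := subspaceB sI (quot_repr I y) (ideal_eval_section (repr (quot_pi I y))).
  by rewrite opprB addrC addrA subrK.
- apply: (congr1 (fun x => quot_pi I x)); rewrite lin_map_delta.
  congr (delta K _); apply: val_inj.
  by have := nodes_val (preimage (so_unit NCS)); case: (val _).
apply/esym; rewrite [LHS]quot_compE //; apply/quot_piP.
have := ideal_eval_section
  ((lin_map (@preimage n) x : Free n) o_(i) (lin_map (@preimage m) y : Free m)).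
by rewrite eval_lin_comp // !sectionK.
Qed.

End Presentation.

(** * A basis of the dual component *)

Section Balanced.
Variables (K : fieldType) (M : finUMagmaType).
Local Notation G := (triangle M).
Local Notation btree := (btree G).
Local Notation Free := (Free K G).
Local Notation NC_rel := (@NC_relations K M).

(** The sum over the pairs of labels of an edge with product d, which form one class of relation (a)
    or (c) when d is not 1. *)
Definition fiber_sum (d : M) (F : M -> M -> K) : K :=
  \sum_x \sum_y ((x * y)%g == d)%:R * F x y.

Lemma fiber_sum_ext d F F' : (forall x y, F x y = F' x y) -> fiber_sum d F = fiber_sum d F'.
Proof. by move=> eqF; apply: eq_bigr => x _; apply: eq_bigr => y _; rewrite eqF. Qed.

Lemma fiber_sumD d F F' :
  fiber_sum d (fun x y => F x y + F' x y) = fiber_sum d F + fiber_sum d F'.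
Proof.
rewrite -big_split; apply: eq_bigr => x _; rewrite -big_split.
by apply: eq_bigr => y _; rewrite mulrDr.
Qed.

Lemma fiber_sumZ d a F : fiber_sum d (fun x y => a * F x y) = a * fiber_sum d F.
Proof.
rewrite mulr_sumr; apply: eq_bigr => x _; rewrite mulr_sumr.
by apply: eq_bigr => y _; rewrite mulrCA.
Qed.

Lemma fiber_sum0 d : fiber_sum d (fun _ _ => 0) = 0.
Proof. by rewrite /fiber_sum big1 // => x _; rewrite big1 // => y _; rewrite mulr0. Qed.

Lemma fiber_sum_sum (I : Type) (r : seq I) d (F : I -> M -> M -> K) :
  fiber_sum d (fun x y => \sum_(i <- r) F i x y) = \sum_(i <- r) fiber_sum d (F i).
Proof.
elim: r => [|i r IHr].
  by rewrite big_nil -[RHS](fiber_sum0 d); apply: fiber_sum_ext => x y; rewrite big_nil.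
by rewrite big_cons -IHr -fiber_sumD; apply: fiber_sum_ext => x y; rewrite big_cons.
Qed.

Lemma sum_fibers (Y : M -> K) F :
  \sum_x \sum_y Y (x * y)%g * F x y = \sum_d Y d * fiber_sum d F.
Proof.
under [RHS]eq_bigr => d _ do rewrite mulr_sumr.
rewrite [RHS]exchange_big; apply: eq_bigr => x _.
under [RHS]eq_bigr => d _ do rewrite mulr_sumr.
rewrite [RHS]exchange_big; apply: eq_bigr => y _.
rewrite (bigD1 (x * y)%g) //= eqxx mul1r big1 ?addr0 // => d ne_d.
by rewrite eq_sym (negPf ne_d) mul0r mulr0.
Qed.

Section Edge.
Variables (p1 q2 q3 p3 : M) (A B C : btree).
Definition left_edge x y := Node (tri p1 x p3) (Node (tri y q2 q3) A B) C.
Definition right_edge x y := Node (tri p1 q2 x) A (Node (tri y q3 p3) B C).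
End Edge.

(* The condition for a function of a tree to belong to the dual component,
   restricted to the edges above the root. *)
Definition balanced (e : btree -> K) := forall p1 q2 q3 p3 A B C, exists c, forall d,
  fiber_sum d (fun x y => e (left_edge p1 q2 q3 p3 A B C x y)) = (d == 1%g)%:R * c /\
  fiber_sum d (fun x y => e (right_edge p1 q2 q3 p3 A B C x y)) = (d == 1%g)%:R * c.

Lemma balanced_ext e e' : (forall g l r, e (Node g l r) = e' (Node g l r)) ->
  balanced e -> balanced e'.
Proof.
move=> ee' be p1 q2 q3 p3 A B C; have [c ec] := be p1 q2 q3 p3 A B C.
exists c => d; have [E1 E2] := ec d.
by split; [rewrite -E1 | rewrite -E2]; apply: fiber_sum_ext => x y; rewrite -ee'.
Qed.

Lemma balancedZ a e : balanced e -> balanced (fun s => a * e s).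
Proof.
move=> be p1 q2 q3 p3 A B C; have [c ec] := be p1 q2 q3 p3 A B C.
by exists (a * c) => d; have [E1 E2] := ec d; rewrite !fiber_sumZ E1 E2 mulrCA.
Qed.

Lemma balanced0 : balanced (fun=> 0).
Proof.
by move=> p1 q2 q3 p3 A B C; exists 0 => d; rewrite !fiber_sum0 mulr0.
Qed.

Lemma balanced_sum (I : eqType) (r : seq I) (e : I -> btree -> K) :
  (forall i, i \in r -> balanced (e i)) -> balanced (fun s => \sum_(i <- r) e i s).
Proof.
elim: r => [|i r IHr] be.
  by apply: balanced_ext balanced0 => g l t; rewrite big_nil.
have b1 := be i (mem_head i r).
have b2 : balanced (fun s => \sum_(i <- r) e i s).
  by apply: IHr => j jr; apply: be; rewrite inE jr orbT.
move=> p1 q2 q3 p3 A B C; have [c1 E1] := b1 p1 q2 q3 p3 A B C.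
have [c2 E2] := b2 p1 q2 q3 p3 A B C; exists (c1 + c2) => d.
have [E1l E1r] := E1 d; have [E2l E2r] := E2 d; rewrite mulrDr.
by split; [rewrite -E1l -E2l | rewrite -E1r -E2r];
  rewrite -fiber_sumD; apply: fiber_sum_ext => x y; rewrite big_cons.
Qed.

Lemma balanced_base (k : M -> K) e : balanced e -> balanced (fun s => k (root_base s) * e s).
Proof.
move=> be p1 q2 q3 p3 A B C; have [c ec] := be p1 q2 q3 p3 A B C.
exists (k p1 * c) => d; have [E1 E2] := ec d.
rewrite mulrCA; split; [rewrite -E1 | rewrite -E2]; rewrite -fiber_sumZ.
all: by apply: fiber_sum_ext => x y; rewrite /= base_tri.
Qed.

End Balanced.

(** * Balanced functions and the orthogonal relations *)

Section LocalBalance.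
Variables (K : fieldType) (M : finUMagmaType).
Local Notation G := (triangle M).
Local Notation btree := (btree G).
Local Notation Free := (Free K G).
Local Notation NC_rel := (@NC_relations K M).
Implicit Types (e : btree -> K) (A B C : btree).

Definition locally_balanced e := forall a i, (i <= nodes a)%N ->
  balanced (fun s => e (graft a i s)).

Lemma sum_tri (F : G -> K) : \sum_g F g = \sum_p \sum_q \sum_r F (tri p q r).
Proof.
transitivity (\sum_(x : M * M * M) F (tri x.1.1 x.1.2 x.2)).
  pose f (x : M * M * M) : G := tri x.1.1 x.1.2 x.2.
  rewrite (reindex f) //; apply: onW_bij.
  exists (fun g => (base_label g, left_label g, right_label g)) => [[[p q] r]|g].
    by rewrite /f /= base_tri left_tri right_tri.
  exact: tri_eta.
by rewrite !pair_bigA; apply: eq_bigr => -[[p q] r].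
Qed.

(** Up to the sign of the form, an element orthogonal to the relations is constant on classes. *)
Lemma orth_related (y : Free 2) s t : Defs.orthogonal NC_rel y ->
  related K s t -> nodes s = 2 -> nodes t = 2 ->
  tree_sign K s * coef y s = tree_sign K t * coef y t.
Proof.
move=> Ry /Ry E0 ns nt; move: E0; rewrite /quadratic_form.
have sumE u : nodes u = 2 ->
    \sum_(v : tree G 2) tree_vec K 2 u v * (tree_sign K (val v) * coef y (val v))
    = tree_sign K u * coef y u.
  exact: (@sum_tree_vec K M 2 u (fun v => tree_sign K v * coef y v)).
move=> E; apply/eqP; rewrite -subr_eq0 -!sumE // -sumrB -[X in _ == X]E; apply/eqP.
apply: eq_bigr => u _; rewrite !ffunE /coef valK /tree_sign; case: ifP => _; ring.
Qed.

(** By [orth_related] the pairing with y is a combination of fiber sums. Those with d <> 1 vanish,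
    while for d = 1 the left and right sums are equal and y takes opposite values on left and right
    trees. *)
Lemma locally_balanced_dual e : locally_balanced e -> local_dual NC_rel e.
Proof.
move=> be y Ry a i A B C le_i.
pose X s := e (graft a i s).
transitivity (\sum_(s : tree G 2) coef y (val s) * X (sub3 (val s) A B C)).
  by apply: eq_bigr => s _; rewrite /coef valK.
rewrite (sum_tree2 (fun s => coef y s * X (sub3 s A B C))).
have bX : balanced X by exact: be.
have [c Xc] : exists c : M -> M -> M -> M -> K, forall p1 q2 q3 p3 d,
    fiber_sum d (fun x y => X (left_edge p1 q2 q3 p3 A B C x y)) = (d == 1%g)%:R * c p1 q2 q3 p3 /\
    fiber_sum d (fun x y => X (right_edge p1 q2 q3 p3 A B C x y)) = (d == 1%g)%:R * c p1 q2 q3 p3.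
  have /choice[c Ec] : forall z : M * M * M * M, exists c, forall d,
    fiber_sum d (fun x y => X (left_edge z.1.1.1 z.1.1.2 z.1.2 z.2 A B C x y)) = (d == 1%g)%:R * c /\
    fiber_sum d (fun x y => X (right_edge z.1.1.1 z.1.1.2 z.1.2 z.2 A B C x y)) = (d == 1%g)%:R * c.
    by move=> z; exact: bX.
  by exists (fun p1 q2 q3 p3 => c (p1, q2, q3, p3)) => p1 q2 q3 p3; exact: (Ec (p1, q2, q3, p3)).
(* The values of y on the classes of product d, taken at the representatives with pair of labels (d,
   1). *)
pose L p1 q2 q3 p3 d := coef y (left2 (tri p1 d p3) (tri 1%g q2 q3)).
pose R p1 q2 q3 p3 d := coef y (right2 (tri p1 q2 d) (tri 1%g q3 p3)).
have sumL : \sum_h \sum_g coef y (left2 h g) * X (sub3 (left2 h g) A B C)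
    = \sum_p1 \sum_p3 \sum_q2 \sum_q3 L p1 q2 q3 p3 1%g * c p1 q2 q3 p3.
  rewrite sum_tri; apply: eq_bigr => p1 _; rewrite exchange_big; apply: eq_bigr => p3 _.
  under eq_bigr => x _ do rewrite sum_tri exchange_big.
  rewrite exchange_big; apply: eq_bigr => q2 _.
  under eq_bigr => x _ do rewrite exchange_big.
  rewrite exchange_big; apply: eq_bigr => q3 _ /=.
  transitivity (\sum_x \sum_y0 L p1 q2 q3 p3 (x * y0)%g * X (left_edge p1 q2 q3 p3 A B C x y0)).
    apply: eq_bigr => x _; apply: eq_bigr => y0 _; congr (_ * _).
    have := orth_related Ry (@related_L K M p1 x p3 y0 q2 q3 1%g (x * y0)%g (esym (mulg1 _)))
      (erefl _) (erefl _).
    by rewrite /tree_sign /= !mul1r.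
  rewrite sum_fibers (bigD1 1%g) //= big1 ?addr0 => [|d ne_d].
    by rewrite (Xc _ _ _ _ _).1 eqxx mul1r.
  by rewrite (Xc _ _ _ _ _).1 (negPf ne_d) mul0r mulr0.
have sumR : \sum_h \sum_g coef y (right2 h g) * X (sub3 (right2 h g) A B C)
    = \sum_p1 \sum_q2 \sum_q3 \sum_p3 R p1 q2 q3 p3 1%g * c p1 q2 q3 p3.
  rewrite sum_tri; apply: eq_bigr => p1 _; apply: eq_bigr => q2 _.
  under eq_bigr => x _ do rewrite sum_tri exchange_big.
  rewrite exchange_big; apply: eq_bigr => q3 _.
  under eq_bigr => x _ do rewrite exchange_big.
  rewrite exchange_big; apply: eq_bigr => p3 _ /=.
  transitivity (\sum_x \sum_y0 R p1 q2 q3 p3 (x * y0)%g * X (right_edge p1 q2 q3 p3 A B C x y0)).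
    apply: eq_bigr => x _; apply: eq_bigr => y0 _; congr (_ * _).
    have := orth_related Ry (@related_R K M p1 q2 x y0 q3 p3 1%g (x * y0)%g (esym (mulg1 _)))
      (erefl _) (erefl _).
    by rewrite /tree_sign /= !mulN1r => /oppr_inj.
  rewrite sum_fibers (bigD1 1%g) //= big1 ?addr0 => [|d ne_d].
    by rewrite (Xc _ _ _ _ _).2 eqxx mul1r.
  by rewrite (Xc _ _ _ _ _).2 (negPf ne_d) mul0r mulr0.
under eq_bigr => h _ do rewrite big_split /=.
rewrite big_split /= sumL sumR.
under eq_bigr => p1 _ do rewrite exchange_big.
under eq_bigr => p1 _ do (under eq_bigr => q2 _ do rewrite exchange_big).
rewrite -big_split big1 // => p1 _; rewrite -big_split big1 // => q2 _ /=.
rewrite -big_split big1 // => q3 _; rewrite -big_split big1 // => p3 _ /=.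
rewrite -mulrDl [X in X * _](_ : _ = 0) ?mul0r //.
have := orth_related Ry (@related_LR K M p1 1%g p3 1%g q2 q3 1%g 1%g (mulg1 _) (mulg1 _))
      (erefl _) (erefl _).
by rewrite /tree_sign /= mul1r mulN1r /L /R => ->; rewrite addNr.
Qed.

End LocalBalance.

(** Two ways of cutting a row into three nonempty blocks, by the last cut or by the first cut; they
    correspond to a left and a right edge in [balanced_cells]. *)
Lemma triangle_sum (R : nmodType) m (f : nat -> nat -> R) :
  \sum_(1 <= j < m) \sum_(1 <= i < j) f i (j - i)%N
  = \sum_(1 <= i < m) \sum_(1 <= j < m - i) f i j.
Proof.
transitivity (\sum_(1 <= j < m) \sum_(1 <= i < m | (i < j)%N) f i (j - i)%N).
  apply: eq_big_nat => j /andP[_ lt_jm]; rewrite (big_nat_widen _ _ m) ?(ltnW lt_jm) //.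
rewrite (exchange_big_dep xpredT) //=; apply: eq_big_nat => i /andP[i_gt0 lt_im].
transitivity (\sum_(i.+1 <= j < m) f i (j - i)%N).
  by rewrite (big_nat_widenl i.+1 1).
rewrite -[i.+1]add1n (big_addn 1 _ i).
by apply: eq_big_nat => j _; rewrite addnK.
Qed.

(** * Sums over the triangulations of a polygon *)

Section Cells.
Variables (K : fieldType) (M : finUMagmaType).
Local Notation G := (triangle M).
Local Notation btree := (btree G).
Local Notation Free := (Free K G).
Local Notation NC_rel := (@NC_relations K M).
Implicit Types (s t : btree).

Definition side := M -> btree -> K.

(* The sum of all the triangulations of a polygon whose sides above the base
   are given by Phi, the labels on both sides of the diagonals being 1.
   The label of the base is ignored. *)
Fixpoint cells (Phi : seq side) s : K :=
  if s is Node h l r then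
    \sum_(1 <= j < size Phi)
      (if take j Phi is [:: phi] then phi (left_label h) l
       else (left_label h == 1%g)%:R * (root_base l == 1%g)%:R * cells (take j Phi) l)
      * (if drop j Phi is [:: phi] then phi (right_label h) r
         else (right_label h == 1%g)%:R * (root_base r == 1%g)%:R * cells (drop j Phi) r)
  else 0.

(** One factor of [cells]: a single side, or a smaller polygon glued along a diagonal with both
    labels 1. *)
Definition part (Phi : seq side) a s : K :=
  if Phi is [:: phi] then phi a s
  else (a == 1%g)%:R * (root_base s == 1%g)%:R * cells Phi s.

Lemma cells_node Phi h l r : cells Phi (Node h l r) =
  \sum_(1 <= j < size Phi) part (take j Phi) (left_label h) l
                           * part (drop j Phi) (right_label h) r.
Proof. by []. Qed.

(** This makes the edge between a cell and its side satisfy the balance condition with constant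
    0. *)
Definition fiber_free (phi : side) := forall d q2 q3 A B,
  fiber_sum d (fun x y => phi x (Node (tri y q2 q3) A B)) = 0.

Definition good_side (phi : side) :=
  (forall a, locally_balanced (phi a)) /\ fiber_free phi.

Fixpoint all_good (Phi : seq side) : Prop :=
  if Phi is phi :: Phi' then good_side phi /\ all_good Phi' else True.

Lemma all_good_take j Phi : all_good Phi -> all_good (take j Phi).
Proof. by elim: Phi j => [|phi Phi IH] [|j] //= [? /IH]; split. Qed.

Lemma all_good_drop j Phi : all_good Phi -> all_good (drop j Phi).
Proof. by elim: Phi j => [|phi Phi IH] [|j] //= [? /IH]. Qed.

Definition cut2 (Phi : seq side) q2 A q3 B : K :=
  \sum_(1 <= i < size Phi) part (take i Phi) q2 A * part (drop i Phi) q3 B.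

(** For a single side both members vanish. Otherwise the edge is a diagonal, and only its pair of
    labels (1, 1) contributes, so the sum is concentrated at d = 1. *)
Lemma fiber_part Phi d q2 q3 A B : all_good Phi ->
  fiber_sum d (fun x y => part Phi x (Node (tri y q2 q3) A B))
  = (d == 1%g)%:R * cut2 Phi q2 A q3 B.
Proof.
move=> good; have [sz1|sz_neq1] := eqVneq (size Phi) 1%N.
  case: Phi sz1 good => [|phi []] //= _ [[_ ->] _].
  by rewrite /cut2 big_geq ?mulr0.
transitivity (fiber_sum d (fun x y => cut2 Phi q2 A q3 B * ((x == 1%g)%:R * (y == 1%g)%:R))).
  apply: fiber_sum_ext => x y; rewrite mulrC.
  have -> : part Phi x (Node (tri y q2 q3) A B)
      = (x == 1%g)%:R * (y == 1%g)%:R * cells Phi (Node (tri y q2 q3) A B).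
    by case: Phi sz_neq1 {good} => [|phi []] //= *; rewrite base_tri.
  by rewrite cells_node left_tri right_tri.
rewrite fiber_sumZ mulrC; congr (_ * _); rewrite /fiber_sum.
rewrite (bigD1 1%g) //= (bigD1 1%g) //= !eqxx mulg1 !mulr1 eq_sym.
rewrite big1 => [|y /negPf->]; last by rewrite !mulr0.
rewrite big1 ?addr0 // => x /negPf ne_x; rewrite big1 // => y _.
by rewrite ne_x mul0r mulr0.
Qed.

(** Flipping a diagonal exchanges a left edge with a right one and keeps the cut of the sides into
    three blocks, carried by A, B and C. The common constant is the sum over these cuts. *)
Lemma balanced_cells Phi : all_good Phi -> balanced (cells Phi).
Proof.
move=> good p1 q2 q3 p3 A B C.
exists (\sum_(1 <= i < size Phi) \sum_(1 <= j < size Phi - i)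
  part (take i Phi) q2 A * (part (take j (drop i Phi)) q3 B * part (drop j (drop i Phi)) p3 C)).
move=> d; split.
  transitivity (fiber_sum d (fun x y => \sum_(1 <= j < size Phi)
      part (drop j Phi) p3 C * part (take j Phi) x (Node (tri y q2 q3) A B))).
    apply: fiber_sum_ext => x y; rewrite /left_edge cells_node left_tri right_tri.
    by apply: eq_bigr => j _; rewrite mulrC.
  rewrite fiber_sum_sum -(triangle_sum _ (fun i j => part (take i Phi) q2 A *
    (part (take j (drop i Phi)) q3 B * part (drop j (drop i Phi)) p3 C))) mulr_sumr.
  apply: eq_big_nat => j /andP[j_gt0 lt_j].
  rewrite fiber_sumZ fiber_part; last exact: all_good_take.
  rewrite mulrCA; congr (_ * _); rewrite /cut2 size_takel ?(ltnW lt_j) // mulr_sumr.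
  apply: eq_big_nat => i /andP[i_gt0 lt_i].
  rewrite take_takel ?(ltnW lt_i) // drop_drop subnK ?(ltnW lt_i) //.
  by rewrite take_drop subnK ?(ltnW lt_i) // mulrC mulrA.
transitivity (fiber_sum d (fun x y => \sum_(1 <= i < size Phi)
    part (take i Phi) q2 A * part (drop i Phi) x (Node (tri y q3 p3) B C))).
  by apply: fiber_sum_ext => x y; rewrite /right_edge cells_node left_tri right_tri.
rewrite fiber_sum_sum mulr_sumr; apply: eq_bigr => i _.
rewrite fiber_sumZ fiber_part; last exact: all_good_drop.
rewrite mulrCA; congr (_ * _); rewrite /cut2 size_drop mulr_sumr.
by [].
Qed.

Lemma root_base_graft a i s : root_base (graft a i s)
  = if a is Node g _ _ then base_label g else root_base s.
Proof. by case: a => //= g l r; case: leqP. Qed.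

Lemma local_base (k : M -> K) e : locally_balanced e ->
  locally_balanced (fun s => k (root_base s) * e s).
Proof.
move=> be a i le_i; case: a le_i => [|g l r] le_i.
  exact: (balanced_base k (be Leaf i le_i)).
have := balancedZ (k (base_label g)) (be (Node g l r) i le_i).
by apply: balanced_ext => h l' r'; rewrite (root_base_graft (Node g l r)).
Qed.

(** In each term the hole of the context lies in one factor and the other factor is a scalar. The
    factor with the hole is a side, or a smaller [cells] times a function of the root base. *)
Lemma locally_balanced_cells Phi : all_good Phi -> locally_balanced (cells Phi).
Proof.
move=> good a; elim: a Phi good => [|h l IHl r IHr] Phi good i /= le_i.
  exact: balanced_cells.
have part_bal (t : btree) x Psi : all_good Psi -> (0 < size Psi)%N ->
    (forall Psi, all_good Psi -> forall i, (i <= nodes t)%N ->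
       balanced (fun s => cells Psi (graft t i s))) ->
    forall j, (j <= nodes t)%N -> balanced (fun s => part Psi x (graft t j s)).
  move=> goodP szP IH j le_j; have [sz1|sz_neq1] := eqVneq (size Psi) 1%N.
    by case: Psi sz1 goodP {szP} => [|phi []] //= _ [[lb _] _]; exact: lb.
  have bb (k : M -> K) : balanced (fun s => k (root_base (graft t j s)) * cells Psi (graft t j s)).
    have bc := IH _ goodP _ le_j; case: t le_j bc {IH} => [|g u v] le_j bc.
      exact: balanced_base.
    by apply: balanced_ext (balancedZ (k (base_label g)) bc) => *; rewrite root_base_graft.
  have := balancedZ (x == 1%g)%:R (bb (fun b => (b == 1%g)%:R)).
  apply: balanced_ext => g u v; rewrite mulrA.
  by case: Psi sz_neq1 {goodP szP IH bb} => [|phi []].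
case: (leqP i (nodes l)) => [le_il|lt_li].
  apply: (@balanced_ext _ _ (fun s => \sum_(1 <= j < size Phi)
    part (drop j Phi) (right_label h) r * part (take j Phi) (left_label h) (graft l i s))).
    by move=> g u v; rewrite cells_node; apply: eq_bigr => j _; rewrite mulrC.
  apply: balanced_sum => j; rewrite mem_index_iota => /andP[j_gt0 lt_j].
  apply: balancedZ; apply: part_bal => //; first exact: all_good_take.
  by rewrite size_takel // ltnW.
apply: (@balanced_ext _ _ (fun s => \sum_(1 <= j < size Phi)
  part (take j Phi) (left_label h) l * part (drop j Phi) (right_label h)
    (graft r (i - (nodes l).+1) s))).
  by move=> g u v; rewrite cells_node.
apply: balanced_sum => j; rewrite mem_index_iota => /andP[j_gt0 lt_j].
apply: balancedZ; apply: part_bal => //; [exact: all_good_drop| |lia].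
by rewrite size_drop subn_gt0.
Qed.

End Cells.

(** * Dual elements with a prescribed leading tree *)

Section DualBasis.
Variables (K : fieldType) (M : finUMagmaType).
Local Notation G := (triangle M).
Local Notation btree := (btree G).
Local Notation NC_rel := (@NC_relations K M).
Local Notation Z_tree := (@Z_tree G (@zero_left M) (@zero_right M)).
Local Notation weight := (weight (@tree_cost M)).
Local Notation heavier := (heavier (@tree_cost M)).
Implicit Types (s t : btree).

(* The side carrying the tree t, given the sides Phi of the cell of its root:
   the pair (a, b) of labels of its edge is replaced by (a, b) - (a * b, 1). *)
Definition tree_side a t (Phi : seq (side K M)) : side K M := fun x s =>
  match t, s with
  | Leaf, Leaf => (x == a)%:R
  | Node _ _ _, Node _ _ _ =>
    (((x == a) && (root_base s == root_base t))%:R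
     - ((x == a * root_base t)%g && (root_base s == 1%g))%:R) * cells Phi s
  | _, _ => 0
  end.

(** In a Z-tree an edge with labels (1, 1) is a right edge; such edges join triangles into a cell,
    triangulated by its right comb, the heaviest of its triangulations. *)
Definition extends (g : G) (t : btree) : bool :=
  if t is Node h _ _ then (right_label g == 1%g) && (base_label h == 1%g) else false.

Fixpoint sides t : seq (side K M) :=
  if t is Node g l r then
    tree_side (left_label g) l (sides l)
    :: (if extends g r then sides r else [:: tree_side (right_label g) r (sides r)])
  else [::].

Fixpoint side_trees t : seq (M * btree) :=
  if t is Node g l r then
    (left_label g, l) :: (if extends g r then side_trees r else [:: (right_label g, r)])
  else [::].

Definition side_of (x : M * btree) := tree_side x.1 x.2 (sides x.2).

Lemma sides_map t : sides t = map side_of (side_trees t).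
Proof. by elim: t => [//|g l _ r IHr] /=; case: ifP => _ //; rewrite IHr. Qed.

(** The pairs (a, b) and (a * b, 1) have the same product, so their difference has zero sum over
    every fiber. *)
Lemma good_tree_side a t Phi : all_good Phi -> good_side (tree_side a t Phi).
Proof.
move=> good; split=> [x|d q2 q3 A B].
  case: t => [|g l r].
    move=> b i le_i; apply: balanced_ext (@balanced0 K M) => h u v.
    by case: b {le_i} => [|h' u' v'] //=; case: leqP.
  have := local_base (fun b => ((x == a) && (b == base_label g))%:R
     - ((x == a * base_label g)%g && (b == 1%g))%:R) (locally_balanced_cells good).
  move=> lb b i le_i; apply: balanced_ext (lb b i le_i) => h u v.
  case Dt: (graft b i (Node h u v)) => [|h' u' v'] //.
  by have := nodes_graft b i (Node h u v); rewrite Dt /=; lia.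
case: t => [|g l r]; first by rewrite -[RHS](fiber_sum0 K d).
pose v := cut2 Phi q2 A q3 B.
transitivity (fiber_sum d (fun x y => v * (((x == a) && (y == base_label g))%:R
     - ((x == a * base_label g)%g && (y == 1%g))%:R))).
  apply: fiber_sum_ext => x y; rewrite mulrC /tree_side cells_node left_tri right_tri.
  by rewrite /= base_tri.
rewrite fiber_sumZ [X in _ * X](_ : _ = 0) ?mulr0 //.
have pick_sum b c : fiber_sum d (fun x y => ((x == b) && (y == c))%:R) = ((b * c)%g == d)%:R :> K.
  rewrite /fiber_sum (bigD1 b) //= (bigD1 c) //= !eqxx mulr1.
  rewrite big1 => [|y /negPf->]; last by rewrite andbF mulr0.
  by rewrite big1 ?addr0 // => x /negPf->; rewrite big1 // => y _; rewrite mulr0.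
transitivity (fiber_sum d (fun x y => ((x == a) && (y == base_label g))%:R
   + (-1) * ((x == a * base_label g)%g && (y == 1%g))%:R) : K).
  by apply: fiber_sum_ext => x y; rewrite mulN1r.
by rewrite fiber_sumD fiber_sumZ !pick_sum mulg1 mulN1r subrr.
Qed.

Lemma good_sides t : all_good (sides t).
Proof.
elim: t => //= g l IHl r IHr; split; first exact: good_tree_side.
by case: ifP => _ //=; split=> //; exact: good_tree_side.
Qed.

(** Each cell of t is replaced by the sum of its triangulations and each other inner edge by (a, b)
    - (a * b, 1); only the label of the root base is kept fixed. *)
Definition dual_elt t s : K := (root_base s == root_base t)%:R * cells (sides t) s.

Lemma dual_elt_dual t k : dualf NC_rel k (dual_elt t).
Proof.
apply: local_dualP; apply: locally_balanced_dual.
exact: (local_base (fun b => (b == root_base t)%:R) (locally_balanced_cells (good_sides t))).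
Qed.

Lemma size_sides g l r : (1 < size (sides (Node g l r)))%N.
Proof. by elim: r g l => [|h r _ r' IHr] g l //=; case: ifP => // _; exact: ltnW (IHr _ _). Qed.

Lemma cells_id t : Z_tree t -> (0 < nodes t)%N -> cells (sides t) t = 1.
Proof.
elim: t => // g l IHl r IHr /= /and4P[zL zR Zl Zr] _.
have side_id a u : (u == Leaf) || (root_base u != 1%g) -> Z_tree u ->
    ((0 < nodes u)%N -> cells (sides u) u = 1) -> tree_side a u (sides u) a u = 1.
  case: u => [|h u v] /=; first by rewrite eqxx.
  move=> b_neq1 _ -> //; rewrite !eqxx /= mulr1 [X in _ - X](_ : _ = 0) ?subr0 //.
  by rewrite (negPf b_neq1) andbF.
have Dl : (l == Leaf) || (root_base l != 1%g) by case: l zL {IHl Zl}.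
set Phi := (if _ then _ else _).
have sz_Phi : (0 < size Phi)%N.
  by rewrite /Phi; case: ifP => // ext; case: r ext {IHr zR Zr Phi}.
rewrite big_ltn ?ltnS //= drop0 take0.
rewrite side_id // => [|n0]; last exact: IHl.
(* Only the cut j = 1 contributes: for j > 1 the tree l would have to be a nonempty piece of the
   cell with base 1, but it is a leaf or has another base. *)
rewrite mul1r big_nat big1 ?addr0 => [|j /andP[j_gt1 lt_j]]; last first.
  rewrite [X in X * _](_ : _ = 0) ?mul0r //.
  case: j j_gt1 lt_j => [|j] //= j_gt0 lt_j.
  have sz_take : (0 < size (take j Phi))%N by rewrite size_takel; lia.
  case: (take j Phi) sz_take => // phi Phi' _.
  case: l Dl {zL Zl IHl} => [|h u v] Dl; first by rewrite mulr0.
  by rewrite /= (negPf Dl) mulr0 mul0r.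
rewrite /Phi; case: ifP => [ext|next].
  case: r ext IHr zR Zr {Phi sz_Phi} => [|h u v] // /andP[rl1 bl1] IHr zR Zr.
  have := size_sides h u v; case Ds: (sides (Node h u v)) => [|phi [|psi Psi]] // _.
  by rewrite -Ds IHr // rl1 [root_base _]/= bl1 !mul1r.
apply: side_id => // [|n0]; last exact: IHr.
case: r next zR {IHr Zr Phi sz_Phi} => [|h u v] //= next; rewrite /zero_right.
by case/orP=> // r1; move: next; rewrite r1 /= => ->.
Qed.

Lemma heavier_trans s t u : heavier s t -> heavier t u -> heavier s u.
Proof.
case=> nst hst [ntu htu]; split=> [|f sz_f]; first by rewrite nst.
by apply: ltn_trans (htu f sz_f) (hst f _); rewrite ntu.
Qed.

Lemma heavier_relabel s g g' l r : base_label g = base_label g' ->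
  heavier s (Node g l r) -> heavier s (Node g' l r).
Proof.
move=> bg [ns hs]; split=> [//|f sz_f]; have := hs f sz_f.
by rewrite /plug /= /tree_cost bg.
Qed.

Lemma heavier_pair g g' l l' r r' : base_label g = base_label g' ->
  l = l' \/ heavier l l' -> r = r' \/ heavier r r' -> heavier l l' \/ heavier r r' ->
  heavier (Node g l r) (Node g' l' r').
Proof.
move=> bg hl hr hlr; apply: heavier_relabel bg _.
case: (heavier_node g hl hr) => // -[Dl Dr].
by case: hlr => /heavier_neq.
Qed.

Lemma heavier_rotate b x y a z c d A B C : heavier (Node (tri b x y) A (Node (tri 1%g a z) B C))
  (Node (tri b c d) (Node (tri 1%g x a) A B) C).
Proof.
apply: (@heavier_sub3 _ _ (right2 (tri b x y) (tri 1%g a z)) (left2 (tri b c d) (tri 1%g x a))) => //.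
by move=> A' B' C'; rewrite sub3_left2 sub3_right2 /= /tree_cost !base_tri eqxx; lia.
Qed.

Lemma heavier_rebase b x y x' y' l r : b != 1%g ->
  heavier (Node (tri b x y) l r) (Node (tri 1%g x' y') l r).
Proof.
move=> b_neq1; split=> // f sz_f.
by rewrite /plug /= /tree_cost !base_tri eqxx b_neq1; lia.
Qed.

Definition comb_label (S : seq (M * btree)) : M := if S is [:: x] then x.1 else 1%g.

(* The base label b is ignored when S has only one element. *)
Fixpoint comb b (S : seq (M * btree)) : btree :=
  match S with
  | [::] => Leaf
  | x :: S' => if S' is [::] then x.2
               else Node (tri b x.1 (comb_label S')) x.2 (comb 1%g S')
  end.

Lemma comb_cons b x S : S <> [::] ->
  comb b (x :: S) = Node (tri b x.1 (comb_label S)) x.2 (comb 1%g S).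
Proof. by case: S. Qed.

Lemma comb_side_trees g l r : comb (base_label g) (side_trees (Node g l r)) = Node g l r.
Proof.
elim: r g l => [|h r1 _ r2 IHr] g l; first by rewrite /= tri_eta.
rewrite -/(side_trees _) [side_trees _]/= -/(extends g (Node h r1 r2)).
case: ifP => [/andP[/eqP rg /eqP bh]|_]; last by rewrite /= tri_eta.
rewrite -/(side_trees (Node h r1 r2)) comb_cons // -bh IHr.
rewrite (_ : comb_label _ = 1%g) -?rg ?tri_eta //=.
by case: ifP => //; case: r2 {IHr}.
Qed.

(** A comb cut after the block S is reached from the right comb by rotations of right edges into
    left ones, each of which decreases the weight. *)
Lemma heavier_comb b x y S S' : (1 < size S)%N -> S' <> [::] ->
  heavier (comb b (S ++ S')) (Node (tri b x y) (comb 1%g S) (comb 1%g S')).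
Proof.
elim: S b x y => // p [//|q S] IHS b x y _ S'n.
have cons_neq0 (v : seq (M * btree)) : (q :: v) <> [::] by [].
rewrite [(p :: q :: S) ++ S']/= (@comb_cons _ p (q :: S ++ S')) // (@comb_cons _ p (q :: S)) //.
have [S0|Sn] := eqVneq S [::].
  by rewrite S0 cat0s (comb_cons _ _ S'n); exact: heavier_rotate.
pose X := Node (tri 1%g (comb_label (q :: S)) 1%g) (comb 1%g (q :: S)) (comb 1%g S').
have lt_S : heavier (comb 1%g (q :: S ++ S')) X.
  by apply: IHS => //; case: S Sn {X}.
(* The induction separates the tail of S from S' inside the right child, and a last rotation brings
   p.2 into the left block. *)
apply: (@heavier_trans _ (Node (tri b p.1 1%g) p.2 X)); last exact: heavier_rotate.
by apply: heavier_pair; rewrite ?base_tri //; [left | right | right].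
Qed.

(** Needed because [cells] does not see the base label of the root. *)
Definition rebase b s := if s is Node h l r then Node (tri b (left_label h) (right_label h)) l r else Leaf.

Lemma rebase_id s : rebase (root_base s) s = s.
Proof. by case: s => //= h l r; rewrite tri_eta. Qed.

Definition leads (x : M * btree) := forall a s, side_of x a s != 0 ->
  (a = x.1 /\ s = x.2) \/ heavier x.2 s.

Lemma sum_nat_neq0 m (F : nat -> K) : \sum_(1 <= j < m) F j != 0 ->
  exists2 j, (0 < j < m)%N & F j != 0.
Proof.
move=> nz; apply: contrapT => none; case/eqP: nz; rewrite big_nat big1 // => j lt_j.
by apply: contrapT => nzF; apply: none; exists j => //; apply/eqP.
Qed.

(** A first cut at j > 1 gives a tree lighter than the right comb by [heavier_comb]. The cut j = 1
    reproduces the comb, up to lighter terms in the sides and in the rest of the cell. *)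
Lemma cells_lead s b (S : seq (M * btree)) : (forall x, x \in S -> leads x) ->
  cells (map side_of S) s != 0 -> comb b S = rebase b s \/ heavier (comb b S) (rebase b s).
Proof.
elim: s b S => [|h L IHL R IHR] b S leadS; first by rewrite eqxx.
rewrite cells_node size_map => /sum_nat_neq0[j /andP[j_gt0 lt_j]].
rewrite mulf_eq0 negb_or -map_take -map_drop => /andP[nzL nzR].
have part_lead (S1 : seq (M * btree)) a T : (forall x, x \in S1 -> leads x) -> (0 < size S1)%N ->
    (forall b S, (forall x, x \in S -> leads x) -> cells (map side_of S) T != 0 ->
       comb b S = rebase b T \/ heavier (comb b S) (rebase b T)) ->
    part (map side_of S1) a T != 0 ->
    (comb_label S1 = a /\ comb 1%g S1 = T) \/ heavier (comb 1%g S1) T.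
  move=> lead1 sz1 IH; have [sz1'|sz_neq1] := eqVneq (size S1) 1%N.
    case: S1 sz1' lead1 {sz1} => [|x []] //= _ lead1.
    by move=> /(lead1 x (mem_head _ _))[[-> ->]|]; [left|right].
  rewrite (_ : part _ a T = (a == 1%g)%:R * (root_base T == 1%g)%:R * cells (map side_of S1) T).
    case: (a =P 1%g) => [->|_]; last by rewrite !mul0r eqxx.
    case: (root_base T =P 1%g) => [bT|_]; last by rewrite mulr0 mul0r eqxx.
    rewrite !mul1r => /(IH 1%g _ lead1); rewrite -bT rebase_id bT => -[DT|]; last by right.
    by left; split=> //; case: S1 sz_neq1 {lead1 sz1 DT} => [|x []].
  by case: S1 sz_neq1 {lead1 sz1} => [|x []].
have leadL x : x \in take j S -> leads x by move=> /mem_take/leadS.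
have leadR x : x \in drop j S -> leads x by move=> /mem_drop/leadS.
have szL : (0 < size (take j S))%N by rewrite size_takel // ltnW.
have szR : (0 < size (drop j S))%N by rewrite size_drop subn_gt0.
have hL := part_lead _ _ _ leadL szL IHL nzL.
have hR := part_lead _ _ _ leadR szR IHR nzR.
have hL' : comb 1%g (take j S) = L \/ heavier (comb 1%g (take j S)) L.
  by case: hL => [[_ ->]|]; [left|right].
have hR' : comb 1%g (drop j S) = R \/ heavier (comb 1%g (drop j S)) R.
  by case: hR => [[_ ->]|]; [left|right].
have Sn : drop j S <> [::] by case: (drop j S) szR.
case: (ltnP 1 j) => [j_gt1|j_le1].
  have hS : heavier (comb b S) (Node (tri b (left_label h) (right_label h))
      (comb 1%g (take j S)) (comb 1%g (drop j S))).
    by rewrite -{1}[S](cat_take_drop j); apply: heavier_comb => //; rewrite size_takel // ltnW.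
  right; rewrite [rebase b _]/=.
  case: (heavier_node (tri b (left_label h) (right_label h)) hL' hR') => [<- //|].
  exact: heavier_trans hS.
have j1 : j = 1%N by lia.
subst j; case: S leadS lt_j nzL nzR leadL leadR szL szR hL hR hL' hR' Sn => // x S _ _ _ _ _ _ _ _.
have -> : take 1 (x :: S) = [:: x] by rewrite /= take0.
have -> : drop 1 (x :: S) = S by rewrite /= drop0.
move=> hL hR hL' hR' Sn; rewrite comb_cons // [rebase b _]/=.
case: hL => [[DxL DL]|hL]; last by right; apply: heavier_pair => //; rewrite ?base_tri //; left.
case: hR => [[DxR DR]|hR]; last by right; apply: heavier_pair => //; rewrite ?base_tri //; right.
by left; rewrite -DxL -DxR -DL -DR.
Qed.

Lemma side_trees_nodes t x : x \in side_trees t -> (nodes x.2 < nodes t)%N.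
Proof.
elim: t => //= g l _ r IHr; rewrite inE => /orP[/eqP->|] /=; first by lia.
case: ifP => _; first by move=> /IHr; lia.
by rewrite inE => /eqP-> /=; lia.
Qed.

(** The sides of t carry smaller trees, hence the induction on nodes. The correction term (a * b, 1)
    only changes a base label b <> 1 into 1, which makes the tree lighter. *)
Lemma side_leads x : leads x.
Proof.
case: x => a t; elim/ltn_ind: {t}(nodes t) {-2}t (erefl (nodes t)) a => n IHn t Dn a.
have lead_t x : x \in side_trees t -> leads x.
  by case: x => c u /side_trees_nodes /=; rewrite Dn => /IHn; apply.
move=> x s; rewrite /side_of /=; case: t Dn lead_t => [|g l r] Dn lead_t.
  case: s => [|h u v]; last by rewrite eqxx.
  by rewrite /=; case: (x =P a) => [-> _|_]; [left | rewrite eqxx].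
case: s => [|h u v]; first by rewrite eqxx.
rewrite mulf_eq0 negb_or sides_map => /andP[nz /(cells_lead (base_label g) lead_t)].
rewrite comb_side_trees /= => ht; move: nz => /=.
have [bh|bh] := eqVneq (base_label h) (base_label g).
  rewrite -bh tri_eta in ht; rewrite bh.
  case: ht => [Dt|]; last by right.
  (* If b = 1 the pairs (a, b) and (a * b, 1) coincide and the side is zero. *)
  have [bg|bg] := eqVneq (base_label g) 1%g.
    by rewrite bg mulg1 subrr eqxx.
  by rewrite !andbT andbF subr0; case: (x =P a) => [-> _|_]; [left; rewrite Dt | rewrite eqxx].
rewrite andbF sub0r oppr_eq0; case: (base_label h =P 1%g) => [bh1 _|_]; last first.
  by rewrite andbF eqxx.
have heavy : heavier (Node (tri (base_label g) (left_label h) (right_label h)) u v) (Node h u v).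
  have -> : Node h u v = Node (tri 1%g (left_label h) (right_label h)) u v.
    by rewrite -bh1 tri_eta.
  by apply: heavier_rebase; rewrite -bh1 eq_sym.
by right; case: ht => [->|/heavier_trans]; [|apply].
Qed.

Lemma dual_elt_lead t s : (0 < nodes t)%N -> dual_elt t s != 0 -> t = s \/ heavier t s.
Proof.
case: t => // g l r _; rewrite mulf_eq0 negb_or => /andP[].
case: (root_base s =P _) => [bs _|_]; last by rewrite eqxx.
rewrite sides_map => /(cells_lead (base_label g)); rewrite comb_side_trees.
have := rebase_id s; rewrite bs /= => ->.
by apply=> x _; exact: side_leads.
Qed.

Lemma dual_elt_id t : (0 < nodes t)%N -> Z_tree t -> dual_elt t t = 1.
Proof. by move=> n0 Zt; rewrite /dual_elt eqxx mul1r cells_id. Qed.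

End DualBasis.

Theorem theorem3p3 (K : fieldType) (charK : [pchar K] =i pred0)
    (M : finUMagmaType) :
  [/\ binary_quadratic (NC K M),
      koszul (NC K M)
    & isomorphic (NC K M) (presented (@NC_relations K M))].
Proof.
have NC_iso := NC_presented K M.
split=> //; first by exists (triangle M : finType), (@NC_relations K M).
exists (triangle M : finType), (@NC_relations K M); split=> //.
apply: (@koszul_acyclic_PBW K (triangle M) (@NC_relations K M) (@nf M) (@nodes_nf M)
  (@nf_graftl M) (@nf_graftr M) (@R_nf K M) (@nf_ideal K M) (@zero_left M) (@zero_right M)
  (@F_tree_nf M) (@nf_F_tree M) (@tree_cost M) (@weight_nf K M) (@weight_sub3 K M)
  (@dual_elt K M)).
- by move=> t _ _; exact: dual_elt_dual.
- by move=> t; exact: dual_elt_id.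
by move=> t s n0 _; exact: dual_elt_lead.
Qed.
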